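(* Let $\Bbbk$ be an algebraically closed field of arbitrary characteristic, let $M$ be a free abelian group of rank $n$, and let $A=\{u_0,\ldots,u_N\}\subset M$ be a finite subset with $\operatorname{Aff}(A)=M$. Assume that the Gauss map $\gamma$ of $X_A\subset\mathbb{P}^N$ is separable, and set $l=\delta_\gamma(X_A)$. Then there exist finite subsets $A^0,\ldots,A^l\subset\mathbb{Z}^{n-l}$ with $\sum_{j=0}^{l}\dim\operatorname{Aff}_{\Bbbk}(A^j)=n-l$ such that $A$ is identified with the Cayley sum of $A^0,\ldots,A^l\subset\mathbb{Z}^{n-l}$ under some affine isomorphism $M\simeq\mathbb{Z}^{n-l}\times\mathbb{Z}^l$.
   Context: For a free abelian group $M$ of finite rank, $T_M=\operatorname{Spec}\Bbbk[M]$, where $\Bbbk[M]=\bigoplus_{u\in M}\Bbbk z^u$, and $M_{\Bbbk}=M\otimes_{\mathbb{Z}}\Bbbk$. For a finite subset $A=\{u_0,\ldots,u_N\}\subset M$ (distinct elements), $X_A\subset\mathbb{P}^N$ is the closure of the image of $T_M\to\mathbb{P}^N$, $t\mapsto[z^{u_0}(t):\cdots:z^{u_N}(t)]$. $\operatorname{Aff}(A)\subset M$ is the set of all $\sum_i a_iu_i$ with $a_i\in\mathbb{Z}$, $\sum_i a_i=1$; $\operatorname{Aff}_{\Bbbk}(A)\subset M_{\Bbbk}$ is the $\Bbbk$-affine subspace of all $\sum_i a_iu_i$ (in $M_{\Bbbk}$) with $a_i\in\Bbbk$, $\sum_i a_i=1$. The Gauss map of an $n$-dimensional projective variety $X\subset\mathbb{P}^N$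 is the rational map $\gamma: X\dashrightarrow\mathbb{G}(n,\mathbb{P}^N)$ sending each smooth point $x$ to the embedded tangent space $\mathbb{T}_xX\subset\mathbb{P}^N$; the Gauss defect $\delta_\gamma(X)$ is the dimension of a general fiber of $\gamma$. $\gamma$ is separable if the field extension $K(X)/K(\gamma(X))$ is separable. Cayley sum: for non-negative integers $l\le n$, the standard basis $e_1,\ldots,e_l$ of $\mathbb{Z}^l$, and finite sets $A^0,\ldots,A^l\subset\mathbb{Z}^{n-l}$, $$A^0*\cdots*A^l:=(A^0\times\{0\})\cup(A^1\times\{e_1\})\cup\cdots\cup(A^l\times\{e_l\})\subset\mathbb{Z}^{n-l}\times\mathbb{Z}^l.$$ *)

(* Defs.v *)
From HB Require Import structures.
From mathcomp Require Import all_boot all_order all_algebra.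
From mathcomp Require Import ring_quotient fraction separable.
From mathcomp Require Import boolp classical_sets.
From mathcomp Require Import finmap mpoly.

Set Implicit Arguments.
Unset Strict Implicit.
Unset Printing Implicit Defensive.

Import GRing.Theory.

Local Open Scope classical_set_scope.
Local Open Scope ring_scope.
Local Open Scope quotient_scope.

Local Notation "x %:F" := (@FracField.tofrac _ x).


(* Subsets of P^N are represented by the sets of homogeneous coordinate
   vectors x != 0 of their points; such sets are stable under scaling. *)

Section ProjectiveSets.
Variables (k : closedFieldType) (N : nat).
Implicit Types (F : {mpoly k[N.+1]}) (x : 'rV[k]_N.+1) (Y Z : set 'rV[k]_N.+1).

Definition proj_zeros (S : set {mpoly k[N.+1]}) : set 'rV[k]_N.+1 :=
  [set x : 'rV[k]_N.+1 | x != 0 /\ forall F, S F -> F.@[x 0] = 0].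

Definition proj_closed Z : Prop :=
  exists S : set {mpoly k[N.+1]},
    (forall F, S F -> F \is homog mdeg) /\ Z = proj_zeros S.

Definition proj_closure Y : set 'rV[k]_N.+1 :=
  proj_zeros [set F | F \is homog mdeg /\ forall x, Y x -> F.@[x 0] = 0].

Definition proj_irreducible Y : Prop :=
  Y !=set0 /\
  forall Z1 Z2, proj_closed Z1 -> proj_closed Z2 -> Y `<=` Z1 `|` Z2 ->
    Y `<=` Z1 \/ Y `<=` Z2.

Definition rel_closed Y Z : Prop := exists2 C, proj_closed C & Z = Y `&` C.

Definition irr_chain Y (d : nat) : Prop :=
  exists Z : nat -> set 'rV[k]_N.+1,
    (forall i, (i <= d)%N -> rel_closed Y (Z i) /\ proj_irreducible (Z i)) /\
    (forall i, (i < d)%N -> Z i `<` Z i.+1).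

(* Krull dimension of Y for the induced Zariski topology (0 if Y is empty). *)
Definition dimension Y : nat :=
  xget 0%N [set d | irr_chain Y d /\ forall e, irr_chain Y e -> (e <= d)%N].

Record proj_variety := ProjVariety {
  pv_set :> set 'rV[k]_N.+1;
  pv_closed : proj_closed pv_set;
  pv_irreducible : proj_irreducible pv_set }.

End ProjectiveSets.

Section CoordinateRing.
Variables (k : closedFieldType) (N : nat) (X : proj_variety k N).

Definition pv_ideal : {mpoly k[N.+1]} -> bool :=
  fun F => `[< forall x, pv_set X x -> F.@[x 0] = 0 >].

Lemma pv_idealP F :
  reflect (forall x, pv_set X x -> F.@[x 0] = 0) (F \in pv_ideal).
Proof. exact: asboolP. Qed.

Lemma meval_dhomogZ d (F : {mpoly k[N.+1]}) (c : k) (x : 'rV[k]_N.+1) :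
  F \is d.-homog -> F.@[(c *: x) 0] = c ^+ d * F.@[x 0].
Proof.
move=> /dhomogP hF; rewrite !mevalE mulr_sumr !big_seq; apply: eq_bigr => m mF.
rewrite mulrCA; congr (_ * _); have <- : mdeg m = d := hF m mF; rewrite mdegE -prodrXr -big_split /=.
by apply: eq_bigr => i _; rewrite mxE exprMn.
Qed.

Lemma pvZ (c : k) (x : 'rV[k]_N.+1) :
  c != 0 -> pv_set X x -> pv_set X (c *: x).
Proof.
have [S [Sh ->]] := pv_closed X => c0 [x0 xS]; split=> [|F SF].
  by rewrite scaler_eq0 negb_or c0.
have /homogP[d Fd] := Sh F SF.
by rewrite (meval_dhomogZ _ _ Fd) xS ?mulr0.
Qed.

Lemma pv_ideal_closed : idealr_closed pv_ideal.
Proof.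
split.
- by apply/pv_idealP => x _; rewrite meval0.
- have [[x Xx] _] := pv_irreducible X.
  by apply/negP => /pv_idealP/(_ x Xx)/eqP; rewrite meval1 oner_eq0.
- move=> F G H /pv_idealP hG /pv_idealP hH; apply/pv_idealP => x Xx.
  by rewrite mevalD mevalM hG // hH // mulr0 addr0.
Qed.

Let comp_zeros (F : {mpoly k[N.+1]}) :=
  proj_zeros [set G | exists d, G = pihomog mdeg d F].

Let comp_poly (F : {mpoly k[N.+1]}) (x : 'rV[k]_N.+1) : {poly k} :=
  \poly_(d < mmeasure mdeg F) (pihomog mdeg d F).@[x 0].

Let comp_closed F : proj_closed (comp_zeros F).
Proof.
exists [set G | exists d, G = pihomog mdeg d F]; split=> // G [d ->].
by apply/homogP; exists d; apply: pihomogP.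
Qed.

Let comp_sum (F : {mpoly k[N.+1]}) (x : 'rV[k]_N.+1) (c : k) :
  F.@[(c *: x) 0] = (comp_poly F x).[c].
Proof.
rewrite {1}(pihomog_partitionE (leqnn (mmeasure mdeg F))) raddf_sum /=.
rewrite horner_poly; apply: eq_bigr => d _.
by rewrite (meval_dhomogZ _ _ (pihomogP _ d F)) mulrC.
Qed.

Let comp_in F : pv_set X `<=` comp_zeros F -> F \in pv_ideal.
Proof.
move=> XF; apply/pv_idealP => x Xx.
rewrite -[x]scale1r comp_sum horner_poly big1 // => d _.
by rewrite (proj2 (XF x Xx)) ?mul0r //; exists d.
Qed.

Let comp_nin F x :
  pv_set X x -> ~ comp_zeros F x -> comp_poly F x != 0.
Proof.
move=> Xx nF; apply/eqP => F0; apply: nF; split.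
  by have [S [_ XS]] := pv_closed X; move: Xx; rewrite XS => -[].
move=> _ [d ->]; have := congr1 (fun p : {poly k} => p`_d) F0.
rewrite coef_poly coef0; case: ifP => // /negbT; rewrite -leqNgt => le_d _.
rewrite pihomogE big_seq_cond big1 ?meval0 // => m /andP[mF /eqP md].
by have := mmeasure_mnm_lt mdeg mF; rewrite md ltnNge le_d.
Qed.

Lemma pv_ideal_prime : prime_idealr_closed pv_ideal.
Proof.
move=> F G /pv_idealP FG; apply/orP.
have [|XF|XG] := proj2 (pv_irreducible X) _ _ (comp_closed F) (comp_closed G).
- move=> x Xx; apply: contrapT => /not_orP[nF nG].
  have : comp_poly F x * comp_poly G x * 'X != 0.
    by rewrite !mulf_neq0 ?polyX_eq0 ?comp_nin.
  case/closed_nonrootP => c; rewrite rootE !hornerM hornerX.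
  rewrite !mulf_eq0 !negb_or -!comp_sum => /andP[/andP[Fc Gc] c0].
  have /eqP := FG _ (pvZ c0 Xx); rewrite mevalM mulf_eq0.
  by rewrite (negPf Fc) (negPf Gc).
- by left; apply: comp_in.
- by right; apply: comp_in.
Qed.

HB.instance Definition _ := isIdealr.Build _ pv_ideal pv_ideal_closed.
HB.instance Definition _ := isPrimeIdealrClosed.Build _ pv_ideal pv_ideal_prime.

Definition pv_prime : prime_idealr {mpoly k[N.+1]} :=
  PrimeIdealr.clone _ pv_ideal _.

Definition coord_ring : Type := {ideal_quot pv_prime}.

HB.instance Definition _ := GRing.ComNzRing.on coord_ring.

Let coord_unit : pred coord_ring := fun f => `[< exists g, g * f = 1 >].
Let coord_inv (f : coord_ring) : coord_ring :=
  if pselect (exists g, g * f = 1) is left h then projT1 (cid h) else f.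

Let coord_mulVr : {in coord_unit, left_inverse 1 coord_inv *%R}.
Proof.
move=> f /asboolP hf; rewrite /coord_inv.
by case: pselect => // h; case: (cid h).
Qed.

Let coord_unitP f g : g * f = 1 -> coord_unit f.
Proof. by move=> gf; apply/asboolP; exists g. Qed.

Let coord_inv_out : {in [predC coord_unit], coord_inv =1 id}.
Proof.
move=> f /negP hf; rewrite /coord_inv; case: pselect => // h.
by case: hf; apply/asboolP.
Qed.

HB.instance Definition _ := GRing.ComNzRing_hasMulInverse.Build coord_ring
  coord_mulVr coord_unitP coord_inv_out.

Let coord_integral : GRing.integral_domain_axiom coord_ring.
Proof. by move=> f g; apply: (@Quotient.rquot_IdomainAxiom _ pv_prime). Qed.

HB.instance Definition _ :=
  GRing.ComUnitRing_isIntegral.Build coord_ring coord_integral.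

Definition coord_class (F : {mpoly k[N.+1]}) : coord_ring :=
  \pi_{ideal_quot pv_prime} F.

Definition coord_frac (F G : {mpoly k[N.+1]}) : {fraction coord_ring} :=
  (coord_class F)%:F / (coord_class G)%:F.

(* K(X), as the subfield of degree-0 homogeneous fractions *)
Definition function_field : set {fraction coord_ring} :=
  [set phi | exists d F G, [/\ F \is d.-homog, G \is d.-homog,
     G \notin pv_ideal & phi = coord_frac F G]].

End CoordinateRing.

Arguments function_field {k N} X _.

Section GaussMap.
Variables (k : closedFieldType) (N : nat) (X : proj_variety k N).

(* Affine cone in k^(N+1) over the embedded tangent space at x. *)
Definition tangent_space (x : 'rV[k]_N.+1) : set 'rV[k]_N.+1 :=
  [set v | forall F : {mpoly k[N.+1]}, F \in pv_ideal X ->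
     \sum_i (F^`M(i)).@[x 0] * v 0 i = 0].

(* The rows of B form a basis of the linear subspace W. *)
Definition row_basis (m : nat) (B : 'M[k]_(m, N.+1)) (W : set 'rV[k]_N.+1) :=
  row_free B /\ W = [set v | (v <= B)%MS].

Definition smooth : set 'rV[k]_N.+1 :=
  [set x | pv_set X x /\
     exists B : 'M[k]_((dimension X).+1, N.+1), row_basis B (tangent_space x)].

Definition gauss_fiber (x : 'rV[k]_N.+1) : set 'rV[k]_N.+1 :=
  [set y | smooth y /\ tangent_space y = tangent_space x].

(* The points of the open subset smooth X \ C of X are the general ones. *)
Definition general_fiber_dim (d : nat) : Prop :=
  exists C, [/\ proj_closed C, ~ smooth `<=` C &
    forall x, smooth x -> ~ C x -> dimension (gauss_fiber x) = d].

Definition gauss_defect : nat := xget 0%N [set d | general_fiber_dim d].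

Definition plucker_index : finType :=
  {J : {ffun 'I_(dimension X).+1 -> 'I_N.+1} |
    [forall i : 'I__, forall j : 'I__, (i < j)%N ==> (J i < J j)%N]}.

Definition plucker (B : 'M[k]_((dimension X).+1, N.+1)) :
    'I_#|plucker_index| -> k :=
  fun a => \det (colsub (val (enum_val a)) B).

(* Image of the pull-back K(gamma(X)) -> K(X): the rational functions F / G on
   X that agree on smooth points with P / Q at the Pluecker coordinates of the
   tangent space, where Q does not vanish identically on gamma(X). *)
Definition gauss_field : set {fraction coord_ring X} :=
  [set phi | exists d (F G : {mpoly k[N.+1]})
                    e (P Q : {mpoly k[#|plucker_index|]}),
     [/\ [/\ F \is d.-homog, G \is d.-homog & G \notin pv_ideal X],
         [/\ P \is e.-homog, Q \is e.-homog &
           exists x B, [/\ smooth x, row_basis B (tangent_space x) &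
             Q.@[plucker B] != 0]],
         forall x B, smooth x -> row_basis B (tangent_space x) ->
           F.@[x 0] * Q.@[plucker B] = G.@[x 0] * P.@[plucker B] &
         phi = coord_frac X F G]].

End GaussMap.

Arguments gauss_field {k N} X _.

Section SeparableExtensions.
Variable L : fieldType.
Implicit Types (E F S : set L) (x : L).

Definition is_subfield E : Prop := divring_closed (mem E).

Definition adjoin F S : set L := smallest is_subfield (F `|` S).

Definition is_min_poly F x (p : {poly L}) : Prop :=
  [/\ p \is monic, p \is a polyOver (mem F), root p x &
    forall q, q \is a polyOver (mem F) -> root q x -> q != 0 ->
      (size p <= size q)%N].

Definition separable_over F x : Prop :=
  exists2 p, is_min_poly F x p & separable_poly p.

Definition alg_independent F (r : nat) (b : 'I_r -> L) : Prop :=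
  forall P : {mpoly L[r]}, P \is a mpolyOver r (mem F) -> P.@[b] = 0 -> P = 0.

Definition separably_generated F E : Prop :=
  exists (r : nat) (b : 'I_r -> L),
    [/\ forall i, E (b i), alg_independent F b &
      forall x, E x -> separable_over (adjoin F (range b)) x].

(* E / F is not assumed algebraic: every finitely generated subextension has a
   separating transcendence basis. *)
Definition separable_extension F E : Prop :=
  forall s : seq L, [set` s] `<=` E -> separably_generated F (adjoin F [set` s]).

End SeparableExtensions.

Definition gauss_separable (k : closedFieldType) (N : nat)
    (X : proj_variety k N) : Prop :=
  separable_extension (gauss_field X) (function_field X).

Definition free_of_rank (M : zmodType) (n : nat) : Prop :=
  exists f : {additive 'rV[int]_n -> M}, bijective f.

Section ToricVariety.
Variables (k : closedFieldType) (M : zmodType).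

(* k-points of T_M = Spec k[M], i.e. homomorphisms M -> k^*; the value at t of
   the character z^u is t u. *)
Definition torus_point (t : M -> k) : Prop :=
  t 0 = 1 /\ forall u v, t (u + v) = t u * t v.

Lemma torus_neq0 t v : torus_point t -> t v != 0.
Proof.
move=> [t0 tD]; apply/eqP => tv0; have /eqP := tD v (- v).
by rewrite subrr t0 tv0 mul0r oner_eq0.
Qed.

Lemma torusMz t v (z : int) : torus_point t -> t (v *~ z) = t v ^ z.
Proof.
move=> ht; have [t0 tD] := ht.
have tMn w m : t (w *+ m) = t w ^+ m.
  by elim: m => [|m IH]; rewrite ?mulr0n ?expr0 // mulrS tD IH exprS.
case: z => m; first exact: tMn.
rewrite NegzE mulrNz -exprz_inv; apply: (mulfI (torus_neq0 (v *+ m.+1) ht)).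
rewrite -tD subrr t0 tMn; have v0 := torus_neq0 v ht.
by rewrite -exprnP exprVn divff ?expf_neq0.
Qed.

Lemma torus_basis n (f : {additive 'rV[int]_n -> M}) t (w : 'rV[int]_n) :
  torus_point t -> t (f w) = \prod_i t (f (delta_mx 0 i)) ^ (w 0 i).
Proof.
move=> ht; have [t0 tD] := ht; rewrite {1}[w]row_sum_delta raddf_sum.
rewrite (big_morph t tD t0); apply: eq_bigr => i _.
by rewrite -{1}[w 0 i]intz scaler_int raddfMz torusMz.
Qed.

Variables (N : nat) (u : 'I_N.+1 -> M).

Definition toric_image : set 'rV[k]_N.+1 :=
  [set x | exists (c : k) (t : M -> k),
     [/\ c != 0, torus_point t & x = c *: \row_i t (u i)]].

Definition toric_set : set 'rV[k]_N.+1 := proj_closure toric_image.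

(* Functions of s that are regular where the polynomial q does not vanish. *)
Section RegularFunctions.
Variable q : {poly k}.

Let regular (g : k -> k) : Prop :=
  exists D (P : {poly k}), forall s, q.[s] != 0 -> q.[s] ^+ D * g s = P.[s].

Let regularC c : regular (fun=> c).
Proof. by exists 0%N, c%:P => s _; rewrite hornerC mul1r. Qed.

Let regularP (p : {poly k}) : regular (horner p).
Proof. by exists 0%N, p => s _; rewrite mul1r. Qed.

Let regularV (p h : {poly k}) : q = p * h -> regular (fun s => p.[s]^-1).
Proof.
move=> qE; exists 1%N, h => s; rewrite qE hornerM mulf_eq0 negb_or => /andP[p0 _].
by rewrite expr1 mulrAC divff ?mul1r.
Qed.

Let regularD g1 g2 :
  regular g1 -> regular g2 -> regular (fun s => g1 s + g2 s).
Proof.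
move=> [D1 [P1 h1]] [D2 [P2 h2]].
exists (D1 + D2)%N, (q ^+ D2 * P1 + q ^+ D1 * P2) => s qs.
rewrite hornerD !hornerM !horner_exp -h1 // -h2 // exprD.
by rewrite !mulrA [q.[s] ^+ D2 * _]mulrC mulrDr.
Qed.

Let regularM g1 g2 :
  regular g1 -> regular g2 -> regular (fun s => g1 s * g2 s).
Proof.
move=> [D1 [P1 h1]] [D2 [P2 h2]]; exists (D1 + D2)%N, (P1 * P2) => s qs.
by rewrite hornerM -h1 // -h2 // exprD mulrACA.
Qed.

Let regular_ext g1 g2 : g1 =1 g2 -> regular g1 -> regular g2.
Proof. by move=> e [D [P h]]; exists D, P => s qs; rewrite -e h. Qed.

Let regularX g m : regular g -> regular (fun s => g s ^+ m).
Proof.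
move=> hg; elim: m => [|m IH]; first exact: regularC.
by apply: regular_ext (regularM hg IH) => s; rewrite exprS.
Qed.

Let regular_sum I (r : seq I) (g : I -> k -> k) :
  (forall i, regular (g i)) -> regular (fun s => \sum_(i <- r) g i s).
Proof.
move=> hg; elim: r => [|i r IH].
  by apply: regular_ext (regularC 0) => s; rewrite big_nil.
by apply: regular_ext (regularD (hg i) IH) => s; rewrite big_cons.
Qed.

Let regular_prod I (r : seq I) (g : I -> k -> k) :
  (forall i, regular (g i)) -> regular (fun s => \prod_(i <- r) g i s).
Proof.
move=> hg; elim: r => [|i r IH].
  by apply: regular_ext (regularC 1) => s; rewrite big_nil.
by apply: regular_ext (regularM (hg i) IH) => s; rewrite big_cons.
Qed.

Let regular_exprz (p h : {poly k}) (z : int) :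
  q = p * h -> regular (fun s => p.[s] ^ z).
Proof.
move=> qE; case: z => m; first exact: regularX (regularP p).
apply: regular_ext (regularX m.+1 (regularV qE)) => s.
by rewrite NegzE -exprz_inv exprnP.
Qed.

Lemma laurent_meval r (z : 'I_N.+1 -> 'I_r -> int) (c : {poly k})
    (l : 'I_r -> {poly k}) (F : {mpoly k[N.+1]}) :
  q = c * \prod_j l j ->
  exists D (P : {poly k}), forall s, q.[s] != 0 ->
    q.[s] ^+ D *
      F.@[(\row_i (c.[s] * \prod_j (l j).[s] ^ (z i j)) : 'rV[k]_N.+1) 0] = P.[s].
Proof.
move=> qE; pose y i s := c.[s] * \prod_j (l j).[s] ^ (z i j).
have hy i : regular (y i).
  apply: regularM (regularP c) _; apply: regular_prod => j.
  apply: (@regular_exprz _ (c * \prod_(j' | j' != j) l j')).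
  by rewrite qE (bigD1 j) //= mulrCA.
have : regular (fun s => F.@[y^~ s]).
  apply: (@regular_ext (fun s => \sum_(m <- msupp F) F@_m * \prod_i y i s ^+ m i)).
    by move=> s; rewrite mevalE.
  apply: regular_sum => m; apply: regularM (regularC _) _.
  by apply: regular_prod => i; apply: regularX.
move=> [D [P h]]; exists D, P => s qs; rewrite -h //; congr (_ * _).
by apply: meval_eq => i; rewrite mxE.
Qed.

End RegularFunctions.

Lemma toric_image_meet n (F1 F2 : {mpoly k[N.+1]}) (x1 x2 : 'rV[k]_N.+1) :
  free_of_rank M n -> toric_image x1 -> toric_image x2 ->
  F1.@[x1 0] != 0 -> F2.@[x2 0] != 0 ->
  exists2 x, toric_image x & F1.@[x 0] != 0 /\ F2.@[x 0] != 0.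
Proof.
move=> [f [g fK gK]] [c1 [t1 [c1N ht1 ->]]] [c2 [t2 [c2N ht2 ->]]] F1x F2x.
have gD v w : g (v + w) = g v + g w.
  by apply: (can_inj fK); rewrite raddfD /= !gK.
have g0 : g 0 = 0 by apply: (can_inj fK); rewrite raddf0 gK.
pose line (a b : k) : {poly k} := a%:P + (b - a) *: 'X.
have line0 a b : (line a b).[0] = a by rewrite hornerD hornerC hornerZ hornerX mulr0 addr0.
have line1 a b : (line a b).[1] = b by rewrite hornerD hornerC hornerZ hornerX mulr1 addrC subrK.
pose c := line c1 c2.
pose l j := line (t1 (f (delta_mx 0 j))) (t2 (f (delta_mx 0 j))).
pose q := c * \prod_j l j.
pose t s v := \prod_j (l j).[s] ^ (g v 0 j).
pose y s : 'rV[k]_N.+1 := \row_i (c.[s] * t s (u i)).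
have y0 : y 0 = c1 *: \row_i t1 (u i).
  apply/rowP => i; rewrite !mxE line0 -{2}[u i]gK (torus_basis _ _ ht1).
  by congr (_ * _); apply: eq_bigr => j _; rewrite line0.
have y1 : y 1 = c2 *: \row_i t2 (u i).
  apply/rowP => i; rewrite !mxE line1 -{2}[u i]gK (torus_basis _ _ ht2).
  by congr (_ * _); apply: eq_bigr => j _; rewrite line1.
have q0 : q.[0] != 0.
  rewrite hornerM horner_prod line0 mulf_neq0 //.
  by apply/prodf_neq0 => j _; rewrite line0 torus_neq0.
have q1 : q.[1] != 0.
  rewrite hornerM horner_prod line1 mulf_neq0 //.
  by apply/prodf_neq0 => j _; rewrite line1 torus_neq0.
have [D1 [P1 h1]] := laurent_meval (fun i j => g (u i) 0 j) F1 (erefl q).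
have [D2 [P2 h2]] := laurent_meval (fun i j => g (u i) 0 j) F2 (erefl q).
have P1N : P1 != 0.
  apply: contraNneq F1x => P0; have /eqP := h1 0 q0; rewrite P0 horner0.
  by rewrite mulf_eq0 expf_eq0 (negPf q0) andbF /= -/(t 0) -/(y 0) y0.
have P2N : P2 != 0.
  apply: contraNneq F2x => P0; have /eqP := h2 1 q1; rewrite P0 horner0.
  by rewrite mulf_eq0 expf_eq0 (negPf q1) andbF /= -/(t 1) -/(y 1) y1.
have qN : q != 0 by apply: contraNneq q0 => ->; rewrite horner0.
have : q * P1 * P2 != 0 := mulf_neq0 (mulf_neq0 qN P1N) P2N.
case/closed_nonrootP => s; rewrite rootE (hornerM (q * P1)) (hornerM q).
rewrite !mulf_eq0 !negb_or => /andP[/andP[qs P1s] P2s].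
exists (y s); last split.
- have := qs; rewrite hornerM horner_prod mulf_eq0 negb_or => /andP[cs].
  move=> /prodf_neq0 ls; exists c.[s], (t s); split=> //; last first.
    by apply/rowP => i; rewrite !mxE.
  split=> [|v w]; first by rewrite /t g0 big1 // => j _; rewrite mxE expr0z.
  rewrite /t gD -big_split /=; apply: eq_bigr => j _.
  by rewrite mxE expfzDr ?ls.
- by apply: contraNneq P1s => F0; rewrite -h1 // -/(t s) -/(y s) F0 mulr0.
- by apply: contraNneq P2s => F0; rewrite -h2 // -/(t s) -/(y s) F0 mulr0.
Qed.

Lemma toric_image_sub : toric_image `<=` toric_set.
Proof.
move=> x xI; split; last by move=> F [_]; apply.
have [c [t [cN ht ->]]] := xI; rewrite scaler_eq0 negb_or cN /=.
apply/eqP => /rowP/(_ 0)/eqP; rewrite !mxE; exact/negP/torus_neq0.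
Qed.

Lemma toric_set_closed : proj_closed toric_set.
Proof.
exists [set F : {mpoly k[N.+1]} |
  F \is homog mdeg /\ forall x, toric_image x -> F.@[x 0] = 0].
by split=> // F [].
Qed.

Lemma toric_set_irreducible n : free_of_rank M n -> proj_irreducible toric_set.
Proof.
move=> hM; split.
  exists (1 *: \row_i (fun=> 1) (u i)); apply: toric_image_sub.
  by exists 1, (fun=> 1); split=> //; [apply: oner_neq0 | split=> // *; rewrite mulr1].
move=> Z1 Z2 Z1c Z2c sub; apply: contrapT => /not_orP[n1 n2].
have nonvanishing Z : proj_closed Z -> ~ toric_set `<=` Z ->
    exists F, (forall x, Z x -> F.@[x 0] = 0) /\
      exists2 x, toric_image x & F.@[x 0] != 0.
  move=> [S [Sh ->]] nZ; apply: contrapT => no; apply: nZ => x [xN xI].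
  split=> // F SF; apply: xI; split; first exact: Sh.
  move=> y yI; apply/eqP/negP => /negP Fy; apply: no; exists F; split.
    by move=> z [_]; apply.
  by exists y.
have [F1 [F1Z [x1 x1I F1x]]] := nonvanishing _ Z1c n1.
have [F2 [F2Z [x2 x2I F2x]]] := nonvanishing _ Z2c n2.
have [x xI [F1N F2N]] := toric_image_meet hM x1I x2I F1x F2x.
by have [/F1Z/eqP|/F2Z/eqP] := sub x (toric_image_sub xI); apply/negP.
Qed.

Definition toric_variety n (hM : free_of_rank M n) : proj_variety k N :=
  ProjVariety toric_set_closed (toric_set_irreducible hM).

End ToricVariety.

Arguments toric_variety k {M N} u {n} hM.

(* Aff(A) for A the set of values of u. *)
Definition affZ (M : zmodType) (N : nat) (u : 'I_N.+1 -> M) : set M :=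
  [set v | exists a : 'I_N.+1 -> int,
     \sum_i a i = 1 /\ v = \sum_i u i *~ a i].

(* Aff_k(A) in Z^m (x) k = k^m. *)
Definition affK (k : fieldType) (m : nat) (A : {fset 'rV[int]_m}) :
    set 'rV[k]_m :=
  [set v | exists a : 'rV[int]_m -> k,
     \sum_(w <- A) a w = 1 /\ v = \sum_(w <- A) a w *: map_mx intr w].

Arguments affK k {m} A _.

Definition affine_dim (k : fieldType) (m : nat) (E : set 'rV[k]_m) (d : nat) :
    Prop :=
  exists (v : 'rV[k]_m) (W : 'M[k]_m),
    \rank W = d /\ E = [set v + w | w in [set w | (w <= W)%MS]].

(* ord0 |-> 0 and j+1 |-> e_(j+1), the standard basis of Z^l *)
Definition cayley_vertex (l : nat) (j : 'I_l.+1) : 'rV[int]_l :=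
  if unlift ord0 j is Some i then delta_mx 0 i else 0.

Definition cayley_sum (m l : nat) (A : 'I_l.+1 -> {fset 'rV[int]_m}) :
    set ('rV[int]_m * 'rV[int]_l) :=
  [set p | exists j, p.1 \in A j /\ p.2 = cayley_vertex j].

Definition affine_iso (M M' : zmodType) (phi : M -> M') : Prop :=
  exists (f : {additive M -> M'}) (c : M'),
    bijective f /\ forall v, phi v = f v + c.

(* Main.v *)
From HB Require Import structures.
Require Import Defs.
From mathcomp Require Import all_boot all_order all_algebra.
From mathcomp Require Import ring_quotient fraction separable.
From mathcomp Require Import boolp classical_sets.
From mathcomp Require Import perm finmap mpoly.

Set Implicit Arguments.
Unset Strict Implicit.
Unset Printing Implicit Defensive.

Import GRing.Theory Num.Theory Order.TTheory.

Local Open Scope classical_set_scope.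
Local Open Scope ring_scope.

(** The Gauss map of a toric variety is monomial, and everything is read off
    the lattice that it defines.

    Let w_i = (1, u_i) in Z^(n+1); the hypothesis on Aff(A) says that the w_i
    generate Z^(n+1). The cone over X_A is the closure of the points
    (s^(w_i))_i, where s runs through a torus of dimension n+1, and at such a
    point x the tangent space consists of the vectors (x_i g(w_i))_i with g
    linear (tangent_torus). Its Pluecker coordinate at an (n+1)-tuple J is
    det(w_j, j in J) times the product of the x_j, j in J. Call J a basis when
    this determinant is nonzero in k, and let L be the subgroup of M generated
    by the differences of sums of the u_j over two bases. On the torus, the
    Gauss map is the map of tori defined by the inclusion of L in M. By the
    Smith normal form, M has a basis e_1, ..., e_n such that L is generated by
    the d_j e_j (adapted_basis); some d_j may vanish.

    The Gauss defect. The points s of the torus that stabilise a tangent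
    space are those on which the characters in L are trivial, that is
    s_j^(d_j) = 1 for all j (tangent_stabilizer). Two points of X_A with the same support are in one
    orbit of the torus (same_support_orbit), so a fibre of the Gauss map is a
    finite union of orbits of this stabiliser, including the part of the fibre
    in the boundary. Hence the defect l is the number of j with d_j = 0
    (gauss_defect_toric). Krull dimensions are bounded from above by counting:
    a chain of length e yields about A^(e+1) linearly independent polynomials
    of degree O(A) (chain_growth), whereas a set parametrised by monomials in q
    variables only carries O(A^q) of them (dimension_bound); from below they
    are bounded by closures of orbits of an increasing sequence of subtori
    (subtorus_chain).

    Separability. The field K(gamma(X)) consists of quotients of polynomials
    that are homogeneous for the grading by M / L, so a character z^v belongs
    to it if and only if v is in L. Were d_j nonzero and divisible by the
    characteristic p, the character with exponent (d_j / p) e_j would have its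
    p-th power, but not itself, in K(gamma(X)), which a separable extension
    does not allow (separable_elementary_divisors). Therefore each nonzero d_j
    is invertible in k.

    The combinatorics. Fix a basis J0 and put u_i and u_j in the same class if
    they agree modulo the saturation of L. If w_j, j in J0, occurs in the
    expansion of w_i over k, then exchanging j for i gives another basis, so
    u_i - u_j is in L. Thus each class is spanned over k by its members in J0,
    and if there are c classes the differences inside them span a space of
    dimension at most n + 1 - c. This space contains the image of L over k,
    because two bases can be matched class by class (basis_matching), and that
    image has dimension n - l because the nonzero d_j are invertible. So
    c <= l + 1. On the other hand the c classes generate the quotient Z^(l+1)
    of Z^(n+1) by the saturation of L, so c = l + 1 and they form a basis of
    it: in this basis the classes become 0, e_1, ..., e_l, which is a Cayley
    sum, and all the inequalities between dimensions are equalities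
    (class_count, cayley_decomposition). *)

(** * Laurent monomials and their linear independence *)

Section LaurentMonomials.
Variable k : fieldType.

Definition nonzero q (s : 'I_q -> k) := forall j, s j != 0.

Definition mon q (e : 'rV[int]_q) (s : 'I_q -> k) : k := \prod_j s j ^ e 0 j.

Definition monomap p q (A : 'M[int]_(p, q)) (s : 'I_q -> k) (i : 'I_p) : k :=
  mon (row i A) s.

Lemma mon_neq0 q (e : 'rV[int]_q) s : nonzero s -> mon e s != 0.
Proof. by move=> s0; apply/prodf_neq0 => j _; rewrite expfz_neq0. Qed.

Lemma monomap_nonzero p q (A : 'M[int]_(p, q)) s :
  nonzero s -> nonzero (monomap A s).
Proof. by move=> s0 i; apply: mon_neq0. Qed.

Lemma mon0 q (s : 'I_q -> k) : mon 0 s = 1.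
Proof. by rewrite /mon big1 // => j _; rewrite mxE expr0z. Qed.

Lemma monD q (e f : 'rV[int]_q) s :
  nonzero s -> mon (e + f) s = mon e s * mon f s.
Proof.
move=> s0; rewrite /mon -big_split /=; apply: eq_bigr => j _.
by rewrite mxE expfzDr.
Qed.

Lemma monMz q (e : 'rV[int]_q) (z : int) s : mon (z *: e) s = mon e s ^ z.
Proof.
transitivity (\prod_j (s j ^ e 0 j) ^ z).
  by apply: eq_bigr => j _; rewrite mxE mulrC exprz_exp.
by apply/esym/(big_morph (fun x : k => x ^ z)) => [x y|]; rewrite ?exp1rz ?expfzMl.
Qed.

Lemma monN q (e : 'rV[int]_q) s : mon (- e) s = (mon e s)^-1.
Proof. by rewrite -scaleN1r monMz exprN1. Qed.

Lemma mon_sum q I (r : seq I) (P : pred I) (e : I -> 'rV[int]_q) s :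
  nonzero s -> mon (\sum_(i <- r | P i) e i) s = \prod_(i <- r | P i) mon (e i) s.
Proof.
move=> s0; exact: (big_morph (fun e => mon e s) (fun e f => monD e f s0) (mon0 s)).
Qed.

Lemma mon_mulmx p q (e : 'rV[int]_p) (A : 'M[int]_(p, q)) s :
  nonzero s -> mon (e *m A) s = mon e (monomap A s).
Proof.
move=> s0; rewrite mulmx_sum_row mon_sum //; apply: eq_bigr => i _.
by rewrite monMz.
Qed.

Lemma monomap_mulmx p q r (A : 'M[int]_(p, q)) (B : 'M[int]_(q, r)) s :
  nonzero s -> monomap (A *m B) s =1 monomap A (monomap B s).
Proof. by move=> s0 i; rewrite /monomap row_mul mon_mulmx. Qed.

Lemma mon_mul q (e : 'rV[int]_q) s t :
  mon e (fun j => s j * t j) = mon e s * mon e t.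
Proof.
by rewrite /mon -big_split; apply: eq_bigr => j _ /=; rewrite expfzMl.
Qed.

Lemma mon_inv q (e : 'rV[int]_q) s : mon e (fun j => (s j)^-1) = (mon e s)^-1.
Proof.
by rewrite /mon -prodfV; apply: eq_bigr => j _; rewrite exprz_inv invr_expz.
Qed.

Lemma mon_delta q (j : 'I_q) s : mon (delta_mx 0 j) s = s j.
Proof.
rewrite /mon (bigD1 j) //= mxE !eqxx expr1z big1 ?mulr1 // => i /negPf ij.
by rewrite mxE ij andbF expr0z.
Qed.

Lemma eq_mon q (e : 'rV[int]_q) s t : s =1 t -> mon e s = mon e t.
Proof. by move=> st; apply: eq_bigr => j _; rewrite st. Qed.

End LaurentMonomials.

(** The functional is v |-> v_0 + v_1 b + v_2 b^2 + ... for an integer b that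
    is a root of none of the finitely many nonzero polynomials attached to the
    vectors. *)
Lemma separating_functional q (vs : seq 'rV[int]_q) :
  exists lam : 'I_q -> int,
    forall v, v \in vs -> v != 0 -> \sum_j v 0 j * lam j != 0.
Proof.
pose P (v : 'rV[int]_q) : {poly int} := \poly_(j < q) (if insub j is Some j' then v 0 j' else 0).
have P0 v : v != 0 -> P v != 0.
  move=> /rV0Pn[j vj]; apply: contraNneq vj => /(congr1 (fun p : {poly int} => p`_j)).
  by rewrite coef_poly ltn_ord valK coef0 => ->.
pose p := \prod_(v <- vs | v != 0) P v.
have p0 : p != 0 by rewrite prodf_seq_neq0; apply/allP => v _; apply/implyP/P0.
have [b pb] : exists b : nat, ~~ root p b%:Z.
  apply: contrapT => nb.
  have : (size p <= size (mkseq Posz (size p)))%N by rewrite size_mkseq.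
  apply/negP; rewrite -ltnNge; apply: (max_poly_roots p0).
    apply/allP => _ /mapP[b _ ->]; apply: contrapT => rb; apply: nb; exists b; exact/negP.
  by rewrite map_inj_uniq ?iota_uniq // => x y [].
exists (fun j => b%:Z ^+ j) => v vin v0.
have : ~~ root (P v) b.
  apply: contra pb => /rootP h; rewrite rootE horner_prod.
  by rewrite (big_rem v) //= v0 h mul0r.
rewrite rootE horner_poly; congr (_ != 0).
by apply: eq_bigr => j _; rewrite valK.
Qed.

(** A Laurent polynomial with infinitely many zeros is zero; here terms with
    equal exponents are not assumed to be collected. *)
Lemma laurent_indep1 (k : closedFieldType) (T : eqType) (r : seq T) (z : T -> int)
    (c : T -> k) :
  (forall t : k, t != 0 -> \sum_(m <- r) c m * t ^ z m = 0) ->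
  forall e : int, \sum_(m <- r | z m == e) c m = 0.
Proof.
move=> h e; pose K : nat := (absz e + \sum_(m <- r) absz (z m))%N.
pose p := \sum_(m <- r) c m *: 'X^(absz (z m + K%:Z)).
have zK m : m \in r -> 0 <= z m + K%:Z.
  move=> mr; rewrite -lerBlDr sub0r /K PoszD.
  have : `|z m| <= (\sum_(m <- r) absz (z m))%N%:Z.
    by rewrite -abszE lez_nat (big_rem m) //= leq_addr.
  rewrite ler_norml => /andP[+ _]; apply: le_trans; rewrite lerN2.
  by rewrite lerDr.
have p0 : p = 0.
  apply/eqP/contraT => pN; have : p * 'X != 0 by rewrite mulf_neq0 ?polyX_eq0.
  case/closed_nonrootP => t; rewrite rootE hornerM hornerX mulf_eq0 negb_or.
  case/andP => pt t0; case/negP: pt; rewrite horner_sum.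
  apply/eqP; transitivity (t ^ K%:Z * (\sum_(m <- r) c m * t ^ z m)); last first.
    by rewrite h ?mulr0.
  rewrite mulr_sumr big_seq [RHS]big_seq; apply: eq_bigr => m mr.
  rewrite hornerZ hornerXn mulrCA; congr (_ * _).
  by rewrite exprnP gez0_abs ?zK // addrC expfzDr.
have eK : 0 <= e + K%:Z.
  rewrite -lerBlDr sub0r /K PoszD; apply: le_trans (_ : - (absz e)%:Z <= _).
    by rewrite lerN2 lerDl.
  by rewrite abszE lerNl -normrN ler_norm.
transitivity (p`_(absz (e + K%:Z))); last by rewrite p0 coef0.
rewrite coef_sum big_mkcond /= big_seq [RHS]big_seq; apply: eq_bigr => m mr.
rewrite coefZ coefXn -(eqr_nat int) !natz !gez0_abs ?zK //.
rewrite (inj_eq (addIr _)) [e == _]eq_sym.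
by case: eqP; rewrite ?mulr1 ?mulr0.
Qed.

(** Restriction to a one-parameter subgroup whose pairing separates the
    exponents reduces the claim to one variable. *)
Lemma laurent_indep (k : closedFieldType) q (T : eqType) (r : seq T)
    (w : T -> 'rV[int]_q) (c : T -> k) :
  (forall s, nonzero s -> \sum_(m <- r) c m * mon (w m) s = 0) ->
  forall e, \sum_(m <- r | w m == e) c m = 0.
Proof.
move=> h e.
have [lam lamP] := separating_functional [seq w m - e | m <- r].
pose ev (v : 'rV[int]_q) := \sum_j v 0 j * lam j.
have evB v : ev (v - e) = ev v - ev e.
  by rewrite /ev -sumrB; apply: eq_bigr => j _; rewrite !mxE mulrBl.
transitivity (\sum_(m <- r | ev (w m) == ev e) c m).
  rewrite big_seq_cond [RHS]big_seq_cond; apply: eq_bigl => m.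
  have [mr|//] := boolP (m \in r); rewrite /=.
  have [->|we] := eqVneq (w m) e; first by rewrite eqxx.
  apply/esym/negbTE; rewrite -subr_eq0 -evB; apply: lamP; rewrite ?subr_eq0 //.
  by apply/mapP; exists m.
apply: laurent_indep1 => t t0; rewrite -[RHS](h (fun j => t ^ lam j)); last first.
  by move=> j; rewrite expfz_neq0.
apply: eq_bigr => m _; congr (_ * _); rewrite /mon /ev.
rewrite (big_morph (fun z => t ^ z) (fun x y => expfzDr x y t0) (expr0z t)).
by apply: eq_bigr => j _; rewrite exprz_exp mulrC.
Qed.

(** The form in which independence of characters is used: the relation
    persists after the terms of each degree are multiplied by a constant, in
    particular after projection to some of the degrees. *)
Lemma laurent_indep_weighted (k : closedFieldType) q (T : eqType) (r : seq T)
    (w : T -> 'rV[int]_q) (c : T -> k) :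
  (forall s, nonzero s -> \sum_(m <- r) c m * mon (w m) s = 0) ->
  forall phi : 'rV[int]_q -> k, \sum_(m <- r) c m * phi (w m) = 0.
Proof.
move=> /laurent_indep h phi; pose E := undup [seq w m | m <- r].
transitivity (\sum_(m <- r) \sum_(e <- E | w m == e) c m * phi e).
  rewrite big_seq [RHS]big_seq; apply: eq_bigr => m mr.
  rewrite big_mkcond (bigD1_seq (w m)) ?undup_uniq ?mem_undup ?map_f //= eqxx.
  by rewrite big1 ?addr0 // => e /negPf; rewrite eq_sym => ->.
rewrite (exchange_big_dep xpredT) //= big1 // => e _.
by rewrite -mulr_suml h mul0r.
Qed.

(** * Polynomials vanishing on the cone over a projective set *)

Section Vanishing.
Variables (k : closedFieldType) (N : nat).
Implicit Types (F G : {mpoly k[N.+1]}) (x y : 'rV[k]_N.+1) (Y Z C : set 'rV[k]_N.+1).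

Lemma poly_eq0_of_units (p : {poly k}) : (forall c, c != 0 -> p.[c] = 0) -> p = 0.
Proof.
move=> h; apply/eqP/contraT => p0.
have : p * 'X != 0 by rewrite mulf_neq0 ?polyX_eq0.
case/closed_nonrootP => t; rewrite rootE hornerM hornerX mulf_eq0 negb_or.
by case/andP => pt t0; rewrite h ?eqxx in pt.
Qed.

(** Vanishing on the cone over Y. Points are represented by arbitrary
    homogeneous coordinates and F need not be homogeneous, so all multiples
    have to be tested. *)
Definition vanishes Y F := forall x, Y x -> forall c, c != 0 -> F.@[(c *: x) 0] = 0.

(** The restriction of F to the line through x. *)
Definition scale_poly F x : {poly k} :=
  \poly_(d < mmeasure mdeg F) (pihomog mdeg d F).@[x 0].

Lemma scale_polyE F x c : F.@[(c *: x) 0] = (scale_poly F x).[c].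
Proof.
rewrite {1}(pihomog_partitionE (leqnn (mmeasure mdeg F))) raddf_sum /=.
rewrite horner_poly; apply: eq_bigr => d _.
by rewrite (meval_dhomogZ _ _ (pihomogP _ d F)) mulrC.
Qed.

Lemma pihomog_large F d : (mmeasure mdeg F <= d)%N -> pihomog mdeg d F = 0.
Proof.
move=> le_d; rewrite pihomogE big_seq_cond big1 // => m /andP[mF /eqP md].
by have := mmeasure_mnm_lt mdeg mF; rewrite md ltnNge le_d.
Qed.

Lemma scale_poly_eq0 F x :
  scale_poly F x = 0 <-> forall d, (pihomog mdeg d F).@[x 0] = 0.
Proof.
split=> [h d|h]; last by apply/polyP => d; rewrite coef_poly coef0 h if_same.
have := congr1 (fun p : {poly k} => p`_d) h; rewrite coef_poly coef0.
by case: ltnP => // /pihomog_large -> _; rewrite meval0.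
Qed.

Lemma vanishesP Y F :
  vanishes Y F <-> forall x, Y x -> forall d, (pihomog mdeg d F).@[x 0] = 0.
Proof.
split=> h x Yx.
  by apply/scale_poly_eq0/poly_eq0_of_units => c c0; rewrite -scale_polyE h.
by move=> c _; rewrite scale_polyE (proj2 (scale_poly_eq0 F x)) ?horner0 //; apply: h.
Qed.

Lemma vanishesS Y Z F : Y `<=` Z -> vanishes Z F -> vanishes Y F.
Proof. by move=> YZ h x /YZ/h. Qed.

Lemma vanishes_homog Y d F :
  F \is d.-homog -> (forall x, Y x -> F.@[x 0] = 0) -> vanishes Y F.
Proof. by move=> Fd h x Yx c _; rewrite (meval_dhomogZ _ _ Fd) h ?mulr0. Qed.

Lemma proj_closure_closed Y : proj_closed (proj_closure Y).
Proof.
by exists [set F : {mpoly k[N.+1]} | F \is homog mdeg /\ forall x, Y x -> F.@[x 0] = 0];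
  split=> // F [].
Qed.

Lemma proj_closed_neq0 C x : proj_closed C -> C x -> x != 0.
Proof. by move=> [S [_ ->]] []. Qed.

Lemma sub_proj_closure Y : (forall x, Y x -> x != 0) -> Y `<=` proj_closure Y.
Proof. by move=> Y0 x Yx; split; [exact: Y0 | move=> F [_]; apply]. Qed.

Lemma proj_closure_min Y C : proj_closed C -> Y `<=` C -> proj_closure Y `<=` C.
Proof.
move=> [S [Sh ->]] YC x [x0 h]; split=> // F SF; apply: h; split; first exact: Sh.
by move=> y /YC[_]; apply.
Qed.

Lemma proj_closureS Y Z : Y `<=` Z -> proj_closure Y `<=` proj_closure Z.
Proof.
by move=> YZ x [x0 h]; split=> // F [Fh FZ]; apply: h; split=> // y /YZ/FZ.
Qed.

(** The closure is defined by homogeneous polynomials only; the homogeneous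
    components of F vanish wherever F vanishes on a cone. *)
Lemma vanishes_closure Y F : vanishes Y F -> vanishes (proj_closure Y) F.
Proof.
move/vanishesP => h; apply/vanishesP => x [x0 xh] d; apply: xh; split.
  by apply/homogP; exists d; apply: pihomogP.
by move=> y Yy; apply: h.
Qed.

(** The ideal of the cone over an irreducible set is prime. Irreducibility is
    applied to the zero loci of the homogeneous components of the two factors. *)
Lemma vanishes_prime Z F G : (forall x, Z x -> x != 0) -> proj_irreducible Z ->
  vanishes Z (F * G) -> vanishes Z F \/ vanishes Z G.
Proof.
move=> Z0 [_ Zirr] h.
pose V H := proj_zeros [set G | exists d, G = pihomog mdeg d H] : set 'rV[k]_N.+1.
have Vc H : proj_closed (V H).
  exists [set G | exists d, G = pihomog mdeg d H]; split=> // _ [d ->].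
  by apply/homogP; exists d; apply: pihomogP.
have ZV H : Z `<=` V H -> vanishes Z H.
  by move=> ZV; apply/vanishesP => x /ZV[_ hx] d; apply: hx; exists d.
have [|/ZV|/ZV] := Zirr _ _ (Vc F) (Vc G); [|by left|by right].
move=> x Zx; have : scale_poly F x * scale_poly G x = 0.
  by apply: poly_eq0_of_units => c c0; rewrite hornerM -!scale_polyE -mevalM h.
by move/eqP; rewrite mulf_eq0 => /orP[] /eqP/scale_poly_eq0 e; [left|right];
  split; rewrite ?Z0 // => _ [d ->].
Qed.

(** A set between an irreducible set and its closure has the same closed
    covers. *)
Lemma irreducible_between Y E : (forall x, E x -> x != 0) -> proj_irreducible E ->
  E `<=` Y -> rel_closed Y (Y `&` proj_closure E) /\ proj_irreducible (Y `&` proj_closure E).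
Proof.
move=> E0 [[x Ex] Eirr] EY; split; first by exists (proj_closure E) => //;
  apply: proj_closure_closed.
have sE : E `<=` Y `&` proj_closure E.
  by move=> y Ey; split; [exact: EY | exact: sub_proj_closure].
split; first by exists x; apply: sE.
move=> Z1 Z2 Z1c Z2c sub.
have [y Ey|s|s] := Eirr _ _ Z1c Z2c; first exact/sub/sE.
- by left=> y [_]; apply: proj_closure_min.
- by right=> y [_]; apply: proj_closure_min.
Qed.

End Vanishing.

(** * Growth of polynomials along chains of irreducible closed sets *)

Section DimensionUpperBound.
Variables (k : closedFieldType) (N : nat).
Implicit Types (F G : {mpoly k[N.+1]}) (x y : 'rV[k]_N.+1) (Y Z : set 'rV[k]_N.+1).

Definition independent_on Y (I : finType) (g : I -> {mpoly k[N.+1]}) :=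
  forall c : I -> k, vanishes Y (\sum_i c i *: g i) -> forall i, c i = 0.

Lemma msizeM_leD F G : (msize (F * G) <= msize F + msize G)%N.
Proof.
have [->|F0] := eqVneq F 0; first by rewrite mul0r msize0.
have [->|G0] := eqVneq G 0; first by rewrite mulr0 msize0.
by rewrite msizeM // leq_pred.
Qed.

Lemma msizeX_le F b : (msize (F ^+ b) <= (b * msize F).+1)%N.
Proof.
elim: b => [|b IH]; first by rewrite expr0 msize1.
rewrite exprS; apply: leq_trans (msizeM_leD _ _) _.
by rewrite mulSn -addnS leq_add2l.
Qed.

(** Grading by powers of F: in a relation, divide by the lowest power of F
    that occurs, which is possible because Z' is irreducible; on Z only the
    lowest term survives. *)
Lemma independent_extend Z Z' F (I : finType) (g : I -> {mpoly k[N.+1]}) A :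
  (forall x, Z' x -> x != 0) -> proj_irreducible Z' -> Z `<=` Z' ->
  vanishes Z F -> ~ vanishes Z' F -> independent_on Z g ->
  independent_on Z' (fun i : I * 'I_A => g i.1 * F ^+ i.2).
Proof.
move=> Z'0 Z'irr ZZ' FZ FZ' gI c hc.
pose Q (b : 'I_A) := \sum_i c (i, b) *: g i.
have QE : \sum_i c i *: (g i.1 * F ^+ i.2) = \sum_b Q b * F ^+ b.
  rewrite (eq_bigr (fun i => c (i.1, i.2) *: (g i.1 * F ^+ i.2))); last by case.
  rewrite -(pair_bigA _ (fun i b => c (i, b) *: (g i * F ^+ b))) exchange_big /=.
  by apply: eq_bigr => b _; rewrite mulr_suml; apply: eq_bigr => i _; rewrite scalerAl.
have FXZ' b : ~ vanishes Z' (F ^+ b).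
  elim: b => [|b IH].
    rewrite expr0 => h; have [[x Zx] _] := Z'irr.
    by have /eqP := h x Zx 1 (oner_neq0 _); rewrite meval1 oner_eq0.
  by rewrite exprS => /(vanishes_prime Z'0 Z'irr)[/FZ'|/IH].
suff h b : forall i, c (i, b) = 0 by case=> i b; apply: h.
(* strong induction: the coefficients of lower powers of F already vanish *)
have [m] := ubnP (nat_of_ord b); elim: m => // m IH in b *; rewrite ltnS => bm.
(* the terms after the lowest one, divided by F^(b+1) *)
pose R := \sum_(b' : 'I_A | (b < b')%N) Q b' * F ^+ (b' - b.+1).
have : vanishes Z' (F ^+ b * (Q b + F * R)).
  suff -> : F ^+ b * (Q b + F * R) = \sum_b Q b * F ^+ b by rewrite -QE.
  rewrite (bigID (fun b' : 'I_A => (b' < b)%N)) /= big1 ?add0r; last first.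
    move=> b' b'b; rewrite /Q big1 ?mul0r // => i _.
    by rewrite IH ?scale0r //; apply: leq_trans bm.
  rewrite (bigD1 b) /=; last by rewrite ltnn.
  rewrite mulrDr [_ * Q b]mulrC; congr (_ + _).
  rewrite /R !mulr_sumr; apply: eq_big => [b'|b' bb'].
    by rewrite -leqNgt ltn_neqAle andbC eq_sym -val_eqE.
  by rewrite mulrA -exprSr mulrCA -exprD subnKC.
case/(vanishes_prime Z'0 Z'irr)=> [/FXZ' //|QR]; apply: gI => x Zx a a0.
have := QR x (ZZ' x Zx) a a0; rewrite mevalD mevalM (FZ x Zx a a0) mul0r addr0.
exact.
Qed.

(** Each step of the chain contributes a polynomial that vanishes on the
    smaller set but not on the larger one, and the monomials in the
    polynomials collected along the chain are linearly independent. The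
    constant C does not depend on A, so this is polynomial growth of degree d
    + 1. *)
Lemma chain_growth Y d : irr_chain Y d ->
  exists C, forall A, exists (I : finType) (g : I -> {mpoly k[N.+1]}),
    [/\ #|I| = (A ^ d.+1)%N, forall i, (msize (g i) <= C * A)%N &
        independent_on Y g].
Proof.
move=> [Z [Zc Zlt]].
have Z0 i : (i <= d)%N -> forall x, Z i x -> x != 0.
  by move=> id x; have [[C Cc ->] _] := Zc i id; case=> _; apply: proj_closed_neq0.
suff h i : (i <= d)%N -> exists C, forall A, exists (I : finType) (g : I -> {mpoly k[N.+1]}),
    [/\ #|I| = (A ^ i.+1)%N, forall i, (msize (g i) <= C * A)%N & independent_on (Z i) g].
  have [C hC] := h d (leqnn d); exists C => A; have [I [g [cI sg gI]]] := hC A.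
  exists I, g; split=> // c hc; apply: gI; apply: vanishesS hc.
  by have [[C' _ ->] _] := Zc d (leqnn d).
elim: i => [|i IH] id.
  have [[x Zx] _] := proj2 (Zc 0%N id); have /rV0Pn[j xj] := Z0 _ id x Zx.
  exists 2%N => A; exists 'I_A, (fun b : 'I_A => 'X_j ^+ b); split.
  - by rewrite card_ord expn1.
  - move=> b; apply: leq_trans (msizeX_le _ _) _.
    by rewrite msizeX mdeg1 mulnC ltn_pmul2l.
  - move=> c hc b; pose p := \poly_(b < A) (if insub b is Some b' then c b' else 0).
    suff /(congr1 (fun p : {poly k} => p`_b)) : p = 0.
      by rewrite coef_poly ltn_ord valK coef0.
    apply: poly_eq0_of_units => t t0; rewrite horner_poly.
    have /(hc x Zx) : t / x 0 j != 0 by rewrite mulf_neq0 ?invr_eq0.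
    rewrite raddf_sum /= => h; rewrite -[RHS]h; apply: eq_bigr => a _.
    by rewrite valK mevalZ rmorphXn /= mevalXU mxE divfK.
have [C hC] := IH (ltnW id); have [ZZ' nZZ'] := Zlt i id.
have [F FZ FZ'] : exists2 F, vanishes (Z i) F & ~ vanishes (Z i.+1) F.
  have [[C1 [S [Sh C1E]] ZE] _] := Zc i (ltnW id).
  have [[C2 C2c Z'E] _] := Zc i.+1 id.
  apply: contrapT => no; apply: nZZ' => x Z'x; rewrite ZE; split.
    by move: Z'x; rewrite Z'E => -[].
  rewrite C1E; split=> [|F SF]; first exact: Z0 Z'x.
  apply: contrapT => Fx; apply: no; exists F.
    have /homogP[e Fe] := Sh F SF; apply: vanishes_homog Fe _ => y.
    by rewrite ZE C1E => -[_ [_]]; apply.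
  by move/(_ x Z'x 1 (oner_neq0 _)); rewrite scale1r.
exists (C + (msize F).+1)%N => A; have [I [g [cI sg gI]]] := hC A.
exists (I * 'I_A)%type, (fun i : I * 'I_A => g i.1 * F ^+ i.2); split.
- by rewrite card_prod cI card_ord -expnSr.
- move=> [j b] /=; apply: leq_trans (msizeM_leD _ _) _.
  rewrite mulnDl leq_add ?sg //; apply: leq_trans (msizeX_le _ _) _.
  rewrite mulSn -add1n leq_add //; first by case: (b) => b' /=; case: (A).
  by rewrite mulnC leq_mul2l ltnW ?orbT.
- by apply: independent_extend gI => //; [apply: Z0 | have [] := Zc i.+1 id].
Qed.

End DimensionUpperBound.

(** * Dimension of a set parametrised by monomials *)

Section ToricPoints.
Variables (k : closedFieldType) (N : nat).

(** The torus acts on the projective space through this product. *)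
Definition hadamard (x y : 'rV[k]_N.+1) : 'rV[k]_N.+1 := \row_i (x 0 i * y 0 i).

(** The point of the cone over a toric variety with parameters s; row i of V
    is the exponent of coordinate i. *)
Definition monomial_point q (V : 'M[int]_(N.+1, q)) (s : 'I_q -> k) : 'rV[k]_N.+1 :=
  \row_i monomap V s i.

(** The degree of a monomial for the grading that gives coordinate i the
    degree row i V; restriction to monomial points turns it into the exponent. *)
Definition weight q (V : 'M[int]_(N.+1, q)) (m : 'X_{1..N.+1}) : 'rV[int]_q :=
  \sum_i (m i)%:Z *: row i V.

Lemma hadamardA x y z : hadamard x (hadamard y z) = hadamard (hadamard x y) z.
Proof. by apply/rowP => i; rewrite !mxE mulrA. Qed.

Lemma hadamardC x y : hadamard x y = hadamard y x.
Proof. by apply/rowP => i; rewrite !mxE mulrC. Qed.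

Lemma monomial_point_neq0 q (V : 'M[int]_(N.+1, q)) s i : nonzero s -> monomial_point V s 0 i != 0.
Proof. by move=> s0; rewrite mxE mon_neq0. Qed.

Lemma weightD q (V : 'M[int]_(N.+1, q)) m1 m2 : weight V (m1 + m2) = weight V m1 + weight V m2.
Proof.
rewrite /weight -big_split /=; apply: eq_bigr => i _.
by rewrite mnmDE PoszD scalerDl.
Qed.

Lemma weight0 q (V : 'M[int]_(N.+1, q)) : weight V 0 = 0.
Proof. by rewrite /weight big1 // => i _; rewrite mnm0E scale0r. Qed.

Lemma monomial_eval_point q (V : 'M[int]_(N.+1, q)) s (m : 'X_{1..N.+1}) :
  nonzero s -> \prod_i (monomial_point V s) 0 i ^+ m i = mon (weight V m) s.
Proof.
move=> s0; rewrite mon_sum //; apply: eq_bigr => i _.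
by rewrite monMz mxE -exprnP.
Qed.

Lemma meval_hadamard_monomial_point q (V : 'M[int]_(N.+1, q)) x s (F : {mpoly k[N.+1]}) :
  nonzero s -> F.@[(hadamard x (monomial_point V s)) 0] =
    \sum_(m <- msupp F) F@_m * (\prod_i x 0 i ^+ m i) * mon (weight V m) s.
Proof.
move=> s0; rewrite mevalE; apply: eq_bigr => m _; rewrite -mulrA; congr (_ * _).
rewrite -monomial_eval_point // -big_split; apply: eq_bigr => i _ /=.
by rewrite mxE exprMn.
Qed.

Lemma hadamard1 x : hadamard (const_mx 1) x = x.
Proof. by apply/rowP => i; rewrite !mxE mul1r. Qed.

Lemma meval_monomial_point q (V : 'M[int]_(N.+1, q)) s (F : {mpoly k[N.+1]}) :
  nonzero s -> F.@[(monomial_point V s) 0] = \sum_(m <- msupp F) F@_m * mon (weight V m) s.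
Proof.
move=> s0; rewrite -{1}[monomial_point V s]hadamard1 meval_hadamard_monomial_point //;
  apply: eq_bigr => m _.
by rewrite big1 ?mulr1 // => i _; rewrite mxE expr1n.
Qed.

Lemma left_kernel_vec (I J : finType) (c : I -> J -> k) : (#|J| < #|I|)%N ->
  exists v : I -> k, (exists i, v i != 0) /\ forall j, \sum_i v i * c i j = 0.
Proof.
move=> JI; pose M : 'M[k]_(#|I|, #|J|) := \matrix_(i, j) c (enum_val i) (enum_val j).
have /rowV0Pn[w /sub_kermxP wM w0] : kermx M != 0.
  rewrite kermx_eq0 /row_free neq_ltn; apply/orP; left.
  exact: leq_ltn_trans (rank_leq_col _) JI.
exists (fun i => w 0 (enum_rank i)); split.
  by have /rV0Pn[i wi] := w0; exists (enum_val i); rewrite enum_valK.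
move=> j; have /rowP/(_ (enum_rank j)) := wM; rewrite !mxE => wMj; rewrite -[RHS]wMj.
rewrite (reindex (@enum_val I I)) /=; last exact/onW_bij/enum_val_bij.
by apply: eq_bigr => i _; rewrite enum_valK mxE enum_rankK.
Qed.

Lemma growth_comparison (a b q d : nat) : (q <= d)%N ->
  exists A, (a * (b * A).*2.+1 ^ q < A ^ d.+1)%N.
Proof.
move=> qd; pose A := (a * b.*2.+1 ^ q).+1; exists A.
have A0 : (0 < A)%N by [].
apply: (@leq_trans (A ^ q.+1)%N); last by rewrite leq_pexp2l.
apply: (@leq_ltn_trans (a * (b.*2.+1 * A) ^ q)%N).
  rewrite leq_mul2l; case: (q) => [|q']; rewrite ?expn0 ?orbT //.
  by rewrite leq_exp2r // mulSn -doubleMl -add1n leq_add2r A0 orbT.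
by rewrite expnMn mulnA expnS ltn_pmul2r ?expn_gt0 ?A0.
Qed.

Lemma weight_bound q (V : 'M[int]_(N.+1, q)) :
  exists B, forall m j, (absz (weight V m 0%R j) <= B * mdeg m)%N.
Proof.
exists (\sum_i \sum_j absz (V i j))%N => m j; rewrite mdegE big_distrr /= -lez_nat.
rewrite abszE summxE; apply: le_trans (ler_norm_sum _ _ _) _.
rewrite -natz natr_sum; apply: ler_sum => i _; rewrite !mxE normrM mulrC.
rewrite natz PoszM; apply: ler_wpM2r; first by rewrite normr_ge0.
rewrite -abszE lez_nat (bigD1 i) //= (bigD1 j) //= -addnA leq_addr //.
Qed.

(** Restricted to the points with a given index sg, polynomials of degree at
    most K are combinations of Laurent monomials in q variables with exponents
    bounded by a multiple of K. There are O(K^q) of them, too few for the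
    growth provided by a chain of length at least q. *)
Lemma dimension_bound q (S : finType) (Y0 : S -> 'rV[k]_N.+1)
    (V : 'M[int]_(N.+1, q)) (Y Y' : set 'rV[k]_N.+1) d :
  Y `<=` proj_closure Y' ->
  (forall y, Y' y -> forall a : k, a != 0 ->
     exists sg s, nonzero s /\ a *: y = hadamard (Y0 sg) (monomial_point V s)) ->
  irr_chain Y d -> (d < q)%N.
Proof.
move=> YY' Yp Yd; rewrite ltnNge; apply/negP => qd.
have [C hC] := chain_growth Yd; have [B hB] := weight_bound V.
have [A hA] := growth_comparison #|S| (B * C) qd.
have [I [g [cI sg gI]]] := hC A; pose K := (B * C * A)%N.
(* exponents are shifted by K so as to be indexed by ordinals *)
pose enc (m : 'X_{1..N.+1}) : {ffun 'I_q -> 'I_K.*2.+1} :=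
  [ffun j => inord (absz (weight V m 0 j + K%:Z))].
pose c (i : I) (p : S * {ffun 'I_q -> 'I_K.*2.+1}) :=
  \sum_(m <- msupp (g i) | enc m == p.2) (g i)@_m * \prod_j Y0 p.1 0 j ^+ m j.
have [|v [[i0 vi0] vc]] := @left_kernel_vec _ _ c.
  by rewrite cI card_prod card_ffun !card_ord.
case/eqP: vi0; apply: gI; apply: vanishesS YY' _; apply: vanishes_closure => y Yy a a0;
  have [p [s [s0 ->]]] := Yp y Yy a a0.
pose E (f : {ffun 'I_q -> 'I_K.*2.+1}) := \prod_j s j ^ ((f j : nat)%:Z - K%:Z).
have gE i : (g i).@[(hadamard (Y0 p) (monomial_point V s)) 0] = \sum_f c i (p, f) * E f.
  rewrite meval_hadamard_monomial_point // (partition_big enc xpredT) //=; apply: eq_bigr => f _.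
  rewrite mulr_suml big_seq_cond [RHS]big_seq_cond; apply: eq_bigr => m.
  case/andP=> mg /eqP <-; congr (_ * _); apply: eq_bigr => j _; congr (_ ^ _).
  have mK : (absz (weight V m 0%R j) <= K)%N.
    apply: leq_trans (hB m j) _; rewrite /K -mulnA leq_mul2l.
    by rewrite (leq_trans (ltnW (msize_mdeg_lt mg)) (sg i)) orbT.
  have : `|weight V m 0 j| <= K%:Z by rewrite -abszE lez_nat.
  rewrite ler_norml => /andP[lo hi].
  have ge0 : 0 <= weight V m 0 j + K%:Z by rewrite -lerBlDr sub0r.
  rewrite ffunE inordK ?gez0_abs ?addrK //.
  by rewrite ltnS -lez_nat gez0_abs // -addnn PoszD lerD2r.
rewrite raddf_sum /=; under eq_bigr do rewrite mevalZ gE mulr_sumr.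
rewrite exchange_big big1 //= => f _.
by under eq_bigr do rewrite mulrA; rewrite -mulr_suml vc mul0r.
Qed.

End ToricPoints.

(** * Diagonal rescaling of the coordinates *)

Section Scaling.
Variables (k : closedFieldType) (N : nat).
Implicit Types (F : {mpoly k[N.+1]}) (x y : 'rV[k]_N.+1).

(** Substitution of x_i X_i for X_i; it is the comorphism of multiplication by
    x. *)
Definition rescale x F : {mpoly k[N.+1]} :=
  F \mPo [tuple x 0 i *: ('X_i : {mpoly k[N.+1]}) | i < N.+1].

Lemma meval_rescale x F y : (rescale x F).@[y 0] = F.@[(hadamard x y) 0].
Proof.
rewrite /rescale comp_mpoly_meval; apply: meval_eq => i.
by rewrite tnth_mktuple mevalZ mevalXU mxE.
Qed.

Lemma rescaleX x m : rescale x 'X_[m] = (\prod_i x 0 i ^+ m i) *: 'X_[m].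
Proof.
rewrite /rescale comp_mpolyX [in RHS]mpolyXE_id -scaler_prod.
by apply: eq_bigr => i _; rewrite tnth_mktuple exprZn.
Qed.

Lemma monomial_split x (m : 'X_{1..N.+1}) i : m i != 0%N ->
  \prod_j x 0 j ^+ m j = x 0 i * \prod_j x 0 j ^+ (m - U_(i))%MM j.
Proof.
move=> mi; rewrite (bigD1 i) //= [in RHS](bigD1 i) //= mulrA mnmBE mnm1E eqxx -exprS.
rewrite subn1 prednK ?lt0n //; congr (_ * _); apply: eq_bigr => j ji.
by rewrite mnmBE mnm1E eq_sym (negPf ji) subn0.
Qed.

Lemma mderiv_rescale x F i : (rescale x F)^`M(i) = x 0 i *: rescale x F^`M(i).
Proof.
elim/mpolyind: F => [|c m F _ _ IH].
  by rewrite /rescale !(comp_mpoly0, mderiv0) scaler0.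
rewrite {1}/rescale comp_mpolyD !mderivD -/(rescale x F) IH /rescale comp_mpolyD scalerDr.
congr (_ + _); rewrite mderivZ !comp_mpolyZ mderivZ -/(rescale x 'X_[m]) rescaleX !mderivZ mderivX.
rewrite comp_mpolyZ -/(rescale x 'X_[_]) rescaleX !scalerA.
have [mi|mi] := eqVneq (m i) 0%N; first by rewrite mi !(mulr0, mul0r, scale0r, mulr0n).
rewrite (monomial_split x mi) -!mulrA [in RHS]mulrCA.
by congr ((_ * (_ * _)) *: _); rewrite mulrC.
Qed.

(** Euler's formula for the derivation that multiplies X_i by h_i. At a point
    with nonzero coordinates it evaluates the gradient of F on an arbitrary
    vector. *)
Lemma euler_sum F x (h : 'I_N.+1 -> k) :
  \sum_i (F^`M(i)).@[x 0] * (x 0 i * h i) =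
  \sum_(m <- msupp F) F@_m * (\sum_i (m i)%:R * h i) * \prod_i x 0 i ^+ m i.
Proof.
have dF i : (F^`M(i)).@[x 0] = \sum_(m <- msupp F) ((F@_m *: 'X_[m])^`M(i)).@[x 0].
  by rewrite {1}[F]mpolyE (big_morph _ (mderivD i) (mderiv0 _ i)) raddf_sum.
under eq_bigr do rewrite dF mulr_suml.
rewrite exchange_big /=; apply: eq_bigr => m _.
rewrite mulrAC -mulrA [in RHS]mulr_sumr mulr_sumr; apply: eq_bigr => i _.
rewrite mderivZ mderivX !mevalZ mevalX -!mulrA; congr (_ * _).
rewrite [RHS]mulrCA; have [->|mi] := eqVneq (m i) 0%N; first by rewrite !mul0r.
by congr (_ * _); rewrite (monomial_split x mi) mulrCA mulrA.
Qed.

End Scaling.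

(** * Chains of closures of orbits of subtori *)

Section SubtorusChains.
Variables (k : closedFieldType) (n N : nat) (W : 'M[int]_(N.+1, n.+1)).
Implicit Types (x y : 'rV[k]_N.+1) (T : pred 'I_n).
Hypothesis W0 : forall i, W i ord0 = 1.

(** Coordinate 0 of the parameter is the scalar of homogeneous coordinates,
    since all exponents have first entry 1; it is always free. The other free
    coordinates are those selected by T. *)
Definition subtorus_orbit (x : 'rV[k]_N.+1) (T : pred 'I_n) : set 'rV[k]_N.+1 :=
  [set y | exists s, [/\ nonzero s, forall j, ~~ T j -> s (lift ord0 j) = 1 &
     y = hadamard x (monomial_point W s)]].

(** Parameters of the cone, from a scalar and a point of the torus of M. *)
Definition torus_coord (c : k) (t : 'I_n -> k) (j : 'I_n.+1) : k :=
  if unlift ord0 j is Some j' then t j' else c.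

Lemma torus_coord0 c t : torus_coord c t ord0 = c.
Proof. by rewrite /torus_coord unlift_none. Qed.

Lemma torus_coordS c t j : torus_coord c t (lift ord0 j) = t j.
Proof. by rewrite /torus_coord liftK. Qed.

Lemma torus_coord_nonzero c t : c != 0 -> nonzero t -> nonzero (torus_coord c t).
Proof. by move=> c0 t0 j; rewrite /torus_coord; case: unliftP => *. Qed.

Lemma monomial_pointE (s : 'I_n.+1 -> k) i :
  monomial_point W s 0 i = s ord0 * \prod_j s (lift ord0 j) ^ W i (lift ord0 j).
Proof.
rewrite mxE /monomap /mon big_ord_recl mxE W0 expr1z; congr (_ * _).
by apply: eq_bigr => j _; rewrite mxE.
Qed.

Lemma subtorus_orbit_neq0 x T : (forall i, x 0 i != 0) ->
  forall y, subtorus_orbit x T y -> y != 0.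
Proof.
move=> x0 y [s [s0 _ ->]]; apply/eqP => /rowP/(_ 0)/eqP; apply/negP.
by rewrite !mxE mulf_neq0 // mon_neq0.
Qed.

Lemma subtorus_orbitS x (T T' : pred 'I_n) : (forall j, T j -> T' j) ->
  subtorus_orbit x T `<=` subtorus_orbit x T'.
Proof.
move=> TT' y [s [s0 sT ->]]; exists s; split=> // j jT'; apply: sT.
by apply: contra jT'; apply: TT'.
Qed.

(** The exponents after restriction to the subtorus of the coordinates in T. *)
Definition masked (T : pred 'I_n) (i : 'I_N.+1) : 'rV[int]_n :=
  \row_j (if T j then W i (lift ord0 j) else 0).

Lemma free_of_rank_row : free_of_rank 'rV[int]_n n.
Proof. by exists (idfun : {additive _ -> _}); exists id. Qed.

(** An orbit of a subtorus is a translate of the toric image of a projection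
    of the exponents. *)
Lemma subtorus_orbitP x T y : subtorus_orbit x T y <->
  exists2 z, toric_image (masked T) z & y = hadamard x z.
Proof.
split=> [[s [s0 sT ->]]|[_ [c [t [c0 tt ->]]] ->]].
  exists (monomial_point W s) => //; exists (s ord0), (fun v => mon v (fun j => s (lift ord0 j))).
  split=> //.
    by split=> [|u v]; [rewrite mon0 | rewrite monD // => j; apply: s0].
  apply/rowP => i; rewrite monomial_pointE !mxE; congr (_ * _); apply: eq_bigr => j _.
  rewrite mxE; case: ifPn => // /sT ->.
  by rewrite !exp1rz.
pose s := torus_coord c (fun j => if T j then t (delta_mx 0 j) else 1).
have s0 : nonzero s.
  apply: torus_coord_nonzero => // j; case: ifP => _; rewrite ?oner_eq0 //.
  exact: torus_neq0 tt.
exists s; split=> // [j /negPf jT|]; first by rewrite /s torus_coordS jT.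
congr (hadamard _ _); apply/rowP => i; rewrite monomial_pointE /s torus_coord0 !mxE; congr (_ * _).
rewrite (torus_basis (idfun : {additive _ -> _}) _ tt); apply: eq_bigr => j _ /=.
by rewrite torus_coordS mxE; case: ifP; rewrite // exp1rz expr0z.
Qed.

(** After the translation is absorbed in the polynomials, two nonempty open
    subsets of a toric image meet. *)
Lemma subtorus_orbit_irreducible x T : (forall i, x 0 i != 0) ->
  proj_irreducible (subtorus_orbit x T).
Proof.
move=> x0; split.
  exists (hadamard x (monomial_point W (fun=> 1))); exists (fun=> 1); split=> // j;
    exact: oner_neq0.
move=> Z1 Z2 Z1c Z2c sub; apply: contrapT => /not_orP[n1 n2].
have nonvanishing Z : proj_closed Z -> ~ subtorus_orbit x T `<=` Z ->
    exists F, (forall y, Z y -> F.@[y 0] = 0) /\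
      exists2 z, toric_image (masked T) z & F.@[(hadamard x z) 0] != 0.
  move=> [S [Sh ->]] nZ; apply: contrapT => no; apply: nZ => y yE.
  split=> [|F SF]; first exact: subtorus_orbit_neq0 yE.
  apply/eqP/negP => /negP Fy; apply: no; exists F; split.
    by move=> z [_]; apply.
  by have /subtorus_orbitP[z zI ye] := yE; exists z; rewrite -?ye.
have [F1 [F1Z [z1 z1I F1z]]] := nonvanishing _ Z1c n1.
have [F2 [F2Z [z2 z2I F2z]]] := nonvanishing _ Z2c n2.
rewrite -meval_rescale in F1z; rewrite -meval_rescale in F2z.
have [z zI []] := toric_image_meet free_of_rank_row z1I z2I F1z F2z.
rewrite !meval_rescale => F1N F2N.
have xzE : subtorus_orbit x T (hadamard x z) by apply/subtorus_orbitP; exists z.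
by have [/F1Z/eqP|/F2Z/eqP] := sub _ xzE; apply/negP.
Qed.

Lemma weight_deg m : weight W m 0 ord0 = (mdeg m)%:Z.
Proof.
rewrite summxE mdegE -natz natr_sum; apply: eq_bigr => i _.
by rewrite !mxE W0 mulr1 natz.
Qed.

(** Any integer vector is the difference pos_part a - pos_part (- a) of two
    exponents of monomials. *)
Definition pos_part p (a : 'rV[int]_p) : 'X_{1..p} :=
  [multinom (if (0 <= a 0 i)%R then absz (a 0%R i) else 0%N) | i < p].

Lemma weight_pos_part (a : 'rV[int]_N.+1) :
  weight W (pos_part a) = a *m W + weight W (pos_part (- a)).
Proof.
rewrite mulmx_sum_row -big_split /=; apply: eq_bigr => i _.
rewrite -scalerDl !mnmE mxE; congr (_ *: _).
case: (lerP 0 (a 0 i)) => [a0|a0]; rewrite oppr_ge0.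
  rewrite gez0_abs //; case: lerP => a0'; last by rewrite addr0.
  have -> : a 0 i = 0 by apply/eqP; rewrite eq_le a0 a0'.
  by rewrite addr0.
by rewrite ltW // gez0_abs ?addrN // oppr_ge0 ltW.
Qed.

Variable S : 'M[int]_(n.+1, N.+1).
Hypothesis SW : S *m W = 1%:M.

Lemma exists_neq01 : exists2 t : k, t != 0 & t != 1.
Proof.
have : 'X * ('X - 1%:P) != 0 :> {poly k}.
  by rewrite mulf_neq0 ?polyX_eq0 ?polyXsubC_eq0.
case/closed_nonrootP => t; rewrite rootM rootX root_XsubC negb_or.
by case/andP; exists t.
Qed.

(** Free one more coordinate at each step. The inclusions are strict because
    the exponents generate the whole lattice: a binomial that restricts to the
    new coordinate minus 1 vanishes on the smaller orbit only. *)
Lemma subtorus_chain l (emb : 'I_l -> 'I_n) (x : 'rV[k]_N.+1) (Y : set 'rV[k]_N.+1) :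
  injective emb -> (forall i, x 0 i != 0) ->
  subtorus_orbit x (fun j => j \in codom emb) `<=` Y -> irr_chain Y l.
Proof.
move=> emb_inj x0 EY.
pose T i : pred 'I_n := fun j => [exists z : 'I_l, (z < i)%N && (emb z == j)].
have ET i : subtorus_orbit x (T i) `<=` Y.
  apply: subset_trans EY; apply: subtorus_orbitS => j /existsP[z /andP[_ /eqP <-]].
  exact: codom_f.
exists (fun i => Y `&` proj_closure (subtorus_orbit x (T i))); split=> i il.
  apply: irreducible_between (ET i); first exact: subtorus_orbit_neq0.
  exact: subtorus_orbit_irreducible.
have TS : subtorus_orbit x (T i) `<=` subtorus_orbit x (T i.+1).
  apply: subtorus_orbitS => j /existsP[z /andP[zi zj]]; apply/existsP; exists z.
  by rewrite zj ltnW.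
split; first by apply: setIS; apply: proj_closureS.
pose j0 := emb (Ordinal il); pose a := row (lift ord0 j0) S.
have aW : a *m W = delta_mx 0 (lift ord0 j0) by rewrite -row_mul SW row1.
pose mp := pos_part a; pose mn := pos_part (- a).
have mpn : weight W mp = delta_mx 0 (lift ord0 j0) + weight W mn by rewrite weight_pos_part aW.
have deg_mpn : mdeg mp = mdeg mn.
  have /rowP/(_ ord0) := mpn; rewrite mxE !weight_deg mxE eqxx /= add0r.
  by case.
pose xm (m : 'X_{1..N.+1}) := \prod_i x 0 i ^+ m i.
have xm0 m : xm m != 0 by apply/prodf_neq0 => j _; rewrite expf_neq0.
(* the coefficients compensate for the translation by x *)
pose F : {mpoly k[N.+1]} := xm mn *: 'X_[mp] - xm mp *: 'X_[mn].
have Fh : F \is (mdeg mn).-homog.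
  by rewrite rpredB // rpredZ // dhomogX /= ?deg_mpn.
have FE s : nonzero s -> F.@[(hadamard x (monomial_point W s)) 0] =
    xm mn * xm mp * mon (weight W mn) s * (s (lift ord0 j0) - 1).
  move=> s0; rewrite mevalB !mevalZ !mevalX.
  have E (m : 'X_{1..N.+1}) : \prod_i (hadamard x (monomial_point W s)) 0 i ^+ m i =
    xm m * mon (weight W m) s.
    rewrite -monomial_eval_point // -big_split; apply: eq_bigr => j _ /=.
    by rewrite mxE exprMn.
  rewrite !E mpn monD // mon_delta mulrBr mulr1 !mulrA; congr (_ - _).
    by rewrite mulrAC.
  by rewrite [xm mp * _]mulrC.
have [t t0 t1] := exists_neq01.
(* a point of the larger orbit off the smaller one *)
pose s := torus_coord 1 (fun j => if j == j0 then t else 1).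
have s0 : nonzero s.
  by apply: torus_coord_nonzero (oner_neq0 _) _ => j; case: ifP; rewrite ?oner_neq0.
have sE : subtorus_orbit x (T i.+1) (hadamard x (monomial_point W s)).
  exists s; split=> // j; rewrite /s torus_coordS; case: eqP => // -> /existsP[].
  by exists (Ordinal il); rewrite ltnSn eqxx.
have sub0 := sub_proj_closure (subtorus_orbit_neq0 x0).
move=> /(_ (hadamard x (monomial_point W s)))[].
  by split; [apply: (ET i.+1) | apply: sub0].
move=> _ [_ /(_ F)]; rewrite FE // => h.
have /eqP : xm mn * xm mp * mon (weight W mn) s * (s (lift ord0 j0) - 1) = 0.
  apply: h; split; first by apply/homogP; exists (mdeg mn).
  move=> _ [s' [s'0 s'T ->]]; rewrite FE // s'T ?subrr ?mulr0 //.
  apply/existsP => -[z /andP[zi /eqP/emb_inj zE]].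
  by rewrite zE /= ltnn in zi.
rewrite !mulf_eq0 !(negPf (xm0 _)) (negPf (mon_neq0 _ s0)) /= subr_eq0.
by rewrite /s torus_coordS eqxx (negPf t1).
Qed.

End SubtorusChains.

(** * Ideal and tangent spaces of a projective toric variety *)

Section ToricIdeal.
Variables (k : closedFieldType) (n N : nat) (W : 'M[int]_(N.+1, n.+1)).
Hypothesis W0 : forall i, W i ord0 = 1.
Variable S : 'M[int]_(n.+1, N.+1).
Hypothesis SW : S *m W = 1%:M.
Implicit Types (x y : 'rV[k]_N.+1) (F : {mpoly k[N.+1]}).

(** With row i of W equal to (1, u_i), these are the points of the cone over
    the torus of X_A. *)
Definition torus_points : set 'rV[k]_N.+1 :=
  [set y | exists2 s, nonzero s & y = monomial_point W s].

Lemma monomial_pointM (s t : 'I_n.+1 -> k) :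
  hadamard (monomial_point W s) (monomial_point W t) = monomial_point W (fun j => s j * t j).
Proof. by apply/rowP => i; rewrite !mxE /monomap mon_mul. Qed.

Definition scalar_coord (c : k) : 'I_n.+1 -> k := torus_coord c (fun=> 1).

Lemma scalar_coord_nonzero c : c != 0 -> nonzero (scalar_coord c).
Proof. by move=> c0; apply: torus_coord_nonzero => // j; apply: oner_neq0. Qed.

Lemma monomial_point_scalar c i : monomial_point W (scalar_coord c) 0 i = c.
Proof.
rewrite monomial_pointE // /scalar_coord torus_coord0 big1 ?mulr1 // => j _.
by rewrite torus_coordS exp1rz.
Qed.

Lemma scale_hadamard c x : c *: x = hadamard x (monomial_point W (scalar_coord c)).
Proof. by apply/rowP => i; rewrite mxE [RHS]mxE monomial_point_scalar mulrC. Qed.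

Lemma nonzeroM q (s t : 'I_q -> k) :
  nonzero s -> nonzero t -> nonzero (fun j => s j * t j).
Proof. by move=> s0 t0 j; rewrite mulf_neq0. Qed.

Lemma torus_points_coord_neq0 y : torus_points y -> forall i, y 0 i != 0.
Proof. by move=> [s s0 ->] i; apply: monomial_point_neq0. Qed.

Lemma torus_points_neq0 y : torus_points y -> y != 0.
Proof. by move=> h; apply/rV0Pn; exists 0; apply: torus_points_coord_neq0. Qed.

Variable X : proj_variety k N.
Hypothesis XE : pv_set X = proj_closure torus_points.

Lemma torus_in_variety s : nonzero s -> pv_set X (monomial_point W s).
Proof.
by move=> s0; rewrite XE; apply: (sub_proj_closure torus_points_neq0); exists s.
Qed.

Lemma variety_neq0 x : pv_set X x -> x != 0.
Proof. by rewrite XE => -[]. Qed.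

(** Both sides are invariant under scaling, so it is enough to test the torus
    rather than its closure. *)
Lemma toric_idealP F :
  F \in pv_ideal X <-> forall s, nonzero s -> F.@[(monomial_point W s) 0] = 0.
Proof.
split=> [/pv_idealP h s s0|h]; first by apply: h; apply: torus_in_variety.
apply/pv_idealP => x; rewrite XE => Xx.
have : vanishes (proj_closure torus_points) F.
  apply: vanishes_closure => _ [s s0 ->] c c0.
  by rewrite scale_hadamard monomial_pointM h //; apply: nonzeroM => //;
    apply: scalar_coord_nonzero.
by move/(_ x Xx 1 (oner_neq0 _)); rewrite scale1r.
Qed.

(** The ideal of X is homogeneous for the grading of the polynomial ring by
    exponents: the coefficients of F in each degree add up to 0, hence also
    after weighting. *)
Lemma ideal_graded F (phi : 'rV[int]_n.+1 -> k) :
  F \in pv_ideal X -> \sum_(m <- msupp F) F@_m * phi (weight W m) = 0.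
Proof.
move=> /toric_idealP h; apply: laurent_indep_weighted => s s0.
by rewrite -[RHS](h s s0) meval_monomial_point.
Qed.

Lemma rescale_ideal F s : nonzero s -> F \in pv_ideal X ->
  rescale (monomial_point W s) F \in pv_ideal X.
Proof.
move=> s0 /toric_idealP h; apply/toric_idealP => t t0; rewrite meval_rescale monomial_pointM h //.
exact: nonzeroM.
Qed.

Definition inv_coord q (s : 'I_q -> k) : 'I_q -> k := fun j => (s j)^-1.

Lemma inv_coord_nonzero q (s : 'I_q -> k) : nonzero s -> nonzero (inv_coord s).
Proof. by move=> s0 j; rewrite invr_eq0. Qed.

Lemma monomial_pointVK x s : nonzero s -> hadamard (hadamard x (monomial_point W s))
  (monomial_point W (inv_coord s)) = x.
Proof.
move=> s0; rewrite -hadamardA monomial_pointM; apply/rowP => i; rewrite mxE [X in _ * X]mxE.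
rewrite /monomap /mon big1 ?mulr1 // => j _.
by rewrite /inv_coord divff ?exp1rz.
Qed.

Lemma tangent_hadamardW y v s : nonzero s ->
  tangent_space X y v -> tangent_space X (hadamard y (monomial_point W s)) (hadamard v
    (monomial_point W s)).
Proof.
move=> s0 Tv F FI; have := Tv _ (rescale_ideal s0 FI); move=> h; rewrite -[RHS]h.
apply: eq_bigr => i _; rewrite mderiv_rescale mevalZ meval_rescale hadamardC mxE.
by rewrite -mulrA [RHS]mulrC -mulrA.
Qed.

(** The torus acts on X, hence on its tangent spaces, also at boundary points. *)
Lemma tangent_hadamard y v s : nonzero s ->
  tangent_space X (hadamard y (monomial_point W s)) (hadamard v (monomial_point W s)) <->
    tangent_space X y v.
Proof.
move=> s0; split; last exact: tangent_hadamardW.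
by move/(tangent_hadamardW (inv_coord_nonzero s0)); rewrite !monomial_pointVK.
Qed.

(** The exponents w_i as vectors over k; distinct exponents may become equal. *)
Definition base_change : 'M[k]_(N.+1, n.+1) := map_mx intr W.

Lemma base_change_left_inverse : map_mx intr S *m base_change = 1%:M.
Proof. by rewrite -map_mxM SW map_mx1. Qed.

(** The vectors (x_i g(w_i))_i, for g running through the coordinate
    functions. *)
Definition tangent_basis x : 'M[k]_(n.+1, N.+1) := \matrix_(j, i) (x 0 i * base_change i j).

Lemma tangent_basisE x : tangent_basis x = base_change^T *m diag_mx x.
Proof. by apply/matrixP => j i; rewrite mul_mx_diag !mxE mulrC. Qed.

Lemma mul_tangent_basis x (g : 'rV[k]_n.+1) i :
  (g *m tangent_basis x) 0 i = x 0 i * \sum_j g 0 j * base_change i j.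
Proof.
by rewrite mxE mulr_sumr; apply: eq_bigr => j _; rewrite mxE mulrCA.
Qed.

Lemma tangent_basis_free x : (forall i, x 0 i != 0) -> row_free (tangent_basis x).
Proof.
move=> x0; rewrite -kermx_eq0; apply/rowV0P => g /sub_kermxP gB.
have gW : g *m base_change^T = 0.
  apply/rowP => i; have /rowP/(_ i) := gB; rewrite mul_tangent_basis [RHS]mxE.
  move/eqP; rewrite mulf_eq0 (negPf (x0 i)) /= => /eqP h.
  by rewrite mxE [RHS]mxE -[RHS]h; apply: eq_bigr => j _; rewrite [X in _ * X]mxE.
have := congr1 (mulmx^~ (map_mx intr S)^T) gW.
by rewrite -mulmxA -trmx_mul base_change_left_inverse trmx1 mulmx1 mul0mx.
Qed.

Lemma weight_intr m j : (weight W m 0 j)%:~R = \sum_i (m i)%:R * base_change i j :> k.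
Proof.
rewrite summxE rmorph_sum; apply: eq_bigr => i _ /=.
by rewrite !mxE intrM.
Qed.

(** Euler's formula and the grading of the ideal show that (x_i g(w_i))_i is
    tangent. Conversely, the binomials in the ideal show that h_i = v_i / x_i
    satisfies every integral relation between the w_i; these generate the
    lattice, so h_i is a linear function of w_i. *)
Lemma tangent_torus s : nonzero s ->
  row_basis (tangent_basis (monomial_point W s)) (tangent_space X (monomial_point W s)).
Proof.
move=> s0; have x0 i := monomial_point_neq0 W i s0; set x := monomial_point W s in x0 *.
split; first exact: tangent_basis_free.
apply/seteqP; split=> v /=; last first.
  case/submxP=> g ->{v} F FI.
  under eq_bigr do rewrite mul_tangent_basis.
  rewrite euler_sum.
  pose phi (e : 'rV[int]_n.+1) : k := (\sum_j g 0 j * (e 0 j)%:~R) * mon e s.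
  rewrite -[RHS](ideal_graded phi FI); apply: eq_bigr => m _.
  rewrite -mulrA; congr (_ * (_ * _)); last by rewrite monomial_eval_point.
  under eq_bigr do rewrite mulr_sumr; rewrite exchange_big /=; apply: eq_bigr => j _.
  by rewrite weight_intr mulr_sumr; apply: eq_bigr => i _; rewrite mulrCA.
move=> Tv; pose h := \row_i (v 0 i / x 0 i) : 'rV[k]_N.+1.
have vE i : v 0 i = x 0 i * h 0 i by rewrite [h 0 i]mxE mulrC divfK.
have rel (a : 'rV[int]_N.+1) : a *m W = 0 -> h *m (map_mx intr a)^T = 0.
  move=> aW; pose mp := pos_part a; pose mn := pos_part (- a).
  have mpn : weight W mp = weight W mn by rewrite weight_pos_part aW add0r.
  have FI : 'X_[mp] - 'X_[mn] \in pv_ideal X.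
    by apply/toric_idealP => t t0; rewrite mevalB !mevalX !monomial_eval_point // mpn subrr.
  have := Tv _ FI; under eq_bigr do rewrite mderivB mevalB vE mulrBl.
  rewrite sumrB !euler_sum !msuppX !big_seq1 !mcoeffX !eqxx !mul1r.
  rewrite !monomial_eval_point // mpn -mulrBl => /eqP;
    rewrite mulf_eq0 (negPf (mon_neq0 _ s0)) orbF.
  move=> /eqP E; apply/rowP => j; rewrite ord1 mxE [RHS]mxE -[RHS]E -sumrB.
  apply: eq_bigr => i _; rewrite -mulrBl mulrC; congr (_ * _).
  have -> : ((map_mx intr a)^T) i 0 = (a 0 i)%:~R :> k by rewrite !mxE.
  rewrite /mp /mn !mnmE mxE; case: (lerP 0 (a 0 i)) => a0; rewrite oppr_ge0.
    rewrite -[in LHS](gez0_abs a0); case: lerP => a0'; rewrite ?subr0 //.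
    have -> : a 0 i = 0 by apply/eqP; rewrite eq_le a0 a0'.
    by rewrite subr0.
  rewrite ltW // sub0r -[in LHS](opprK (a 0 i)) -(gez0_abs (_ : 0 <= - a 0 i)) ?mulrNz //.
  by rewrite oppr_ge0 ltW.
suff : (v <= tangent_basis x)%MS by [].
apply/submxP; exists (h *m (map_mx intr S)^T); apply/rowP => i.
rewrite vE mul_tangent_basis; congr (_ * _).
(* w_i = (W S)_i w is an integral relation between the exponents *)
have /rel : row i (1%:M - W *m S) *m W = 0.
  by rewrite -row_mul mulmxBl mul1mx -mulmxA SW mulmx1 subrr row0.
rewrite map_row map_mxB map_mx1 map_mxM -/base_change -{1}[h]trmxK -trmx_mul -row_mul.
rewrite mulmxBl mul1mx -mulmxA => /rowP/(_ 0); rewrite 4!mxE [RHS]mxE [X in _ + X]mxE => E.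
apply/eqP; rewrite -subr_eq0; apply/eqP; rewrite -[RHS]E.
congr (_ - _); rewrite [(base_change *m _) _ _]mxE; apply: eq_bigr => j _.
by rewrite mulrC -[h in LHS]trmxK -trmx_mul [(_ ^T) 0 j]mxE.
Qed.

End ToricIdeal.

(** * Torus orbits and dimension of a projective toric variety *)

Section CharacterExtension.
Variable k : closedFieldType.

Lemma exists_exprz_root (z : int) (c : k) : z != 0 -> c != 0 ->
  exists2 s : k, s != 0 & s ^ z = c.
Proof.
have pos (m : nat) (b : k) : b != 0 -> exists2 s, s != 0 & s ^+ m.+1 = b.
  move=> b0; have : size ('X^(m.+1) - b%:P : {poly k})%R != 1%N by rewrite size_XnsubC.
  case/closed_rootP => s; rewrite rootE !hornerE subr_eq0 => /eqP sb.
  by exists s => //; apply: contraNneq b0 => s0; rewrite -sb s0 expr0n.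
case: z => [[|m]|m] // _ c0; first by have [s] := pos m c c0; exists s.
have [|s s0 sc] := pos m c^-1; first by rewrite invr_eq0.
by exists s => //; rewrite NegzE -exprnN sc invrK.
Qed.

(** The multiplicative group of an algebraically closed field is divisible. In
    Smith normal form the equations for s become s_j^(d_j) = c_j, and the
    hypothesis says that c_j = 1 when d_j = 0. *)
Lemma character_extension p q (A : 'M[int]_(p, q)) (c : 'I_p -> k) :
  nonzero c -> (forall a : 'rV[int]_p, a *m A = 0 -> mon a c = 1) ->
  exists2 s, nonzero s & monomap A s =1 c.
Proof.
move=> c0 rel; have [L Lu [R Ru [d _ AE]]] := int_Smith_normal_form A.
set D := (\matrix_(i, j) _) in AE.
pose c' := monomap (invmx L) c.
have c'0 : nonzero c' by apply: monomap_nonzero.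
have /choice [s' s'P] : forall j : 'I_q, exists x : k, x != 0 /\
    forall i : 'I_p, i = j :> nat -> d`_i != 0 -> x ^ d`_i = c' i.
  move=> j; have [jp|jp] := ltnP j p; last first.
    exists 1; split=> [|i ij]; first exact: oner_neq0.
    by have := ltn_ord i; rewrite ij ltnNge jp.
  have [d0|d0] := eqVneq d`_j 0.
    by exists 1; split=> [|i ->]; rewrite ?oner_neq0 // d0 eqxx.
  have [x x0 xc] := exists_exprz_root d0 (c'0 (Ordinal jp)).
  exists x; split=> // i ij _; rewrite ij xc; congr (c' _); exact/val_inj.
have s'0 : nonzero s' by move=> j; have [] := s'P j.
exists (monomap (invmx R) s'); first exact: monomap_nonzero.
have Ds : monomap D s' =1 c'.
  move=> i; have rowD : (forall j : 'I_q, i = j :> nat -> d`_i = 0) -> c' i = 1.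
    move=> h; apply: rel; rewrite -row_mul AE !mulmxA mulVmx // mul1mx row_mul.
    suff -> : row i D = 0 by rewrite mul0mx.
    by apply/rowP => j; rewrite !mxE; case: eqP => // /h ->.
  have [[j ij]|no] := pselect (exists j : 'I_q, i = j :> nat); last first.
    rewrite rowD; last by move=> j ij; case: no; exists j.
    rewrite /monomap /mon big1 // => j _; rewrite !mxE.
    by case: eqP => [ij|]; [case: no; exists j | rewrite expr0z].
  have -> : monomap D s' i = s' j ^ d`_i.
    rewrite /monomap /mon (bigD1 j) //= !mxE ij eqxx big1 ?mulr1 // => j' j'j.
    rewrite !mxE ij; case: eqP => [jj'|]; last by rewrite expr0z.
    by case/eqP: j'j; apply: val_inj.
  have [d0|d0] := eqVneq d`_i 0; last by have [_] := s'P j; apply.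
  by rewrite d0 expr0z rowD // => j'.
move=> i; rewrite AE monomap_mulmx; last exact: monomap_nonzero.
have e : monomap R (monomap (invmx R) s') =1 s'.
  move=> j; rewrite -monomap_mulmx // mulmxV //.
  by rewrite /monomap row1 mon_delta.
rewrite /monomap (eq_mon _ e) row_mul mon_mulmx // (eq_mon _ Ds).
by rewrite -mon_mulmx // -row_mul mulmxV // row1 mon_delta.
Qed.

Lemma mon_pos_part p (a : 'rV[int]_p) (c : 'I_p -> k) : nonzero c ->
  \prod_i c i ^+ pos_part a i = mon a c * \prod_i c i ^+ pos_part (- a) i.
Proof.
move=> c0; rewrite /mon -big_split; apply: eq_bigr => i _ /=.
rewrite !mnmE mxE !exprnP -expfzDr //; congr (_ ^ _).
case: (lerP 0 (a 0 i)) => [a0|a0]; rewrite oppr_ge0.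
  rewrite gez0_abs //; case: lerP => a0'; last by rewrite addr0.
  have -> : a 0 i = 0 by apply/eqP; rewrite eq_le a0 a0'.
  by rewrite addr0.
by rewrite ltW // gez0_abs ?addrN // oppr_ge0 ltW.
Qed.

End CharacterExtension.

Section ToricOrbits.
Variables (k : closedFieldType) (n N : nat) (W : 'M[int]_(N.+1, n.+1)).
Hypothesis W0 : forall i, W i ord0 = 1.
Variable S : 'M[int]_(n.+1, N.+1).
Hypothesis SW : S *m W = 1%:M.
Implicit Types (x y : 'rV[k]_N.+1) (F : {mpoly k[N.+1]}).
Variable X : proj_variety k N.
Hypothesis XE : pv_set X = proj_closure (torus_points W).

(** The ratios of the nonzero coordinates of y' and y satisfy all
    multiplicative relations between the corresponding exponents, because both
    points satisfy the binomial equations of X; so they extend to a character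
    of the whole lattice. *)
Lemma same_support_orbit y y' : pv_set X y -> pv_set X y' ->
  (forall i, (y 0 i == 0) = (y' 0 i == 0)) ->
  exists2 s, nonzero s & y' = hadamard y (monomial_point W s).
Proof.
move=> Xy Xy' supp.
pose A : 'M[int]_(N.+1, n.+1) := \matrix_(i, j) (if y 0 i == 0 then 0 else W i j).
pose fill (z : 'rV[k]_N.+1) i := if y 0 i == 0 then 1 else z 0 i.
have fy0 : nonzero (fill y).
  by move=> i; rewrite /fill; case: ifPn; rewrite ?oner_neq0.
have fy'0 : nonzero (fill y').
  by move=> i; rewrite /fill supp; case: ifPn; rewrite ?oner_neq0.
pose c i := fill y' i * (fill y i)^-1.
have c0 : nonzero c by move=> i; rewrite mulf_neq0 ?invr_eq0.
have [a aA|s s0 sc] := character_extension (A := A) c0.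
  pose b : 'rV[int]_N.+1 := \row_i (if y 0 i == 0 then 0 else a 0 i).
  have bW : b *m W = 0.
    rewrite -[RHS]aA; apply/rowP => j; rewrite !mxE; apply: eq_bigr => i _.
    by rewrite !mxE; case: ifP; rewrite ?mulr0 ?mul0r.
  have monb z : pv_set X z -> (forall i, (y 0 i == 0) = (z 0 i == 0)) -> mon b (fill z) = 1.
    move=> Xz suppz; have fz0 : nonzero (fill z).
      by move=> i; rewrite /fill suppz; case: ifPn; rewrite ?oner_neq0.
    have fillE (e : 'rV[int]_N.+1) : (forall i, y 0 i == 0 -> e 0 i = 0) ->
        \prod_i z 0 i ^+ pos_part e i = \prod_i fill z i ^+ pos_part e i.
      move=> e0; apply: eq_bigr => i _; rewrite mnmE /fill; case: (boolP (y 0 i == 0)) => // yi.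
      by rewrite e0 // lexx absz0 !expr0.
    have b0 i : y 0 i == 0 -> b 0 i = 0 by rewrite mxE => ->.
    have Nb0 i : y 0 i == 0 -> (- b) 0 i = 0 by rewrite mxE => /b0 ->; rewrite oppr0.
    have FI : 'X_[pos_part b] - 'X_[pos_part (- b)] \in pv_ideal X.
      apply/(toric_idealP W0 XE) => t t0; rewrite mevalB !mevalX !monomial_eval_point //.
      by rewrite weight_pos_part bW add0r subrr.
    have /pv_idealP/(_ z Xz)/eqP := FI; rewrite mevalB !mevalX !fillE // subr_eq0.
    rewrite mon_pos_part // -[X in _ == X]mul1r => /eqP/mulIf; apply.
    by apply/prodf_neq0 => i _; rewrite expf_neq0.
  have -> : mon a c = mon b c.
    apply: eq_bigr => i _; rewrite mxE /c /fill; case: ifP => // _.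
    by rewrite invr1 mulr1 exp1rz expr0z.
  by rewrite mon_mul mon_inv !monb // invr1 mulr1.
exists s => //; apply/rowP => i; rewrite !mxE.
have := sc i; rewrite /c /fill; case: eqP => [yi _|/eqP yi sE].
  by rewrite yi mul0r; apply/eqP; rewrite -supp yi.
rewrite [monomap W s i](_ : _ = monomap A s i); last first.
  by apply: eq_bigr => j _; rewrite !mxE (negPf yi).
by rewrite sE mulrC divfK.
Qed.

Lemma dimension_eq (Y : set 'rV[k]_N.+1) d :
  irr_chain Y d -> (forall e, irr_chain Y e -> (e <= d)%N) -> dimension Y = d.
Proof.
move=> Yd Ymax; rewrite /dimension; case: xgetP => [e _ [Ye emax]|no].
  by apply/eqP; rewrite eqn_leq Ymax ?emax.
by case: (no d).
Qed.

(** The chain of all coordinate subtori has length n, and the cone is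
    parametrised by n + 1 variables. *)
Lemma dimension_toric : dimension X = n.
Proof.
apply: dimension_eq => [|e].
  apply: (@subtorus_chain k n N W W0 S SW n id (const_mx 1)) => [//|i|].
    by rewrite mxE oner_neq0.
  by move=> _ [s [s0 _ ->]]; rewrite hadamard1; apply: torus_in_variety XE _ s0.
rewrite -ltnS; apply: (@dimension_bound k N n.+1 unit (fun=> const_mx 1) W _ (torus_points W)).
  by rewrite XE.
move=> _ [s s0 ->] a a0; exists tt, (fun j => s j * scalar_coord a j).
split; first by apply: nonzeroM => //; apply: scalar_coord_nonzero.
by rewrite hadamard1 (scale_hadamard W0) monomial_pointM.
Qed.

Lemma smoothP x : smooth X x <->
  pv_set X x /\ exists B : 'M[k]_(n.+1, N.+1), row_basis B (tangent_space X x).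
Proof. by rewrite /smooth dimension_toric. Qed.

Lemma smooth_torus s : nonzero s -> smooth X (monomial_point W s).
Proof.
move=> s0; apply/smoothP; split; first exact: torus_in_variety XE _ s0.
by exists (tangent_basis W (monomial_point W s)); apply: tangent_torus SW _ XE _ s0.
Qed.

End ToricOrbits.

(** * Bases of exponents and stabilisers of tangent spaces *)

Section Bases.
Variables (k : closedFieldType) (n N : nat) (W : 'M[int]_(N.+1, n.+1)).
Implicit Types (J : 'I_n.+1 -> 'I_N.+1).

(** The columns J form a basis of the space of linear functions on the tangent
    space at a torus point: the Pluecker coordinate J does not vanish there. *)
Definition basis J : bool := \det (rowsub J (base_change k W)) != 0.

Definition weight_sum J : 'rV[int]_n.+1 := \sum_a row (J a) W.

Lemma basis_unit J : basis J -> rowsub J (base_change k W) \in unitmx.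
Proof. by rewrite unitmxE unitfE. Qed.

Lemma basis_inj J : basis J -> injective J.
Proof.
move=> bJ a b Jab; apply/eqP/contraT => ab; case/eqP: bJ.
by apply: (determinant_alternate ab) => j; rewrite !mxE Jab.
Qed.

Lemma basis_exists (S : 'M[int]_(n.+1, N.+1)) : S *m W = 1%:M -> exists J, basis J.
Proof.
move=> SW; have full : row_full (base_change k W).
  by apply/row_fullP; exists (map_mx intr S); apply: base_change_left_inverse.
exists (fullrankfun full); rewrite /basis -unitfE -unitmxE -row_full_unit.
exact: fullrowsub_full.
Qed.

(** Row i holds the coordinates of w_i in the basis J. *)
Definition basis_coords J : 'M[k]_(N.+1, n.+1) :=
  (base_change k W) *m invmx (rowsub J (base_change k W)).

Lemma basis_coordsK J : basis J -> basis_coords J *m rowsub J (base_change k W) = (base_change k W).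
Proof. by move=> bJ; rewrite /basis_coords -mulmxA mulVmx ?mulmx1 ?basis_unit. Qed.

Lemma basis_coords_rowsub J : basis J -> rowsub J (basis_coords J) = 1%:M.
Proof. by move=> bJ; rewrite /basis_coords -mul_rowsub_mx mulmxV ?basis_unit. Qed.

Definition exchange J a i : 'I_n.+1 -> 'I_N.+1 := fun b => if b == a then i else J b.

(** The determinant is multiplied by the coordinate that is exchanged. *)
Lemma basis_exchange J i a : basis J -> basis_coords J i a != 0 -> basis (exchange J a i).
Proof.
move=> bJ ia; rewrite /basis.
have -> : rowsub (exchange J a i) (base_change k W) =
  rowsub (exchange J a i) (basis_coords J) *m rowsub J (base_change k W).
  by rewrite mul_rowsub_mx basis_coordsK.
rewrite det_mulmx mulf_neq0 // (expand_det_col _ a) (bigD1 a) //= big1 ?addr0.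
  rewrite [rowsub _ _ a a]mxE {1}/exchange eqxx mulf_neq0 // /cofactor mulf_neq0 ?signr_eq0 //
    (_ : row' _ _ = 1%:M) ?det1 ?oner_neq0 //.
  apply/matrixP => b c; rewrite mxE [LHS]mxE [LHS]mxE /exchange eq_sym (negPf (neq_lift _ _)).
  have /matrixP/(_ (lift a b) (lift a c)) := basis_coords_rowsub bJ; rewrite mxE => ->.
  by rewrite !mxE (inj_eq lift_inj).
move=> b ba; rewrite [rowsub _ _ b a]mxE {1}/exchange (negPf ba).
have /matrixP/(_ b a) := basis_coords_rowsub bJ; rewrite mxE => ->.
by rewrite mxE (negPf ba) mul0r.
Qed.

Lemma weight_sum_exchange J a i :
  weight_sum (exchange J a i) - weight_sum J = row i W - row (J a) W.
Proof.
rewrite /weight_sum (bigD1 a) //= [X in _ - X](bigD1 a) //= /exchange eqxx.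
rewrite (eq_bigr (fun b => row (J b) W)) => [|b /negPf -> //].
by rewrite opprD addrACA subrr addr0.
Qed.

(** The differences of sums over two bases have first entry 0; the conditions
    say that in the n other coordinates they generate the lattice of the
    multiples of d_j in coordinate j, the value 0 being allowed for d_j. *)
Definition lattice_divisors (J0 : 'I_n.+1 -> 'I_N.+1) (d : 'I_n -> int) : Prop :=
  (forall J J', basis J -> basis J' ->
     forall j : 'I_n, (d j %| (weight_sum J - weight_sum J') ord0 (lift ord0 j))%Z) /\
  forall j : 'I_n, exists c : {ffun 'I_n.+1 -> 'I_N.+1} -> int,
    (forall J : {ffun 'I_n.+1 -> 'I_N.+1}, c J != 0 -> basis J) /\
    d j *: delta_mx 0 (lift ord0 j) =
      \sum_(J : {ffun 'I_n.+1 -> 'I_N.+1}) c J *: (weight_sum J - weight_sum J0).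

End Bases.

Section GaussFibers.
Variables (k : closedFieldType) (n N : nat) (W : 'M[int]_(N.+1, n.+1)).
Hypothesis W0 : forall i, W i ord0 = 1.
Variable S : 'M[int]_(n.+1, N.+1).
Hypothesis SW : S *m W = 1%:M.
Variable d : 'I_n -> int.
Variable J0 : 'I_n.+1 -> 'I_N.+1.
Hypothesis bJ0 : basis k W J0.
Hypothesis hd : lattice_divisors k W J0 d.
Let d_dvd := hd.1.
Let d_gen := hd.2.
Implicit Types (x y : 'rV[k]_N.+1) (F : {mpoly k[N.+1]}).

(** The parameters on which every character in the lattice of the Gauss map is
    trivial. The scalar coordinate 0 is free. *)
Definition stabilizer (s : 'I_n.+1 -> k) : Prop :=
  nonzero s /\ forall j, s (lift ord0 j) ^ d j = 1.

Lemma weight_sum0 J : weight_sum W J 0 ord0 = n.+1%:Z.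
Proof.
rewrite summxE (eq_bigr (fun=> 1)) => [|a _]; last by rewrite mxE W0.
by rewrite sumr_const card_ord natz.
Qed.

Lemma stabilizer_mon s J J' : stabilizer s -> basis k W J -> basis k W J' ->
  mon (weight_sum W J - weight_sum W J') s = 1.
Proof.
move=> [s0 sd] bJ bJ'; rewrite /mon big_ord_recl !mxE !weight_sum0 subrr expr0z mul1r.
rewrite big1 // => j _; have /dvdzP[z zE] := d_dvd bJ bJ' j.
by rewrite zE mulrC -exprz_exp sd exp1rz.
Qed.

(** By exchange, w_i and the members of the basis that occur in its expansion
    differ by elements of the lattice. *)
Lemma stabilizer_coords s i a : stabilizer s -> basis_coords k W J0 i a != 0 ->
  monomap W s i = monomap W s (J0 a).
Proof.
move=> Hs ia; have [s0 _] := Hs.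
have := stabilizer_mon Hs (basis_exchange bJ0 ia) bJ0.
rewrite weight_sum_exchange monD // monN => h; apply: (divIf (mon_neq0 (row (J0 a) W) s0)).
by rewrite divff ?mon_neq0.
Qed.

(** If the diagonal matrix of s acts on the columns of the exponent matrix
    through C, taking minors shows that the sum of the w_j over any basis
    takes the value det C at s, so s is trivial on the lattice. Conversely, an
    element of the stabiliser has equal values on w_i and on the members of J0
    that occur in it, so its action is that of its restriction to J0. *)
Lemma stabilizerP s : nonzero s ->
  stabilizer s <-> exists C : 'M[k]_n.+1, diag_mx (monomial_point W s) *m base_change k W =
    base_change k W *m C.
Proof.
move=> s0; split=> [Hs|[C CE]].
  pose D0 : 'rV[k]_n.+1 := \row_a monomap W s (J0 a).
  exists (invmx (rowsub J0 (base_change k W)) *m diag_mx D0 *m rowsub J0 (base_change k W)).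
  rewrite !mulmxA -/(basis_coords k W J0) -[in LHS](basis_coordsK bJ0) mulmxA; congr (_ *m _).
  rewrite mul_diag_mx mul_mx_diag; apply/matrixP => i a.
  rewrite [LHS]mxE [RHS]mxE [monomial_point W s 0 i]mxE [D0 0 a]mxE.
  have [->|ia] := eqVneq (basis_coords k W J0 i a) 0; first by rewrite mulr0 mul0r.
  by rewrite (stabilizer_coords Hs ia) mulrC.
have monJ J : basis k W J -> mon (weight_sum W J) s = \det C.
  move=> bJ; have : rowsub J (diag_mx (monomial_point W s) *m base_change k W) =
    rowsub J (base_change k W) *m C.
    by rewrite CE mul_rowsub_mx.
  rewrite mul_diag_mx (_ : rowsub J _ = diag_mx (\row_a monomap W s (J a)) *m rowsub J
    (base_change k W)).
    move/(congr1 determinant); rewrite !det_mulmx mulrC => /(mulfI bJ) <-.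
    by rewrite det_diag mon_sum //; apply: eq_bigr => a _; rewrite mxE.
  by rewrite mul_diag_mx; apply/matrixP => a j; rewrite !mxE.
split=> // j; have [c [cb dE]] := d_gen j.
rewrite -(mon_delta (lift ord0 j) s) -monMz dE mon_sum // big1 // => J _.
have [->|cJ] := eqVneq (c J) 0; first by rewrite scale0r mon0.
have detC : \det C != 0 by rewrite -(monJ J0) // mon_neq0.
by rewrite monMz monD // monN !monJ ?cb // divff ?exp1rz.
Qed.

Lemma stabilizer_inv s : stabilizer s -> stabilizer (inv_coord s).
Proof.
move=> [s0 sd]; split; first exact: inv_coord_nonzero.
by move=> j; rewrite /inv_coord exprz_inv -invr_expz sd invr1.
Qed.

Variable X : proj_variety k N.
Hypothesis XE : pv_set X = proj_closure (torus_points W).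

(** Acting on tangent spaces amounts to multiplying their basis matrix by a
    diagonal matrix. *)
Lemma tangent_stabilizer s t : nonzero s -> nonzero t ->
  stabilizer t <-> tangent_space X (hadamard (monomial_point W s) (monomial_point W t)) =
    tangent_space X (monomial_point W s).
Proof.
move=> s0 t0.
have tbE u : nonzero u -> tangent_space X (monomial_point W u) =
    [set v | (v <= tangent_basis W (monomial_point W u))%MS].
  by move=> u0; have [_] := tangent_torus W0 SW XE u0.
have basisM u r : tangent_basis W (hadamard (monomial_point W u) (monomial_point W r)) =
    (diag_mx (monomial_point W r) *m base_change k W)^T *m diag_mx (monomial_point W u) :>
      'M[k]_(n.+1, N.+1).
  rewrite trmx_mul tr_diag_mx tangent_basisE -mulmxA; congr (_ *m _).
  rewrite mulmx_diag; congr diag_mx; apply/rowP => i; rewrite !mxE mulrC //.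
have st0 := nonzeroM s0 t0.
have sub u r : nonzero u -> stabilizer r ->
    tangent_space X (hadamard (monomial_point W u) (monomial_point W r)) `<=`
      tangent_space X (monomial_point W u).
  move=> u0 Hr; have [r0 _] := Hr; rewrite monomial_pointM !tbE //; last exact: nonzeroM.
  move=> v /= h; suff : (v <= tangent_basis W (monomial_point W u))%MS by [].
  apply: submx_trans h _; rewrite -monomial_pointM basisM.
  have [C ->] := (stabilizerP r0).1 Hr.
  by rewrite trmx_mul -mulmxA -tangent_basisE submxMl.
split=> [Ht|].
  apply/seteqP; split; first exact: sub.
  have := sub _ _ st0 (stabilizer_inv Ht); rewrite -monomial_pointM monomial_pointVK //.
rewrite monomial_pointM !tbE // -monomial_pointM => E.
have /submxP[C CE] : (tangent_basis W (hadamard (monomial_point W s) (monomial_point W t)) <=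
  tangent_basis W (monomial_point W s))%MS.
  apply/row_subP => i.
  have : [set v | (v <= tangent_basis W (monomial_point W s))%MS]
      (row i (tangent_basis W (hadamard (monomial_point W s) (monomial_point W t)))) by rewrite
        -E /= row_sub.
  by [].
apply/stabilizerP => //; exists C^T.
have ds0 : diag_mx (monomial_point W s) \in unitmx.
  by rewrite unitmxE det_diag unitfE; apply/prodf_neq0 => i _; apply: monomial_point_neq0.
move: CE; rewrite basisM tangent_basisE mulmxA =>
  /(congr1 (mulmx^~ (invmx (diag_mx (monomial_point W s))))).
by rewrite /= !mulmxK // => /(congr1 trmx); rewrite trmxK trmx_mul trmxK.
Qed.

End GaussFibers.

(** * Fibres of the Gauss map and the Gauss defect *)

Section FiberDimension.
Variables (k : closedFieldType) (n N : nat) (W : 'M[int]_(N.+1, n.+1)).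
Hypothesis W0 : forall i, W i ord0 = 1.
Variable S : 'M[int]_(n.+1, N.+1).
Hypothesis SW : S *m W = 1%:M.
Variable d : 'I_n -> int.
Variable J0 : 'I_n.+1 -> 'I_N.+1.
Hypothesis bJ0 : basis k W J0.
Hypothesis hd : lattice_divisors k W J0 d.
Implicit Types (x y : 'rV[k]_N.+1) (F : {mpoly k[N.+1]}).
Variable X : proj_variety k N.
Hypothesis XE : pv_set X = proj_closure (torus_points W).

Lemma roots_of_unity_seq (m : nat) : (0 < m)%N ->
  exists rs : seq k, forall z : k, z ^+ m = 1 -> z \in rs.
Proof.
move=> m0; have [rs pE] := closed_field_poly_normal ('X^m - 1 : {poly k}).
exists rs => z zm; rewrite -root_prod_XsubC.
have : root ('X^m - 1 : {poly k}) z by rewrite rootE !hornerE zm subrr.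
rewrite pE rootZ // lead_coef_eq0.
by rewrite -size_poly_eq0 size_XnsubC.
Qed.

(** The coordinates on which the lattice of the Gauss map is trivial; they
    parametrise the general fibre. *)
Definition free_coord : pred 'I_n := fun j => d j == 0.
Definition free_index := @enum_val 'I_n free_coord.
Local Notation l := #|free_coord|.

Lemma free_index_inj : injective free_index.
Proof. exact: enum_val_inj. Qed.

Lemma tangent_hadamard_eq y y' s : nonzero s -> tangent_space X y = tangent_space X y' ->
  tangent_space X (hadamard y (monomial_point W s)) =
    tangent_space X (hadamard y' (monomial_point W s)).
Proof.
move=> s0 E; suff sub z z' : tangent_space X z = tangent_space X z' ->
    tangent_space X (hadamard z (monomial_point W s)) `<=`
      tangent_space X (hadamard z' (monomial_point W s)).
  by apply/seteqP; split; apply: sub.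
move=> {}E v; rewrite -[v](monomial_pointVK W v (inv_coord_nonzero s0)).
have -> : inv_coord (inv_coord s) = s by apply: funext => j; rewrite /inv_coord invrK.
by rewrite !(tangent_hadamard W0 XE) // E.
Qed.


(** The fibre contains the orbit of the connected component of the stabiliser. *)
Lemma gauss_fiber_chain s : nonzero s -> irr_chain (gauss_fiber X (monomial_point W s)) l.
Proof.
move=> s0; apply: (subtorus_chain W0 SW free_index_inj (fun i => monomial_point_neq0 W i s0)).
move=> _ [t [t0 tT ->]]; split.
  by rewrite monomial_pointM; apply: (smooth_torus W0 SW XE); apply: nonzeroM.
apply/(tangent_stabilizer W0 SW bJ0 hd XE s0 t0); split=> // j.
have [->|dj] := eqVneq (d j) 0; first by rewrite expr0z.
rewrite tT ?exp1rz //; apply: contra dj => /codomP[z ->].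
exact: (enum_valP z).
Qed.

(** The exponents modulo the saturation of the lattice: the first entry and
    the free coordinates. *)
Definition free_cols : 'M[int]_(N.+1, l.+1) :=
  \matrix_(i, z) W i (if unlift ord0 z is Some z' then lift ord0 (free_index z') else ord0).

(** A finite part, carried by the coordinates with d_j nonzero, times a point
    of the torus of the free coordinates. *)
Lemma monomial_point_split (s : 'I_n.+1 -> k) : monomial_point W s =
  hadamard (monomial_point W (torus_coord 1 (fun j => if d j == 0 then 1 else s (lift ord0 j))))
      (monomial_point free_cols (torus_coord (s ord0) (fun z => s (lift ord0 (free_index z))))).
Proof.
apply/rowP => i; rewrite [RHS]mxE !monomial_pointE //; last by move=> i';
  rewrite mxE unlift_none W0.
rewrite !torus_coord0 mul1r mulrCA; congr (_ * _).
rewrite (bigID free_coord) /= mulrC; congr (_ * _).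
  rewrite [RHS](bigID free_coord) /= [X in _ = X * _]big1 ?mul1r => [|j].
    by apply: eq_bigr => j; rewrite /free_coord torus_coordS => /negPf ->.
  by rewrite /free_coord torus_coordS => ->; rewrite exp1rz.
rewrite big_enum_val; apply: eq_bigr => z _.
by rewrite torus_coordS mxE liftK.
Qed.

(** Each nonempty stratum of the fibre with given support is one orbit of the
    stabiliser, whose coordinates with d_j nonzero are roots of unity. So the
    fibre is parametrised by l + 1 free variables and by finitely many data,
    the support and these roots of unity. *)
Lemma gauss_fiber_bound s e : nonzero s ->
  irr_chain (gauss_fiber X (monomial_point W s)) e -> (e < l.+1)%N.
Proof.
move=> s0; pose D := (\prod_(j | d j != 0) absz (d j))%N.
have D0 : (0 < D)%N by rewrite prodn_cond_gt0 // => j; rewrite absz_gt0.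
have [rs rsP] := roots_of_unity_seq D0.
have rootD (t : 'I_n.+1 -> k) j : stabilizer d t -> d j != 0 -> t (lift ord0 j) \in rs.
  move=> [t0 td] dj; apply: rsP; rewrite /D (bigD1 j) //= exprM.
  suff -> : t (lift ord0 j) ^+ absz (d j) = 1 by rewrite expr1n.
  by case: (d j) (td j) => m //; rewrite NegzE -exprnN => /(congr1 GRing.inv); rewrite invrK invr1.
have rs1 : 1 \in rs by apply: rsP; rewrite expr1n.
(* one point of the fibre is chosen for each support, if there is one *)
pose yS (A : {set 'I_N.+1}) : 'rV[k]_N.+1 :=
  xget 0 [set y | gauss_fiber X (monomial_point W s) y /\ forall i, (y 0 i == 0) = (i \notin A)].
pose Y0 (p : {set 'I_N.+1} * {ffun 'I_n -> seq_sub rs}) :=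
  hadamard (yS p.1) (monomial_point W (torus_coord 1 (fun j => ssval (p.2 j)))).
apply: (dimension_bound (Y0 := Y0) (V := free_cols)
          (sub_proj_closure (Y := gauss_fiber X (monomial_point W s)) _)).
  by move=> y [/(smoothP W0 SW XE)[Xy _] _]; apply: variety_neq0 XE _ Xy.
move=> y Fy a a0; pose A := [set i | y 0 i != 0]%SET.
have Ay i : (y 0 i == 0) = (i \notin A) by rewrite inE negbK.
have [y1F y1A] : [set y | gauss_fiber X (monomial_point W s) y /\
    forall i, (y 0 i == 0) = (i \notin A)] (yS A) by apply: xgetPex; exists y.
have [/(smoothP W0 SW XE)[Xy _] Ty] := Fy.
have [/(smoothP W0 SW XE)[Xy1 _] Ty1] := y1F.
have [t t0 yE] : exists2 t, nonzero t & y = hadamard (yS A) (monomial_point W t).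
  by apply: (same_support_orbit W0 XE) => // i; rewrite Ay y1A.
have Ht : stabilizer d t.
  apply/(tangent_stabilizer W0 SW bJ0 hd XE s0 t0).
  by rewrite -(tangent_hadamard_eq t0 Ty1) -yE.
pose t' j := t j * scalar_coord a j.
have t'0 : nonzero t' by apply: nonzeroM => //; apply: scalar_coord_nonzero.
have t'S j : t' (lift ord0 j) = t (lift ord0 j).
  by rewrite /t' /scalar_coord torus_coordS mulr1.
pose r := [ffun j => insubd (SeqSub rs1) (if d j == 0 then 1 else t' (lift ord0 j))].
have rE j : ssval (r j) = if d j == 0 then 1 else t' (lift ord0 j).
  rewrite ffunE insubdK //; case: (boolP (d j == 0)) => // dj.
  by rewrite t'S; apply: rootD.
exists (A, r), (torus_coord (t' ord0) (fun z => t' (lift ord0 (free_index z)))); split.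
  by apply: torus_coord_nonzero => [|z]; apply: t'0.
rewrite (scale_hadamard W0) yE -hadamardA monomial_pointM -/t' (monomial_point_split t')
  hadamardA /Y0 /=.
congr (hadamard (hadamard _ (monomial_point W _)) _); apply: funext => j; congr (torus_coord _ _ j).
by apply: funext => i; rewrite rE.
Qed.

Lemma gauss_fiber_dimension s : nonzero s -> dimension (gauss_fiber X (monomial_point W s)) = l.
Proof.
move=> s0; apply: dimension_eq; first exact: gauss_fiber_chain.
by move=> e /(gauss_fiber_bound s0); rewrite ltnS.
Qed.

(** All points of the torus are equivalent, and any closed set that does not
    contain all smooth points misses one of them. *)
Lemma gauss_defect_toric : gauss_defect X = l.
Proof.
have meets C : proj_closed C -> ~ smooth X `<=` C ->
    exists2 s, nonzero s & ~ C (monomial_point W s).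
  move=> Cc nC; apply: contrapT => no; apply: nC => x [Xx _].
  suff : proj_closure (torus_points W) `<=` C by apply; rewrite -XE.
  apply: proj_closure_min => // _ [s s0 ->]; apply: contrapT => ns; apply: no.
  by exists s.
rewrite /gauss_defect; case: xgetP => [e _ [C [Cc nC CE]]|no].
  have [s s0 ns] := meets C Cc nC.
  rewrite -(gauss_fiber_dimension s0); apply/esym/CE => //.
  exact: (smooth_torus W0 SW XE s0).
case: (no l); pose m1 := [multinom 1%N | i < N.+1]; pose F : {mpoly k[N.+1]} := 'X_[m1].
have Fh : F \is homog mdeg by apply/homogP; exists (mdeg m1); rewrite dhomogX.
have FE x : F.@[x 0] = \prod_i x 0 i.
  by rewrite mevalX; apply: eq_bigr => i _; rewrite mnmE.
(* the points to be avoided are those of the boundary *)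
exists (proj_zeros [set F]); split.
- by exists [set F]; split=> // _ ->.
- move/(_ (monomial_point W (fun=> 1))) => h.
  have n1 : nonzero (fun _ : 'I_n.+1 => 1 : k) by move=> j; apply: oner_neq0.
  have [_ /(_ F (erefl _))/eqP] := h (smooth_torus W0 SW XE n1).
  by rewrite FE; apply/negP/prodf_neq0 => i _; apply: monomial_point_neq0.
move=> x /(smoothP W0 SW XE)[Xx _] nx.
have x0 i : x 0 i != 0.
  apply: contra_notN nx => /eqP xi; split; first exact: variety_neq0 XE _ Xx.
  by move=> _ ->; rewrite FE (bigD1 i) //= xi mul0r.
have n1 : nonzero (fun _ : 'I_n.+1 => 1 : k) by move=> j; apply: oner_neq0.
have X1 : pv_set X (monomial_point W (fun=> 1)) by apply: torus_in_variety XE _ n1.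
have [|s s0 ->] := same_support_orbit W0 XE X1 Xx.
  by move=> i; rewrite (negPf (x0 i)) (negPf (monomial_point_neq0 _ _ n1)).
by rewrite monomial_pointM gauss_fiber_dimension //; apply: nonzeroM.
Qed.

End FiberDimension.

(** * Purely inseparable elements in separable extensions *)

Section InseparableElements.
Variable L : fieldType.
Implicit Types (G : set L).

Lemma subfield1 G : is_subfield G -> G 1.
Proof. by case=> /set_mem. Qed.

Lemma subfieldB G x y : is_subfield G -> G x -> G y -> G (x - y).
Proof. by case=> _ h _ /mem_set Gx /mem_set Gy; apply/set_mem/h. Qed.

Lemma subfield_div G x y : is_subfield G -> G x -> G y -> G (x / y).
Proof. by case=> _ _ h /mem_set Gx /mem_set Gy; apply/set_mem/h. Qed.

Lemma subfield0 G : is_subfield G -> G 0.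
Proof. by move=> sG; rewrite -(subrr 1); apply: subfieldB => //; apply: subfield1. Qed.

Lemma subfieldN G x : is_subfield G -> G x -> G (- x).
Proof. by move=> sG Gx; rewrite -sub0r; apply: subfieldB => //; apply: subfield0. Qed.

Lemma subfieldD G x y : is_subfield G -> G x -> G y -> G (x + y).
Proof. by move=> sG Gx Gy; rewrite -[y]opprK; apply: subfieldB => //; apply: subfieldN. Qed.

Lemma subfieldV G x : is_subfield G -> G x -> G x^-1.
Proof. by move=> sG Gx; rewrite -div1r; apply: subfield_div => //; apply: subfield1. Qed.

Lemma subfieldM G x y : is_subfield G -> G x -> G y -> G (x * y).
Proof. by move=> sG Gx Gy; rewrite -[y]invrK; apply: subfield_div => //; apply: subfieldV. Qed.

Lemma subfieldXz G x (z : int) : is_subfield G -> G x -> G (x ^ z).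
Proof.
move=> sG Gx; have GX m : G (x ^+ m).
  by elim: m => [|m IH]; rewrite ?expr0 ?exprS; [apply: subfield1 | apply: subfieldM].
by case: z => m; rewrite ?NegzE -?exprnN; [apply: GX | apply: subfieldV].
Qed.

Lemma polyOver_setP G (p : {poly L}) : G 0 ->
  p \is a polyOver (mem G) <-> forall i, G p`_i.
Proof.
move=> G0; split=> [/allP h i|h].
  have [ip|ip] := ltnP i (size p); last by rewrite nth_default.
  by apply/set_mem/h/mem_nth.
by apply/allP => _ /(nthP 0)[i _ <-]; apply/mem_set.
Qed.

(** Euclidean division by a monic polynomial does not leave the field of
    coefficients; G is only a subset of L, hence the explicit recursion. *)
Lemma polyOver_division G (q A : {poly L}) : is_subfield G -> q \is monic ->
  (forall i, G q`_i) -> (forall i, G A`_i) ->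
  exists C R : {poly L}, [/\ forall i, G R`_i, A = C * q + R & (size R < size q)%N].
Proof.
move=> sG mq Gq; have [m] := ubnP (size A); elim: m => // m IH in A *.
rewrite ltnS => sA GA; have [Aq|qA] := ltnP (size A) (size q).
  by exists 0, A; rewrite mul0r add0r.
have q0 : (0 < size q)%N by rewrite size_poly_gt0 monic_neq0.
pose T := lead_coef A *: 'X^(size A - size q).
have GT i : G T`_i.
  rewrite coefZ coefXn lead_coefE; case: eqP => _; rewrite ?mulr1 ?mulr0 //.
  exact: subfield0.
have A0 : A != 0 by rewrite -size_poly_gt0 (leq_trans q0).
have TqA : size (T * q) = size A.
  by rewrite /T -scalerAl size_scale ?lead_coef_eq0 // size_monicM ?monicXn ?monic_neq0 //
    size_polyXn addSn subnK.
have sA' : (size (A - T * q)%R < size A)%N.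
  rewrite -(@prednK (size A)) ?size_poly_gt0 // ltnS; apply/leq_sizeP => j.
  rewrite leq_eqVlt coefB => /orP[/eqP <-|jA].
    rewrite -[X in _ - _`_X]/(size A).-1 -{2}TqA -!lead_coefE lead_coefM (monicP mq) mulr1.
    by rewrite /T lead_coefZ lead_coefXn mulr1 subrr.
  rewrite prednK ?size_poly_gt0 // in jA.
  by rewrite !nth_default ?subrr // TqA.
have [|i|C [R [GR E sR]]] := IH (A - T * q); first exact: leq_trans sA' sA.
  rewrite coefB; apply: subfieldB => //; rewrite coefM.
  apply: (big_ind G); first exact: subfield0.
    by move=> x y; apply: subfieldD.
  by move=> j _; apply: subfieldM.
exists (C + T), R; split=> //; rewrite mulrDl addrAC -E addrNK //.
Qed.

(** The minimal polynomial divides X^p - x^p = (X - x)^p and has no multiple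
    root, so it is X - x. *)
Lemma separable_insep_in G x p : is_subfield G -> p \in [pchar L] ->
  G (x ^+ p) -> separable_over G x -> G x.
Proof.
move=> sG pL Gxp [q [mq /(polyOver_setP _ (subfield0 sG)) Gq qx qmin] sep].
have p0 : (0 < p)%N by apply: prime_gt0 (pcharf_prime pL).
have frob : 'X^p - (x ^+ p)%:P = ('X - x%:P) ^+ p.
  have pLX : p \in [pchar {poly L}] by rewrite (rmorph_pchar polyC).
  by rewrite -!(pFrobenius_autE pLX) pFrobenius_autB_comm ?pFrobenius_autE ?polyC_exp //;
    apply: mulrC.
have [|C [R [GR E sR]]] := polyOver_division (A := 'X^p - (x ^+ p)%:P) sG mq Gq.
  move=> i; rewrite coefB coefXn coefC; apply: subfieldB => //.
    by case: eqP => _; [apply: subfield1 | apply: subfield0].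
  by case: eqP => _ //; apply: subfield0.
have R0 : R = 0.
  apply/eqP/contraT => R0; have : (size q <= size R)%N.
    apply: qmin => //; first by apply/(polyOver_setP _ (subfield0 sG)).
    have /(congr1 (horner^~ x)) := E; rewrite !hornerE (rootP qx) mulr0 add0r subrr.
    by move/esym/eqP.
  by rewrite leqNgt sR.
have : q %| ('X - x%:P) ^+ p by rewrite -frob E R0 addr0 dvdp_mull.
case/dvdp_exp_XsubCP => e _ qe.
have e1 : (e <= 1)%N.
  rewrite leqNgt; apply/negP => e2; have := separable_nosquare sep e2 (u := 'X - x%:P).
  by rewrite size_XsubC (eqp_dvdr _ qe) dvdpp => /(_ isT).
have [e0|] := posnP e.
  have : root ('X - x%:P) x by rewrite root_XsubC.
  by move: qx; rewrite (eqp_root qe) e0 expr0 (negPf (root1 _)).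
case: e e1 qe => [|[|e]] // _; rewrite expr1 eqp_monic ?monicXsubC // => /eqP qE _.
have := Gq 0%N; rewrite qE coefB coefX coefC sub0r /= => /(subfieldN sG).
by rewrite opprK.
Qed.

Lemma adjoin_frobenius G (s : seq L) p : is_subfield G -> p \in [pchar L] ->
  (forall x, x \in s -> G (x ^+ p)) ->
  forall x, adjoin G [set` s] x -> G (x ^+ p).
Proof.
move=> sG pL sp; pose T : set L := [set x | G (x ^+ p)].
have sT : is_subfield T.
  split; first by apply/mem_set; rewrite /T /= expr1n; apply: subfield1.
  - move=> x y /set_mem Tx /set_mem Ty; apply/mem_set; rewrite /T /= -(pFrobenius_autE pL).
    by rewrite pFrobenius_autB_comm ?pFrobenius_autE; [apply: subfieldB | apply: mulrC].
  - move=> x y /set_mem Tx /set_mem Ty; apply/mem_set; rewrite /T /= exprMn exprVn.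
    exact: subfield_div.
apply: smallest_sub => // x [Gx|/sp //]; exact: (subfieldXz p%:Z sG Gx).
Qed.

(** Apply the hypothesis to the subextension generated by x. All its p-th
    powers are in G, so a separating transcendence basis of it is empty, and x
    is both separable and purely inseparable over G. *)
Lemma separable_extension_insep G x p (E : set L) : is_subfield G -> p \in [pchar L] ->
  separable_extension G E -> E x -> G (x ^+ p) -> G x.
Proof.
move=> sG pL sepE Ex Gxp.
have [|r [b [bE bind bsep]]] := sepE [:: x].
  by move=> y; rewrite /= inE => /eqP ->.
have Gp : forall y, adjoin G [set` [:: x]] y -> G (y ^+ p).
  by apply: adjoin_frobenius => // y; rewrite inE => /eqP ->.
have p0 : (0 < p)%N by apply: prime_gt0 (pcharf_prime pL).
(* an element b of the basis would be a root of X^p - b^p *)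
have r0 : r = 0%N.
  case: r b bE bind {bsep} => // r b bE bind; exfalso.
  pose P : {mpoly L[r.+1]} := 'X_ord0 ^+ p - (b ord0 ^+ p)%:MP.
  have : P = 0.
    apply: bind; last by rewrite mevalB mevalC rmorphXn /= mevalXU subrr.
    apply/allP => _ /mapP[m _ ->]; apply/mem_set; rewrite mcoeffB mpolyXn mcoeffX mcoeffC.
    apply: subfieldB => //; first by case: eqP => _; [apply: subfield1 | apply: subfield0].
    apply: subfieldM => //; first by apply: Gp; apply: bE.
    by case: eqP => _; [apply: subfield1 | apply: subfield0].
  move/(congr1 (mcoeff (U_(ord0) *+ p))); rewrite mcoeffB mpolyXn mcoeffX eqxx mcoeffC.
  rewrite mcoeff0 -mdeg_eq0 mdegMn mdeg1 mul1n (gtn_eqF p0) mulr0 subr0.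
  by move/eqP; rewrite oner_eq0.
have sub : G `<=` adjoin G (range b) by apply: sub_smallest; left.
have adjG : adjoin G (range b) = G.
  apply/seteqP; split=> //; apply: smallest_sub => // y [//|[i _ _]].
  by move: (i); rewrite r0 => -[].
apply: (separable_insep_in sG pL Gxp); rewrite -{1}adjG; apply: bsep.
by move=> T [_ sT]; apply: sT; right; rewrite /= inE.
Qed.
End InseparableElements.

(** * Density of the torus for identities in Pluecker coordinates *)

Section Gradients.
Variables (k : closedFieldType) (N : nat) (X : proj_variety k N).
Implicit Types (x y : 'rV[k]_N.+1) (F : {mpoly k[N.+1]}).

Definition jacobian r (f : 'I_r -> {mpoly k[N.+1]}) x : 'M[k]_(r, N.+1) :=
  \matrix_(i, j) ((f i)^`M(j)).@[x 0].

Lemma jacobian_tangent r (f : 'I_r -> {mpoly k[N.+1]}) x v :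
  (forall i, f i \in pv_ideal X) -> tangent_space X x v -> v *m (jacobian f x)^T = 0.
Proof.
move=> fI Tv; apply/rowP => i; rewrite mxE [RHS]mxE -[RHS](Tv _ (fI i)).
by apply: eq_bigr => j _; rewrite !mxE mulrC.
Qed.

(** A finite family of equations with independent gradients at x, of maximal
    size, defines the tangent space. *)
Lemma maximal_jacobian x : exists r (f : 'I_r -> {mpoly k[N.+1]}),
  [/\ forall i, f i \in pv_ideal X, row_free (jacobian f x) &
      tangent_space X x = [set v | v *m (jacobian f x)^T = 0]].
Proof.
pose P r := `[< exists f : 'I_r -> {mpoly k[N.+1]},
  (forall i, f i \in pv_ideal X) /\ row_free (jacobian f x) >].
have P0 : exists r, P r.
  exists 0%N; apply/asboolP; exists (fun=> 0); split=> [[]|] //.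
  by rewrite /row_free flatmx0 mxrank0.
have Pmax r : P r -> (r <= N.+1)%N.
  by move/asboolP=> [f [_ /eqP fr]]; rewrite -{1}fr rank_leq_col.
have [r /asboolP[f [fI fr]] rmax] := ex_maxnP P0 Pmax.
exists r, f; split=> //; apply/seteqP; split=> v; first exact: jacobian_tangent.
move=> vC F FI; pose g : 'rV[k]_N.+1 := \row_j (F^`M(j)).@[x 0].
suff /submxP[a gE] : (g <= jacobian f x)%MS.
  have : v *m g^T = 0 by rewrite gE trmx_mul mulmxA vC mul0mx.
  move/rowP/(_ 0); rewrite mxE [RHS]mxE => h; rewrite -[RHS]h.
  by apply: eq_bigr => j _; rewrite !mxE mulrC.
apply/negPn/negP => gC.
have : (r.+1 <= r)%N; last by rewrite ltnn.
apply: rmax; apply/asboolP.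
exists (fun i => if unlift ord0 i is Some j then f j else F); split.
  by move=> i; case: unliftP.
apply: inj_row_free => w wJ.
have E : w 0 ord0 *: g + (\row_i w 0 (lift ord0 i)) *m jacobian f x = 0.
  apply/rowP => j; have /rowP/(_ j) := wJ; rewrite mxE big_ord_recl.
  rewrite [RHS]mxE => h; rewrite [RHS]mxE -[RHS]h !mxE unlift_none; congr (_ + _).
  by apply: eq_bigr => i _; rewrite !mxE liftK.
have w0 : w 0 ord0 = 0.
  apply/eqP/negPn/negP => w0; case/negP: gC.
  rewrite -(eqmx_scale _ w0); move/eqP: E; rewrite addr_eq0 => /eqP ->.
  by rewrite -mulNmx submxMl.
have /rowP w'0 : \row_i w 0 (lift ord0 i) = 0.
  by apply: (row_free_injr fr) => /=; move: E; rewrite w0 scale0r add0r mul0mx.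
apply/rowP => i; rewrite [RHS]mxE; have [j ->|-> //] := unliftP ord0 i.
by have := w'0 j; rewrite !mxE.
Qed.

End Gradients.

Lemma meval_homogZ (k : closedFieldType) p e (Q : {mpoly k[p]}) c (v : 'I_p -> k) :
  Q \is e.-homog -> Q.@[fun a => c * v a] = c ^+ e * Q.@[v].
Proof.
move=> /dhomogP hQ; rewrite !mevalE mulr_sumr !big_seq; apply: eq_bigr => m mQ.
rewrite mulrCA; congr (_ * _); have <- : mdeg m = e := hQ m mQ.
rewrite mdegE -prodrXr -big_split /=.
by apply: eq_bigr => i _; rewrite exprMn.
Qed.

Section PluckerDensity.
Variables (k : closedFieldType) (N : nat) (X : proj_variety k N).
Local Notation n := (dimension X).
Variable W : 'M[int]_(N.+1, n.+1).
Hypothesis W0 : forall i, W i ord0 = 1.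
Variable S : 'M[int]_(n.+1, N.+1).
Hypothesis SW : S *m W = 1%:M.
Hypothesis XE : pv_set X = proj_closure (torus_points W).
Implicit Types (x y : 'rV[k]_N.+1) (F G : {mpoly k[N.+1]}).
Implicit Types (P Q : {mpoly k[#|plucker_index X|]}).

Lemma plucker_mul (A : 'M[k]_n.+1) (B : 'M[k]_(n.+1, N.+1)) a :
  plucker (A *m B) a = \det A * plucker B a.
Proof. by rewrite /plucker -mulmx_colsub det_mulmx. Qed.

(** The identity is only given on the torus, but smooth points of the boundary
    matter as well. Near a smooth point x the tangent space is the kernel of a
    jacobian of constant rank; with R0 a right inverse of the jacobian C0 at x
    and M = C R0, the rows of det(M) B - B C^T adj(M)^T R0^T span this kernel.
    They depend polynomially on the point and specialise to B at x, so the
    identity becomes a polynomial one on X. *)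
Lemma plucker_density F G e P Q : P \is e.-homog -> Q \is e.-homog ->
  (forall s, nonzero s -> F.@[(monomial_point W s) 0] * Q.@[plucker (tangent_basis W
    (monomial_point W s))] =
     G.@[(monomial_point W s) 0] * P.@[plucker (tangent_basis W (monomial_point W s))]) ->
  forall x B, smooth X x -> row_basis B (tangent_space X x) ->
    F.@[x 0] * Q.@[plucker B] = G.@[x 0] * P.@[plucker B].
Proof.
move=> Ph Qh FG x B [Xx _] [Bf BE].
have [r [f [fI fr TE]]] := maximal_jacobian X x.
have [R0 CR0] := row_freeP fr; set C0 := jacobian f x in fr TE CR0.
have BC0 : B *m C0^T = 0.
  apply/row_matrixP => i; rewrite row_mul row0.
  have : [set v | v *m C0^T = 0] (row i B) by rewrite -TE BE /= row_sub.
  by [].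
have rankr : (r + n.+1 = N.+1)%N.
  have rC : \rank C0^T = r by rewrite mxrank_tr (eqP fr).
  have BK : (B == kermx C0^T)%MS.
    apply/andP; split; first exact/sub_kermxP.
    apply/row_subP => i; have : [set v | (v <= B)%MS] (row i (kermx C0^T)).
      by rewrite -BE TE /= -row_mul mulmx_ker row0.
    by [].
  have : \rank B = n.+1 by apply/eqP.
  rewrite (eqmxP BK) mxrank_ker rC => <-; rewrite subnKC //.
  by rewrite -rC rank_leq_row.
pose ev y := meval (y 0) : {rmorphism {mpoly k[N.+1]} -> k}.
pose mc := @mpolyC N.+1 k : {rmorphism k -> {mpoly k[N.+1]}}.
have evc y p q (A : 'M[k]_(p, q)) : map_mx (ev y) (map_mx mc A) = A.
  by apply/matrixP => i j; rewrite !mxE /= mevalC.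
pose C : 'M[{mpoly k[N.+1]}]_(r, N.+1) := \matrix_(i, j) (f i)^`M(j).
have evC y : map_mx (ev y) C = jacobian f y by apply/matrixP => i j; rewrite !mxE.
pose M := C *m map_mx mc R0; pose dl := \det M.
pose Bp := dl *: map_mx mc B - map_mx mc B *m C^T *m (\adj M)^T *m (map_mx mc R0)^T.
pose By y := map_mx (ev y) Bp.
have ByE y : By y = (\det (jacobian f y *m R0)) *: B -
    B *m (jacobian f y)^T *m (\adj (jacobian f y *m R0))^T *m R0^T.
  rewrite /By /Bp map_mxB map_mxZ !map_mxM -!map_trmx map_mx_adj evc evC.
  by rewrite map_mxM !evc evC /dl -det_map_mx map_mxM evc evC.
have Bx : By x = B.
  by rewrite ByE -/C0 BC0 !mul0mx subr0 CR0 det1 scale1r.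
have dlE y : dl.@[y 0] = \det (jacobian f y *m R0).
  by rewrite -[LHS]/(ev y dl) /dl -det_map_mx map_mxM evc evC.
have ByC y : By y *m (jacobian f y)^T = 0.
  rewrite ByE mulmxBl -scalemxAl -!mulmxA -trmx_mul mulmxA -[X in _ - _ *m X]trmx_mul.
  by rewrite mul_mx_adj tr_scalar_mx mul_mx_scalar subrr.
pose pl : #|plucker_index X|.-tuple {mpoly k[N.+1]} :=
  [tuple \det (colsub (val (enum_val a)) Bp) | a < #|plucker_index X|].
have plE Q' y : (Q' \mPo pl).@[y 0] = Q'.@[plucker (By y)].
  rewrite comp_mpoly_meval; apply: meval_eq => a; rewrite tnth_mktuple.
  by rewrite -[LHS]/(ev y _) -det_map_mx map_mxsub.
have : dl * (F * (Q \mPo pl) - G * (P \mPo pl)) \in pv_ideal X.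
  apply/(toric_idealP W0 XE) => s s0; set y := monomial_point W s.
  rewrite mevalM mevalB !mevalM !plE.
  (* the factor dl allows to assume that the jacobian has full rank at y *)
  have [->|dl0] := eqVneq dl.@[y 0] 0; first by rewrite mul0r.
  have Cf : row_free (jacobian f y).
    rewrite -row_leq_rank; apply: leq_trans (mxrankM_maxl _ R0).
    by rewrite mxrank_unit // unitmxE unitfE -dlE.
  have [tf tE] := tangent_torus W0 SW XE s0.
  have tC : tangent_basis W y *m (jacobian f y)^T = 0.
    apply/row_matrixP => i; rewrite row_mul row0; apply: jacobian_tangent => //.
    by rewrite tE /= row_sub.
  have tK : (tangent_basis W y == kermx (jacobian f y)^T)%MS.
    rewrite -(mxrank_leqif_eq (introT sub_kermxP tC)) mxrank_ker mxrank_tr.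
    by rewrite (eqP tf) (eqP Cf) -rankr addKn.
  have /submxP[A AE] : (By y <= tangent_basis W y)%MS.
    by rewrite (eqmxP tK); apply/sub_kermxP.
  have plA Q' : Q' \is e.-homog -> Q'.@[plucker (By y)] =
      \det A ^+ e * Q'.@[plucker (tangent_basis W y)].
    move=> Q'h; rewrite -meval_homogZ //; apply: meval_eq => a.
    by rewrite AE plucker_mul.
  by rewrite !plA // mulrCA FG // -/y [X in _ - X]mulrCA subrr mulr0.
move/pv_idealP/(_ x Xx); rewrite mevalM mevalB !mevalM !plE dlE -/C0 CR0 det1 mul1r Bx.
by move/eqP; rewrite subr_eq0 => /eqP.
Qed.

End PluckerDensity.

(** * Function field and field of the Gauss image *)

Section CoordinateFractions.
Local Open Scope quotient_scope.
Variables (k : closedFieldType) (N : nat) (X : proj_variety k N).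
Implicit Types (F G : {mpoly k[N.+1]}).
Local Notation cls := (coord_class X).
Local Notation frac := (coord_frac X).

Lemma coord_classB F G : cls (F - G) = cls F - cls G.
Proof. by rewrite /coord_class rmorphB. Qed.

Lemma coord_classM F G : cls (F * G) = cls F * cls G.
Proof. by rewrite /coord_class rmorphM. Qed.

Lemma coord_class1 : cls 1 = 1.
Proof. by rewrite /coord_class rmorph1. Qed.

Lemma coord_class_eq F G : (cls F == cls G) = (F - G \in pv_ideal X).
Proof. rewrite /coord_class Quotient.idealrBE. reflexivity. Qed.


Lemma coord_class_eq0 F : (cls F == 0) = (F \in pv_ideal X).
Proof. by rewrite -[F in RHS]subr0 -coord_class_eq /coord_class rmorph0. Qed.

Lemma ideal_mulN F G : F \notin pv_ideal X -> G \notin pv_ideal X -> F * G \notin pv_ideal X.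
Proof.
rewrite -(coord_class_eq0 F) -(coord_class_eq0 G) -(coord_class_eq0 (F * G)) => F0 G0.
rewrite coord_classM.
exact: (@mulf_neq0 (coord_ring X) _ _ F0 G0).
Qed.

Lemma ideal_mul F G : F \in pv_ideal X -> G * F \in pv_ideal X.
Proof.
rewrite -(coord_class_eq0 F) -(coord_class_eq0 (G * F)) coord_classM => /eqP ->.
by rewrite mulr0.
Qed.

Lemma tofrac_class_neq0 G : G \notin pv_ideal X -> FracField.tofrac (cls G) != 0.
Proof. by rewrite tofrac_eq0 coord_class_eq0. Qed.

Lemma coord_frac_eq F1 G1 F2 G2 : G1 \notin pv_ideal X -> G2 \notin pv_ideal X ->
  frac F1 G1 = frac F2 G2 <-> F1 * G2 - F2 * G1 \in pv_ideal X.
Proof.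
move=> h1 h2; rewrite -coord_class_eq !coord_classM -tofrac_eq !tofracM.
have g1 := tofrac_class_neq0 h1; have g2 := tofrac_class_neq0 h2.
rewrite -(eqr_div _ _ g1 g2); exact: (rwP eqP).
Qed.

Lemma coord_fracM F1 G1 F2 G2 : frac F1 G1 * frac F2 G2 = frac (F1 * F2) (G1 * G2).
Proof. by rewrite /coord_frac !coord_classM !tofracM invfM mulrACA. Qed.

Lemma coord_fracV F G : (frac F G)^-1 = frac G F.
Proof. by rewrite /coord_frac invf_div. Qed.

Lemma coord_fracB F1 G1 F2 G2 : G1 \notin pv_ideal X -> G2 \notin pv_ideal X ->
  frac F1 G1 - frac F2 G2 = frac (F1 * G2 - F2 * G1) (G1 * G2).
Proof.
move=> h1 h2; have g1 := tofrac_class_neq0 h1; have g2 := tofrac_class_neq0 h2.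
rewrite /coord_frac coord_classB !coord_classM tofracB !tofracM mulrBl.
rewrite invfM mulrACA divff; last exact: g2.
rewrite mulr1 [X in _ = _ - _ * X]mulrC mulrACA divff; last exact: g1.
by rewrite mulr1.
Qed.

Lemma coord_frac_self F : F \notin pv_ideal X -> frac F F = 1.
Proof. by move=> h; rewrite /coord_frac divff ?tofrac_class_neq0. Qed.

Lemma coord_frac_denom0 F G : G \in pv_ideal X -> frac F G = 0.
Proof.
rewrite -(coord_class_eq0 G) -tofrac_eq0 => /eqP G0.
by rewrite /coord_frac G0 invr0 mulr0.
Qed.

Lemma coord_frac_num0 G : frac 0 G = 0.
Proof. by rewrite /coord_frac /coord_class rmorph0 tofrac0 mul0r. Qed.

(** The coordinate ring is a k-algebra. *)
Lemma coord_frac_pchar p : p \in [pchar k] -> p \in [pchar {fraction coord_ring X}].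
Proof.
case/andP=> pr /eqP pk; rewrite inE pr -(rmorph_nat (@FracField.tofrac _)) /=.
rewrite tofrac_eq0 -(rmorph_nat (\pi_{ideal_quot (pv_prime X)})) /= -/(coord_class X _).
rewrite coord_class_eq0; apply/pv_idealP => x _.
by rewrite -mpolyC_nat mevalC pk.
Qed.

End CoordinateFractions.

Section GaussField.
Variables (k : closedFieldType) (N : nat) (X : proj_variety k N).
Local Notation n := (dimension X).
Variable W : 'M[int]_(N.+1, n.+1).
Hypothesis W0 : forall i, W i ord0 = 1.
Variable S : 'M[int]_(n.+1, N.+1).
Hypothesis SW : S *m W = 1%:M.
Hypothesis XE : pv_set X = proj_closure (torus_points W).
Implicit Types (x y : 'rV[k]_N.+1) (F G : {mpoly k[N.+1]}).
Implicit Types (P Q : {mpoly k[#|plucker_index X|]}).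
Local Notation frac := (coord_frac X).

Definition plucker_cols (a : 'I_#|plucker_index X|) : 'I_n.+1 -> 'I_N.+1 :=
  val (enum_val a).

Definition index_mnm (J : 'I_n.+1 -> 'I_N.+1) : 'X_{1..N.+1} := (\sum_b U_(J b))%MM.

(** The Pluecker coordinate of the tangent space at a torus point, as a
    monomial in the coordinates of the point. *)
Definition plucker_poly a : {mpoly k[N.+1]} :=
  \det (rowsub (plucker_cols a) (base_change k W)) *: 'X_[index_mnm (plucker_cols a)].

Definition plucker_pullback Q : {mpoly k[N.+1]} :=
  Q \mPo [tuple plucker_poly a | a < #|plucker_index X|].

Lemma prod_index_mnm x J : \prod_i x 0 i ^+ index_mnm J i = \prod_b x 0 (J b).
Proof.
transitivity (\prod_i \prod_b x 0 i ^+ (U_(J b))%MM i).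
  by apply: eq_bigr => i _; rewrite /index_mnm mnm_sumE expr_sum.
rewrite exchange_big /=; apply: eq_bigr => b _.
rewrite (bigD1 (J b)) //= mnm1E eqxx expr1 big1 ?mulr1 // => i iJ.
by rewrite mnm1E eq_sym (negPf iJ) expr0.
Qed.

Lemma weight_index_mnm J : weight W (index_mnm J) = weight_sum W J.
Proof.
rewrite /index_mnm (big_morph (weight W) (@weightD N _ W) (weight0 W)); apply: eq_bigr => b _.
rewrite /weight (bigD1 (J b)) //= mnm1E eqxx scale1r big1 ?addr0 // => i iJ.
by rewrite mnm1E eq_sym (negPf iJ) scale0r.
Qed.

Lemma plucker_tangent_basis x a : plucker (tangent_basis W x) a = (plucker_poly a).@[x 0].
Proof.
rewrite /plucker_poly mevalZ mevalX prod_index_mnm /plucker -/(plucker_cols a).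
move: (plucker_cols a) => J; rewrite -det_tr mulrC.
have -> : (colsub J (tangent_basis W x))^T =
    diag_mx (\row_b x 0 (J b)) *m rowsub J (base_change k W).
  by rewrite mul_diag_mx; apply/matrixP => b j; rewrite !mxE.
by rewrite det_mulmx det_diag; congr (_ * _); apply: eq_bigr => b _; rewrite mxE.
Qed.

Lemma plucker_pullbackE Q x :
  (plucker_pullback Q).@[x 0] = Q.@[plucker (tangent_basis W x)].
Proof.
rewrite comp_mpoly_meval; apply: meval_eq => a.
by rewrite tnth_mktuple plucker_tangent_basis.
Qed.

(** The definition of the Gauss field only asks for some smooth point,
    possibly in the boundary, where Q does not vanish; by density there is
    then one in the torus. *)
Lemma plucker_pullback_nonzero e Q : Q \is e.-homog ->
  (plucker_pullback Q \notin pv_ideal X) <->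
  exists x (B : 'M[k]_(n.+1, N.+1)),
    [/\ smooth X x, row_basis B (tangent_space X x) & Q.@[plucker B] != 0].
Proof.
move=> Qh; split=> [QI|[x [B [sx xB QB]]]].
  apply: contrapT => no; case/negP: QI; apply/(toric_idealP W0 XE) => s s0.
  rewrite plucker_pullbackE; apply/eqP/negPn/negP => Qs; apply: no.
  exists (monomial_point W s), (tangent_basis W (monomial_point W s)); split=> //.
    exact: (smooth_torus W0 SW XE s0).
  exact: (tangent_torus W0 SW XE s0).
apply/negP => /(toric_idealP W0 XE) QI; case/eqP: QB.
have := plucker_density (F := 1) (G := 0) W0 SW XE Qh Qh _ sx xB.
rewrite meval1 meval0 mul1r mul0r; apply=> s s0.
by rewrite meval1 meval0 mul1r mul0r -plucker_pullbackE QI.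
Qed.

Lemma plucker_poly_homog a : plucker_poly a \is n.+1.-homog.
Proof.
rewrite rpredZ // dhomogX /=; apply/eqP/eqP; rewrite -eqz_nat -(weight_deg W0) weight_index_mnm.
by rewrite weight_sum0.
Qed.

Lemma plucker_pullback_homog e Q : Q \is e.-homog ->
  plucker_pullback Q \is (e * n.+1).-homog.
Proof.
move=> /dhomogP Qh; rewrite [Q]mpolyE /plucker_pullback raddf_sum /= big_seq rpred_sum // => m mQ.
rewrite comp_mpolyZ rpredZ // comp_mpolyX -(Qh m mQ) /= mdegE big_distrl /=.
apply: (big_ind2 (fun d (F : {mpoly k[N.+1]}) => F \is d.-homog)) => [|d1 F1 d2 F2|a _].
- exact: dhomog1.
- exact: dhomogM.
- by rewrite tnth_mktuple mulnC; apply: dhomogMn; apply: plucker_poly_homog.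
Qed.

(** The Gauss field is generated by the monomials that give the Pluecker
    coordinates on the torus. *)
Lemma gauss_fieldP phi : gauss_field X phi <->
  exists e P Q, [/\ P \is e.-homog, Q \is e.-homog, plucker_pullback Q \notin pv_ideal X &
    phi = frac (plucker_pullback P) (plucker_pullback Q)].
Proof.
split=> [[d [F [G [e [P [Q [[Fh Gh GI] [Ph Qh Qn] FG ->]]]]]]]|[e [P [Q [Ph Qh QI ->]]]]].
  exists e, P, Q; have QI := (plucker_pullback_nonzero Qh).2 Qn; split=> //.
  apply/coord_frac_eq => //; apply/(toric_idealP W0 XE) => s s0.
  rewrite mevalB !mevalM !plucker_pullbackE FG ?[_ * G.@[_]]mulrC ?subrr //.
    exact: (smooth_torus W0 SW XE s0).
  exact: (tangent_torus W0 SW XE s0).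
exists (e * n.+1)%N, (plucker_pullback P), (plucker_pullback Q), e, P, Q; split=> //.
- by split=> //; apply: plucker_pullback_homog.
- by split=> //; apply/(plucker_pullback_nonzero Qh).
apply: (plucker_density W0 SW XE Ph Qh) => s s0.
by rewrite !plucker_pullbackE mulrC.
Qed.

Lemma gauss_field_subfield : is_subfield (gauss_field X).
Proof.
have I1 : (1 : {mpoly k[N.+1]}) \notin pv_ideal X.
  by rewrite -coord_class_eq0 coord_class1 oner_eq0.
have pM P Q : plucker_pullback (P * Q) = plucker_pullback P * plucker_pullback Q.
  by rewrite /plucker_pullback rmorphM.
have pB P Q : plucker_pullback (P - Q) = plucker_pullback P - plucker_pullback Q.
  by rewrite /plucker_pullback rmorphB.
have p1 : plucker_pullback 1 = 1 by rewrite /plucker_pullback rmorph1.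
have G1 : gauss_field X 1.
  apply/gauss_fieldP; exists 0%N, 1, 1.
  by rewrite p1 coord_frac_self //; split=> //; apply: dhomog1.
split; first exact/mem_set.
- move=> x y /set_mem/gauss_fieldP[e1 [P1 [Q1 [P1h Q1h Q1I ->]]]].
  move=> /set_mem/gauss_fieldP[e2 [P2 [Q2 [P2h Q2h Q2I ->]]]].
  apply/mem_set/gauss_fieldP; exists (e1 + e2)%N, (P1 * Q2 - P2 * Q1), (Q1 * Q2).
  rewrite pB !pM coord_fracB //; split=> //; last exact: ideal_mulN.
    by apply: rpredB; [|rewrite addnC]; apply: dhomogM.
  exact: dhomogM.
- move=> x y /set_mem/gauss_fieldP[e1 [P1 [Q1 [P1h Q1h Q1I ->]]]].
  move=> /set_mem/gauss_fieldP[e2 [P2 [Q2 [P2h Q2h Q2I ->]]]].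
  rewrite coord_fracV coord_fracM -!pM; apply/mem_set/gauss_fieldP.
  (* division by zero gives zero *)
  have [P2I|P2I] := boolP (plucker_pullback P2 \in pv_ideal X).
    exists 0%N, 0, 1; rewrite p1; split=> //; [exact: dhomog0 | exact: dhomog1 |].
    rewrite !pM coord_frac_denom0; last exact: ideal_mul.
    by rewrite /plucker_pullback rmorph0 coord_frac_num0.
  exists (e1 + e2)%N, (P1 * Q2), (Q1 * P2); rewrite !pM; split=> //.
  + exact: dhomogM.
  + exact: dhomogM.
  + exact: ideal_mulN.
Qed.

End GaussField.

(** * Characters in the field of the Gauss image *)

(** Pluecker coordinates are indexed by increasing sequences, bases by
    arbitrary ones. *)
Lemma increasing_reindex p q (J : 'I_p -> 'I_q.+1) : injective J ->
  exists (J' : {ffun 'I_p -> 'I_q.+1}) (sg : {perm 'I_p}),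
    (forall i j : 'I_p, (i < j)%N -> (J' i < J' j)%N) /\ J' =1 J \o sg.
Proof.
move=> Jinj; pose s := sort (fun a b : 'I_q.+1 => (a <= b)%N) (codom J).
have ss : size s = p by rewrite size_sort size_codom card_ord.
have us : uniq s by rewrite sort_uniq map_inj_uniq ?enum_uniq.
have srt : sorted ltn (map val s).
  rewrite ltn_sorted_uniq_leq map_inj_uniq ?us //=; last exact: val_inj.
  by rewrite sorted_map; apply: sort_sorted => a b; apply: leq_total.
pose J' := [ffun i : 'I_p => nth ord0 s i].
have J'lt (i j : 'I_p) : (i < j)%N -> (J' i < J' j)%N.
  move=> ij; have := sorted_ltn_nth ltn_trans 0%N srt.
  move/(_ i j); rewrite !inE size_map ss => /(_ (ltn_ord i) (ltn_ord j) ij).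
  by rewrite !(nth_map ord0) ?ss // !ffunE.
have J'in i : J' i \in codom J.
  by rewrite ffunE -(mem_sort (fun a b : 'I_q.+1 => (a <= b)%N)) mem_nth ?ss.
have J'inj : injective J'.
  move=> i j E; case: (ltngtP i j) => [/J'lt|/J'lt|/ord_inj //]; by rewrite E ltnn.
have sginj : injective (fun i => iinv (J'in i)).
  by move=> i j /(congr1 J); rewrite !f_iinv => /J'inj.
exists J', (perm sginj); split=> // i; by rewrite /= permE f_iinv.
Qed.

Section Characters.
Variables (k : closedFieldType) (N : nat) (X : proj_variety k N).
Local Notation n := (dimension X).
Variable W : 'M[int]_(N.+1, n.+1).
Hypothesis W0 : forall i, W i ord0 = 1.
Variable S : 'M[int]_(n.+1, N.+1).
Hypothesis SW : S *m W = 1%:M.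
Hypothesis XE : pv_set X = proj_closure (torus_points W).
Variable d : 'I_n -> int.
Variable J0 : 'I_n.+1 -> 'I_N.+1.
Hypothesis bJ0 : basis k W J0.
Hypothesis hd : lattice_divisors k W J0 d.
Let d_dvd := hd.1.
Let d_gen := hd.2.
Implicit Types (x y : 'rV[k]_N.+1) (F G : {mpoly k[N.+1]}) (e v w : 'rV[int]_n.+1).
Implicit Types (P Q : {mpoly k[#|plucker_index X|]}).
Local Notation frac := (coord_frac X).

Definition in_lattice v : bool :=
  (v 0 ord0 == 0) && [forall j : 'I_n, (d j %| v ord0 (lift ord0 j))%Z].

Lemma in_latticeP v : reflect (v 0 ord0 = 0 /\ forall j : 'I_n, (d j %| v ord0 (lift ord0 j))%Z)
  (in_lattice v).
Proof. by apply: (iffP andP) => [[/eqP v0 /forallP]|[-> /forallP]]. Qed.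

Lemma in_lattice0 : in_lattice 0.
Proof. by apply/in_latticeP; split=> [|j]; rewrite mxE ?dvdz0. Qed.

Lemma in_latticeD v w : in_lattice v -> in_lattice w -> in_lattice (v + w).
Proof.
move=> /in_latticeP[v0 vd] /in_latticeP[w0 wd]; apply/in_latticeP; split=> [|j];
  rewrite mxE ?v0 ?w0 //.
exact: rpredD.
Qed.

Lemma in_latticeN v : in_lattice v -> in_lattice (- v).
Proof.
by move=> /in_latticeP[v0 vd]; apply/in_latticeP; split=> [|j]; rewrite mxE ?v0 ?oppr0 ?rpredN.
Qed.

Lemma in_latticeB v w : in_lattice v -> in_lattice w -> in_lattice (v - w).
Proof. by move=> Lv Lw; apply: in_latticeD => //; apply: in_latticeN. Qed.

Lemma in_lattice_basis J J' : basis k W J -> basis k W J' ->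
  in_lattice (weight_sum W J - weight_sum W J').
Proof.
move=> bJ bJ'; apply/in_latticeP; split=> [|j]; last exact: d_dvd.
by rewrite mxE [X in _ + X]mxE !(weight_sum0 W0) subrr.
Qed.

(** Homogeneous of degree e for the grading of polynomials by exponents modulo
    the lattice. *)
Definition graded e F := forall m, m \in msupp F -> in_lattice (weight W m - e).

Lemma graded0 e : graded e 0.
Proof. by move=> m; rewrite msupp0. Qed.

Lemma gradedX m : graded (weight W m) 'X_[m].
Proof. by move=> m'; rewrite msuppX inE => /eqP ->; rewrite subrr in_lattice0. Qed.

Lemma gradedZ e c F : graded e F -> graded e (c *: F).
Proof. by move=> eF m /msuppZ_le/eF. Qed.

Lemma gradedD e F G : graded e F -> graded e G -> graded e (F + G).
Proof. by move=> eF eG m /msuppD_le; rewrite mem_cat => /orP[/eF|/eG]. Qed.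

Lemma gradedM e f F G : graded e F -> graded f G -> graded (e + f) (F * G).
Proof.
move=> eF fG m /msuppM_le/allpairsP[[m1 m2] /= [/eF L1 /fG L2 ->]].
by rewrite weightD opprD addrACA in_latticeD.
Qed.

Lemma graded1 : graded 0 1.
Proof. by rewrite -mpolyX0 -[X in graded X](weight0 W); apply: gradedX. Qed.

Lemma gradedXn e F m : graded e F -> graded (e *+ m) (F ^+ m).
Proof.
move=> eF; elim: m => [|m IH]; first by rewrite mulr0n expr0; apply: graded1.
by rewrite mulrS exprS; apply: gradedM.
Qed.

Lemma graded_plucker_poly a : graded (weight_sum W J0) (plucker_poly W a).
Proof.
rewrite /plucker_poly; have [->|bJ] := eqVneq (\det (rowsub (plucker_cols a) (base_change k W))) 0.
  by rewrite scale0r; apply: graded0.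
apply: gradedZ => m; rewrite msuppX inE => /eqP ->.
by rewrite weight_index_mnm; apply: in_lattice_basis.
Qed.

(** All the monomials that occur in the Pluecker coordinates have the same
    degree modulo the lattice, by definition of the lattice. *)
Lemma graded_pullback r Q : Q \is r.-homog ->
  graded (weight_sum W J0 *+ r) (plucker_pullback W Q).
Proof.
move=> /dhomogP Qh; rewrite [Q]mpolyE /plucker_pullback raddf_sum /= big_seq.
apply: big_ind => [|F G|m mQ]; [exact: graded0 | exact: gradedD |].
rewrite comp_mpolyZ; apply: gradedZ; rewrite comp_mpolyX -(Qh m mQ) /= mdegE.
rewrite -sumrMnr; apply: (big_ind2 graded) => [|f F g G|a _].
- exact: graded1.
- exact: gradedM.
- by rewrite tnth_mktuple; apply: gradedXn; apply: graded_plucker_poly.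
Qed.

Lemma monomial_notin_ideal m : 'X_[m] \notin pv_ideal X.
Proof.
apply/negP => /(toric_idealP W0 XE)/(_ (fun=> 1)); rewrite mevalX monomial_eval_point.
  by move=> h; have /eqP := h (fun=> oner_neq0 _); apply/negP/mon_neq0 => j; apply: oner_neq0.
by move=> j; apply: oner_neq0.
Qed.

(** The ideal is homogeneous for the grading modulo the lattice, so it
    contains the components of its elements. *)
Lemma graded_separation e f F G : graded e F -> graded f G -> ~~ in_lattice (e - f) ->
  F - G \in pv_ideal X -> F \in pv_ideal X.
Proof.
move=> eF fG ef FGI; apply/(toric_idealP W0 XE) => s s0.
pose cl m := in_lattice (weight W m - e).
have Gcl m : cl m -> G@_m = 0.
  move=> clm; apply: memN_msupp_eq0; apply: contra ef => /fG Lm.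
  by have := in_latticeB Lm clm; rewrite opprB addrC addrA subrK.
have := ideal_graded W0 XE (fun v => if in_lattice (v - e) then mon v s else 0) FGI.
move=> h; rewrite -[RHS]h meval_monomial_point //; rewrite [RHS](bigID cl) /=.
rewrite [X in _ = _ + X]big1 ?addr0 => [|m /negPf]; last first.
  by rewrite /cl => ->; rewrite mulr0.
(* F and F - G have the same coefficients in the degree of F *)
rewrite (perm_big (filter cl (msupp (F - G)))) /=; last first.
  apply: uniq_perm; rewrite ?filter_uniq ?msupp_uniq // => m.
  rewrite mem_filter !mcoeff_msupp mcoeffB.
  have [clm|ncl] /= := boolP (cl m); first by rewrite Gcl ?subr0.
  by apply/negbTE; rewrite negbK; apply/eqP/memN_msupp_eq0/(contra _ ncl)/eF.
rewrite big_filter; apply: eq_bigr => m clm; rewrite mcoeffB Gcl // subr0.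
by rewrite /cl in clm; rewrite clm.
Qed.

(** The rational function z^e on the cone over X, written as a quotient of
    monomials in the homogeneous coordinates. *)
Definition toric_char e := frac 'X_[pos_part (e *m S)] 'X_[pos_part (- (e *m S))].

Lemma toric_charE m1 m2 e : weight W m1 - weight W m2 = e -> frac 'X_[m1] 'X_[m2] = toric_char e.
Proof.
move=> E; apply/coord_frac_eq; try exact: monomial_notin_ideal.
apply/(toric_idealP W0 XE) => s s0; rewrite mevalB !mevalM !mevalX !monomial_eval_point //
  -!monD //.
rewrite -[X in mon X s - _](_ : weight W (pos_part (e *m S)) + weight W m2 = _) ?subrr //.
by rewrite weight_pos_part -mulmxA SW mulmx1 -E -addrA [_ + weight W m2]addrC addrA subrK.
Qed.

Lemma toric_charD e f : toric_char (e + f) = toric_char e * toric_char f.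
Proof.
rewrite {2 3}/toric_char coord_fracM -!mpolyXD; apply/esym/toric_charE.
rewrite !weightD (weight_pos_part _ (e *m S)) (weight_pos_part _ (f *m S)) -!mulmxA SW !mulmx1.
by rewrite addrACA addrK.
Qed.

Lemma toric_char0 : toric_char 0 = 1.
Proof. by rewrite -(toric_charE (subrr (weight W 0))) coord_frac_self ?monomial_notin_ideal. Qed.

Lemma toric_char_neq0 e : toric_char e != 0.
Proof.
apply/eqP => h; have := toric_charD e (- e); rewrite subrr toric_char0 h mul0r => /eqP.
by rewrite oner_eq0.
Qed.

Lemma toric_charMn e m : toric_char (e *+ m) = toric_char e ^+ m.
Proof.
by elim: m => [|m IH]; rewrite ?mulr0n ?toric_char0 ?expr0 // mulrS toric_charD IH exprS.
Qed.

Lemma toric_charN e : toric_char (- e) = (toric_char e)^-1.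
Proof.
by apply: (mulfI (toric_char_neq0 e)); rewrite -toric_charD subrr toric_char0 divff
  ?toric_char_neq0.
Qed.

Lemma toric_charMz e (z : int) : toric_char (z *: e) = toric_char e ^ z.
Proof.
case: z => m; first by rewrite -[RHS]toric_charMn -scaler_nat natz.
by rewrite NegzE scaleNr toric_charN -exprnN -toric_charMn -scaler_nat natz.
Qed.

Lemma toric_char_function_field e : e 0 ord0 = 0 -> function_field X (toric_char e).
Proof.
move=> e0; exists (mdeg (pos_part (- (e *m S)))), 'X_[pos_part (e *m S)], 'X_[pos_part (- (e *m
  S))].
split; rewrite ?dhomogX ?monomial_notin_ideal //=.
apply/eqP/eqP; rewrite -eqz_nat -!(weight_deg W0) (weight_pos_part _ (e *m S)) -mulmxA SW mulmx1.
by rewrite mxE e0 add0r.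
Qed.

(** A ratio of two Pluecker coordinates. *)
Lemma gauss_field_basis_char J : basis k W J ->
  gauss_field X (toric_char (weight_sum W J - weight_sum W J0)).
Proof.
have sorted_basis J1 : basis k W J1 -> exists P,
    P \is 1.-homog /\ plucker_pullback W P = 'X_[index_mnm J1].
  move=> bJ1; have [J' [sg [J'lt J'E]]] := increasing_reindex (basis_inj bJ1).
  have J'in : [forall i : 'I_n.+1, forall j : 'I_n.+1, (i < j)%N ==> (J' i < J' j)%N].
    by apply/forallP => i; apply/forallP => j; apply/implyP/J'lt.
  pose a : 'I_#|plucker_index X| := enum_rank (exist _ J' J'in : plucker_index X).
  have aE : plucker_cols a = J' by rewrite /plucker_cols /a enum_rankK.
  have bJ' : basis k W J'.
    rewrite /basis (_ : rowsub J' _ = row_perm sg (rowsub J1 (base_change k W))).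
      by rewrite row_permE det_mulmx det_perm mulf_neq0 ?signr_eq0.
    by apply/matrixP => i j; rewrite !mxE J'E.
  have mE : index_mnm J' = index_mnm J1.
    rewrite /index_mnm [RHS](reindex_inj (@perm_inj _ sg)).
    by apply: eq_bigr => b _; rewrite J'E.
  exists ((\det (rowsub J' (base_change k W)))^-1 *: 'X_a); split.
    by rewrite rpredZ // dhomogX /= mdeg1.
  rewrite /plucker_pullback comp_mpolyZ comp_mpolyXU -tnth_nth tnth_mktuple.
  by rewrite /plucker_poly aE scalerA mulVf // scale1r mE.
move=> bJ; have [P [Ph PE]] := sorted_basis J bJ; have [Q [Qh QE]] := sorted_basis J0 bJ0.
apply/(gauss_fieldP W0 SW XE); exists 1%N, P, Q; split=> //.
  by rewrite QE monomial_notin_ideal.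
by rewrite PE QE; apply/esym/toric_charE; rewrite !weight_index_mnm.
Qed.

(** If z^e is a quotient of two polynomials of the same degree modulo the
    lattice, the two sides of the cross-multiplied identity have degrees that
    differ by e; unless e is in the lattice each side would be in the ideal. *)
Lemma gauss_field_char_lattice e : e 0 ord0 = 0 -> gauss_field X (toric_char e) -> in_lattice e.
Proof.
move=> e0 /(gauss_fieldP W0 SW XE)[m [P [Q [Ph Qh QI E]]]].
set m1 := pos_part (e *m S); set m2 := pos_part (- (e *m S)); set g := weight_sum W J0 *+ m.
apply/negPn/negP => Le.
have := (coord_frac_eq _ _ (monomial_notin_ideal m2) QI).1 E; rewrite -/m1 => I12.
have : 'X_[m1] * plucker_pullback W Q \in pv_ideal X.
  apply: (graded_separation (e := weight W m1 + g) (f := g + weight W m2)) I12.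
  - by apply: gradedM (graded_pullback Qh); apply: gradedX.
  - by apply: gradedM (graded_pullback Ph) _; apply: gradedX.
  - rewrite /m1 weight_pos_part -mulmxA SW mulmx1 -/m2.
    by rewrite [g + _]addrC opprD addrACA subrr addr0 addrK.
by apply/negP/ideal_mulN => //; apply: monomial_notin_ideal.
Qed.

Lemma gauss_field_lattice_char j : gauss_field X (toric_char (d j *: delta_mx 0 (lift ord0 j))).
Proof.
have sG := gauss_field_subfield W0 SW XE.
have [c [cb ->]] := d_gen j.
apply: (big_ind (fun e => gauss_field X (toric_char e))) => [|e f|J _].
- by rewrite toric_char0; apply: subfield1 sG.
- by rewrite toric_charD; apply: subfieldM sG.
have [->|/cb bJ] := eqVneq (c J) 0.
  by rewrite scale0r toric_char0; apply: subfield1 sG.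
by rewrite toric_charMz; apply: (subfieldXz _ sG); apply: gauss_field_basis_char.
Qed.

(** Otherwise z^v with v = (d_j / p) e_j is not in the Gauss field although
    its p-th power is. *)
Lemma separable_elementary_divisors : gauss_separable X ->
  forall j, d j != 0 -> (d j)%:~R != 0 :> k.
Proof.
move=> sep j dj; apply/negP => dk.
have sG := gauss_field_subfield W0 SW XE.
have dn : (absz (d j))%:R == 0 :> k.
  by case: (d j) dk => m //; rewrite NegzE mulrNz oppr_eq0.
have [p pk] : exists p, p \in [pchar k] by apply: natf0_pchar dn; rewrite absz_gt0.
have /dvdzP[z zE] : (p%:Z %| d j)%Z by rewrite dvdzE /= (dvdn_pcharf pk).
pose v : 'rV[int]_n.+1 := z *: delta_mx 0 (lift ord0 j).
have vp : v *+ p = d j *: delta_mx 0 (lift ord0 j).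
  by rewrite /v zE -scaler_nat scalerA natz mulrC.
have v0 : v 0 ord0 = 0 by rewrite !mxE eqxx /= mulr0.
have Gv : gauss_field X (toric_char v).
  apply: (separable_extension_insep sG (coord_frac_pchar X pk) sep).
    exact: toric_char_function_field.
  by rewrite -toric_charMn vp; apply: gauss_field_lattice_char.
have /in_latticeP[_ /(_ j)] := gauss_field_char_lattice v0 Gv.
have z0 : z != 0 by apply: contraNneq dj => z0; rewrite zE z0 mul0r.
rewrite !mxE !eqxx mulr1 dvdzE zE abszM /= => /dvdn_leq.
rewrite absz_gt0 z0 leqNgt => /(_ isT)/negP; apply.
by rewrite ltn_Pmulr ?absz_gt0 // prime_gt1 // (pcharf_prime pk).
Qed.

End Characters.

(** * Classes of exponents modulo the lattice of the Gauss map *)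

Lemma rank_le_nonzero_rows (F : fieldType) p q (D : 'M[F]_(p, q)) (P : pred 'I_p) :
  (forall a, ~~ P a -> row a D = 0) -> (\rank D <= #|P|)%N.
Proof.
move=> D0; pose B : 'M[F]_(#|P|, q) := \matrix_z row (enum_val z) D.
apply: leq_trans (rank_leq_row B); apply: mxrankS; apply/row_subP => a.
have [Pa|/D0 ->] := boolP (P a); last exact: sub0mx.
by rewrite (_ : row a D = row (enum_rank_in Pa a) B) ?row_sub // rowK enum_rankK_in.
Qed.

Lemma mxrank_sum_leq (F : fieldType) q (I : finType) (D : I -> 'M[F]_q) :
  (\rank (\sum_b D b)%MS <= \sum_b \rank (D b))%N.
Proof.
apply: (big_ind2 (fun (A : 'M[F]_q) r => \rank A <= r)%N) => //.
  by rewrite mxrank0.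
move=> A1 r1 A2 r2 h1 h2; apply: leq_trans (mxrank_adds_leqif A1 A2) _.
exact: leq_add.
Qed.

Lemma int_left_inverse_leq p q (A : 'M[int]_(p, q)) (B : 'M[int]_(q, p)) :
  A *m B = 1%:M -> (p <= q)%N.
Proof.
move/(congr1 (map_mx (intr : int -> rat))); rewrite map_mxM map_mx1 => h.
by rewrite -(mxrank1 rat p) -h; apply: leq_trans (mxrankM_maxl _ _) (rank_leq_col _).
Qed.

(** The distinct rows of F form the matrix T, and cl sends i to the position
    of row i. *)
Lemma row_classes p q (F : 'M[int]_(p, q)) :
  exists c (cl : 'I_p -> 'I_c) (T : 'M[int]_(c, q)),
    [/\ forall b, exists i, cl i = b, forall i, row (cl i) T = row i F &
        forall i i', row i F = row i' F -> cl i = cl i'].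
Proof.
pose V := undup (codom (fun i => row i F)).
have inV i : row i F \in V by rewrite mem_undup (codom_f (fun i => row i F)).
have idx i : (index (row i F) V < size V)%N by rewrite index_mem.
exists (size V), (fun i => Ordinal (idx i)), (\matrix_b nth 0 V b); split.
- move=> b; have /codomP[i iE] : nth 0 V b \in codom (fun i => row i F).
    by rewrite -mem_undup mem_nth.
  by exists i; apply: val_inj; rewrite /= -iE index_uniq ?undup_uniq.
- by move=> i; rewrite rowK /= nth_index.
- by move=> i i' E; apply: val_inj; rewrite /= E.
Qed.

Section CayleyStructure.
Variables (k : closedFieldType) (n N : nat) (W : 'M[int]_(N.+1, n.+1)).
Hypothesis W0 : forall i, W i ord0 = 1.
Variable S : 'M[int]_(n.+1, N.+1).
Hypothesis SW : S *m W = 1%:M.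
Variable d : 'I_n -> int.
Variable J0 : 'I_n.+1 -> 'I_N.+1.
Hypothesis bJ0 : basis k W J0.
Hypothesis hd : lattice_divisors k W J0 d.
Let d_dvd := hd.1.
Let d_gen := hd.2.
Hypothesis d_unit : forall j, d j != 0 -> (d j)%:~R != 0 :> k.

Local Notation l := #|free_coord d|.
Local Notation r := #|[predC free_coord d]|.
Local Notation F := (free_cols W d).

Lemma card_free : (l + r = n)%N.
Proof. by rewrite cardC card_ord. Qed.

Definition torsion_index : 'I_r -> 'I_n := enum_val.

(** These coordinates of the exponents become the factor Z^(n-l) that contains
    the sets A^j. *)
Definition torsion_part (i : 'I_N.+1) : 'rV[int]_r := \row_z W i (lift ord0 (torsion_index z)).

Definition torsion_vec (i : 'I_N.+1) : 'rV[k]_r := map_mx intr (torsion_part i).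
Local Notation tk := torsion_vec.

(** An exchange changes the sum over a basis by an element of the lattice,
    whose free coordinates vanish. *)
Lemma basis_coords_free i a : basis_coords k W J0 i a != 0 -> row i F = row (J0 a) F.
Proof.
move=> ia; apply/rowP => z; rewrite !mxE.
case: unliftP => [z' _|_]; last by rewrite !W0.
have := d_dvd (basis_exchange bJ0 ia) bJ0 (free_index z').
rewrite weight_sum_exchange !mxE.
have /eqP -> : d (free_index z') == 0 by apply: (enum_valP z').
by rewrite dvd0z subr_eq0 => /eqP.
Qed.

(** Some term of the Leibniz formula for the determinant of the coordinates of
    J in J0 is nonzero, and coordinates vanish between different classes. *)
Lemma basis_matching J : basis k W J ->
  exists sg : 'S_n.+1, forall a, row (J a) F = row (J0 (sg a)) F.
Proof.
move=> bJ; have : \det (rowsub J (basis_coords k W J0)) != 0.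
  apply: contraNneq bJ => h; apply/eqP.
  by rewrite -[base_change k W](basis_coordsK bJ0) -mul_rowsub_mx det_mulmx h mul0r.
move=> detN; apply: contrapT => no; case/eqP: detN.
rewrite /determinant big1 // => sg _.
have [/prodf_neq0 h|] := boolP (\prod_a rowsub J (basis_coords k W J0) a (sg a) != 0).
  case: no; exists sg => a; apply: basis_coords_free; have := h a isT.
  by rewrite [rowsub _ _ _ _]mxE.
by rewrite negbK => /eqP ->; rewrite mulr0.
Qed.

Lemma basis_coords_sum1 i : \sum_a basis_coords k W J0 i a = 1.
Proof.
have /matrixP/(_ i ord0) := basis_coordsK bJ0; rewrite mxE [RHS]mxE W0 => h.
by rewrite -[RHS]h; apply: eq_bigr => a _; rewrite [rowsub _ _ _ _]mxE [base_change _ _ _ _]mxE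
  W0 mulr1.
Qed.

Lemma basis_coords_torsion i : tk i = \sum_a basis_coords k W J0 i a *: tk (J0 a).
Proof.
apply/rowP => z; rewrite summxE !mxE.
have /matrixP/(_ i (lift ord0 (torsion_index z))) := basis_coordsK bJ0; rewrite mxE [RHS]mxE => h.
rewrite -[LHS]h; apply: eq_bigr => a _; rewrite [rowsub _ _ _ _]mxE [base_change _ _ _ _]mxE.
by rewrite [RHS]mxE; congr (_ * _); rewrite !mxE.
Qed.

Lemma basis_coords_support i : exists a, basis_coords k W J0 i a != 0.
Proof.
apply: contrapT => no; have := basis_coords_sum1 i; rewrite big1 => [/esym/eqP|a _].
  by rewrite oner_eq0.
by apply/eqP/negPn/negP => h; apply: no; exists a.
Qed.

Section Classes.
Variables (c : nat) (cl : 'I_N.+1 -> 'I_c) (T : 'M[int]_(c, l.+1)).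
Hypothesis cl_surj : forall b, exists i, cl i = b.
Hypothesis clT : forall i, row (cl i) T = row i F.
Hypothesis cl_eq : forall i i', row i F = row i' F -> cl i = cl i'.

Lemma basis_coords_class i a : basis_coords k W J0 i a != 0 -> cl (J0 a) = cl i.
Proof. by move/basis_coords_free/cl_eq. Qed.

Variable rep : 'I_c -> 'I_n.+1.
Hypothesis repP : forall b, cl (J0 (rep b)) = b.

(** Over k, the span of the differences inside the class b; by exchange the
    members of J0 in the class suffice. *)
Definition class_span b : 'M[k]_(n.+1, r) :=
  \matrix_a (if cl (J0 a) == b then tk (J0 a) - tk (J0 (rep b)) else 0).

Lemma in_class_span i : (tk i - tk (J0 (rep (cl i))) <= class_span (cl i))%MS.
Proof.
have -> : tk i - tk (J0 (rep (cl i))) = row i (basis_coords k W J0) *m class_span (cl i).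
  rewrite mulmx_sum_row -[X in _ - X]scale1r -(basis_coords_sum1 i) scaler_suml.
  rewrite {1}basis_coords_torsion -sumrB; apply: eq_bigr => a _; rewrite rowK [row _ _ _ _]mxE.
  have [->|ia] := eqVneq (basis_coords k W J0 i a) 0; first by rewrite !scale0r subrr.
  by rewrite (basis_coords_class ia) eqxx scalerBr.
exact: submxMl.
Qed.

(** A class with m members in J0 gives at most m - 1 differences, and every
    class meets J0. *)
Lemma class_span_rank : (\sum_b \rank (class_span b) + c <= n.+1)%N.
Proof.
have rk b : (\rank (class_span b) <= \sum_(a | cl (J0 a) == b) (a != rep b))%N.
  rewrite -big_mkcondr sum1_card; apply: rank_le_nonzero_rows => a; rewrite rowK.
  by rewrite negb_and negbK; case: eqP => //= _ /eqP ->; rewrite subrr.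
have cE : c = (\sum_b \sum_(a | cl (J0 a) == b) (a == rep b))%N.
  transitivity (\sum_(b < c) 1)%N; first by rewrite sum1_card card_ord.
  apply: eq_bigr => b _; rewrite (bigD1 (rep b)) ?repP //= eqxx big1 // => a /andP[_ /negPf ->] //.
rewrite [X in (_ + X)%N]cE.
apply: (@leq_trans (\sum_b \sum_(a | cl (J0 a) == b) (a != rep b) +
                    \sum_b \sum_(a | cl (J0 a) == b) (a == rep b))%N).
  by rewrite leq_add2r; apply: leq_sum => b _; apply: rk.
apply: (@leq_trans (\sum_(a < n.+1) 1)%N); last by rewrite sum1_card card_ord.
rewrite -big_split /= [X in (_ <= X)%N](partition_big (fun a => cl (J0 a)) xpredT) //=.
apply: leq_sum => b _; rewrite -big_split /=; apply: leq_sum => a _.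
by case: (a == rep b).
Qed.

(** The sum of these spans contains the lattice, as two bases are matched
    class by class; and the lattice spans everything because the nonzero d_j
    are invertible in k. *)
Lemma class_span_full : (r <= \sum_b \rank (class_span b))%N.
Proof.
pose U := (\sum_b <<class_span b>>)%MS.
suff fullU : (1%:M <= U)%MS.
  rewrite -[X in (X <= _)%N](mxrank1 k r); apply: leq_trans (mxrankS fullU) _.
  apply: leq_trans (mxrank_sum_leq _) _; apply: leq_sum => b _.
  by rewrite mxrank_gen.
have inU i i' : cl i = cl i' -> (tk i - tk i' <= U)%MS.
  move=> E; have sub j : (tk j - tk (J0 (rep (cl j))) <= U)%MS.
    apply: submx_trans (in_class_span j) _; rewrite -genmxE.
    exact: (sumsmx_sup (cl j)).
  have -> : tk i - tk i' = (tk i - tk (J0 (rep (cl i)))) - (tk i' - tk (J0 (rep (cl i')))).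
    by rewrite E opprB addrA subrK.
  by rewrite addmx_sub // eqmx_opp.
pose tor (v : 'rV[int]_n.+1) : 'rV[k]_r := \row_z (v 0 (lift ord0 (torsion_index z)))%:~R.
have torB v w : tor (v - w) = tor v - tor w.
  by apply/rowP => z; rewrite !mxE intrB.
have torD v w : tor (v + w) = tor v + tor w.
  by apply/rowP => z; rewrite !mxE intrD.
have torZ a v : tor (a *: v) = a%:~R *: tor v.
  by apply/rowP => z; rewrite !mxE intrM.
have tor0 : tor 0 = 0 by rewrite -(subrr 0) torB subrr.
have torrow i : tor (row i W) = tk i by apply/rowP => z; rewrite !mxE.
have torsum J : tor (weight_sum W J) = \sum_a tk (J a).
  rewrite /weight_sum (big_morph tor torD tor0); apply: eq_bigr => a _; exact: torrow.
apply/row_subP => z; rewrite row1.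
have dz : d (torsion_index z) != 0 by apply: (enum_valP z).
rewrite -(eqmx_scale _ (d_unit dz)).
have -> : (d (torsion_index z))%:~R *: delta_mx 0 z =
  tor (d (torsion_index z) *: delta_mx 0 (lift ord0 (torsion_index z))).
  apply/rowP => z'; rewrite !mxE eqxx /= (inj_eq lift_inj) (inj_eq enum_val_inj).
  by rewrite intrM; case: eqP.
have [a [ab ->]] := d_gen (torsion_index z).
rewrite (big_morph tor torD tor0) summx_sub // => J _; rewrite torZ.
have [->|/ab bJ] := eqVneq (a J) 0; first by rewrite scale0r sub0mx.
rewrite scalemx_sub // torB !torsum; have [sg sgE] := basis_matching bJ.
rewrite [X in _ - X](reindex_inj (@perm_inj _ sg)) /= -sumrB summx_sub // => b _.
by apply: inU; apply: cl_eq.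
Qed.

(** The exponents generate the lattice, hence so do their classes modulo the
    saturation. *)
Lemma class_matrix_left_inverse : exists L : 'M[int]_(l.+1, c), L *m T = 1%:M.
Proof.
pose idx (z : 'I_l.+1) := if unlift ord0 z is Some z' then lift ord0 (free_index z') else ord0 :
  'I_n.+1.
have idx_inj : injective idx.
  move=> z z'; rewrite /idx; case: unliftP => [y ->|->]; case: unliftP => [y' ->|->] //.
  - by move/lift_inj/enum_val_inj ->.
exists (rowsub idx S *m \matrix_(i, b) (cl i == b)%:R); rewrite -mulmxA.
have -> : (\matrix_(i, b) (cl i == b)%:R) *m T = F.
  apply/row_matrixP => i; rewrite -clT row_mul mulmx_sum_row (bigD1 (cl i)) //=.
  rewrite !mxE eqxx scale1r big1 ?addr0 // => b /negPf bi.
  by rewrite !mxE eq_sym bi scale0r.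
have -> : F = colsub idx W by apply/matrixP => i z; rewrite !mxE.
rewrite mul_rowsub_mx mulmx_colsub SW; apply/matrixP => z z'.
by rewrite !mxE (inj_eq idx_inj).
Qed.

(** The two bounds on the ranks leave no room: c <= l + 1 because n - l <= n +
    1 - c, and c >= l + 1 because c vectors generate Z^(l+1). *)
Lemma class_count : c = l.+1 /\ (\sum_b \rank (class_span b))%N = r.
Proof.
have [L LT] := class_matrix_left_inverse.
have lc := int_left_inverse_leq LT; have h := class_span_rank; have g := class_span_full.
have e := card_free; split; apply/eqP; rewrite eqn_leq ?lc ?g ?andbT.
  rewrite -(leq_add2l r); apply: leq_trans (_ : n.+1 <= _)%N.
    by apply: leq_trans h; rewrite leq_add2r.
  by rewrite addnS addnC e.
rewrite -(leq_add2r c); apply: leq_trans h _; rewrite -{1}e -addSn addnC leq_add2l.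
exact: lc.
Qed.

End Classes.
End CayleyStructure.

(** * Cayley decomposition in coordinates *)

Lemma sum_fset_delta (T : choiceType) (R : pzRingType) (V : lmodType R) (A : {fset T}) (x : T)
    (g : T -> V) : x \in A -> \sum_(w <- A) (w == x)%:R *: g w = g x.
Proof.
move=> xA; rewrite (bigD1_seq x) ?fset_uniq //= eqxx scale1r big1 ?addr0 //.
by move=> w /negPf ->; rewrite scale0r.
Qed.

Section CayleyDecomposition.
Variables (k : closedFieldType) (n N : nat) (W : 'M[int]_(N.+1, n.+1)).
Hypothesis W0 : forall i, W i ord0 = 1.
Variable S : 'M[int]_(n.+1, N.+1).
Hypothesis SW : S *m W = 1%:M.
Variable d : 'I_n -> int.
Variable J0 : 'I_n.+1 -> 'I_N.+1.
Hypothesis bJ0 : basis k W J0.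
Hypothesis hd : lattice_divisors k W J0 d.
Hypothesis d_unit : forall j, d j != 0 -> (d j)%:~R != 0 :> k.

Local Notation l := #|free_coord d|.
Local Notation r := #|[predC free_coord d]|.
Local Notation F := (free_cols W d).

Definition exponent (i : 'I_N.+1) : 'rV[int]_n := \row_j W i (lift ord0 j).

(** The free coordinates of v, with first entry c; for c = 1 and an exponent v
    this is its class modulo the saturation. *)
Definition homogenize (c : int) (v : 'rV[int]_n) : 'rV[int]_l.+1 :=
  \row_z (if unlift ord0 z is Some z' then v 0 (free_index z') else c).

Definition drop_first (y : 'rV[int]_l.+1) : 'rV[int]_l := \row_z y 0 (lift ord0 z).

Lemma homogenizeD c1 c2 v1 v2 :
  homogenize (c1 + c2) (v1 + v2) = homogenize c1 v1 + homogenize c2 v2.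
Proof. by apply/rowP => z; rewrite !mxE; case: unlift => [z'|]; rewrite ?mxE. Qed.

Lemma homogenize_exponent i : homogenize 1 (exponent i) = row i F.
Proof. by apply/rowP => z; rewrite !mxE; case: unlift => [z'|]; rewrite ?mxE ?W0. Qed.

(** The classes form a basis of Z^(l+1), the rows of T. Its first coordinates
    are all 1, so in this basis the sum of the coordinates of the class of v
    is its first entry: it is 1 on exponents, and dropping one coordinate
    makes the classes 0, e_1, ..., e_l. The other factor of the isomorphism
    keeps the coordinates with d_j nonzero. *)
Lemma cayley_decomposition :
  exists (A : 'I_l.+1 -> {fset 'rV[int]_r}) (dm : 'I_l.+1 -> nat),
    [/\ forall j, affine_dim (affK k (A j)) (dm j),
        (\sum_j dm j)%N = r &
        exists phi : 'rV[int]_n -> 'rV[int]_r * 'rV[int]_l,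
          affine_iso phi /\ phi @` range exponent = cayley_sum A].
Proof.
have [c [cl [T [cl_surj clT cl_eq]]]] := row_classes F.
have /choice[rep repP] : forall b, exists a, cl (J0 a) = b.
  move=> b; have [i <-] := cl_surj b; have [a ia] := basis_coords_support W0 bJ0 i.
  by exists a; apply: (basis_coords_class W0 bJ0 hd cl_eq ia).
have [cE dimE] := class_count W0 SW bJ0 hd d_unit clT cl_eq repP.
have [L LT] := class_matrix_left_inverse SW clT.
subst c; have [_ Tu] := mulmx1_unit LT.
have T0 b : T b ord0 = 1.
  have [i <-] := cl_surj b; have /rowP/(_ ord0) := clT i.
  by rewrite !mxE unlift_none W0.
pose A b := [fset torsion_part W d i | i in [seq i <- enum 'I_N.+1 | cl i == b]]%fset.
have AP b w : reflect (exists2 i, cl i = b & w = torsion_part W d i) (w \in A b).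
  apply: (iffP (imfsetP _ _ _ _)) => [[i /=]|[i ib ->]].
    by rewrite mem_filter => /andP[/eqP ib _] ->; exists i.
  by exists i => //=; rewrite mem_filter ib eqxx mem_enum.
exists A, (fun b => \rank (class_span k W d J0 cl rep b)); split=> //.
  move=> b; set D := class_span k W d J0 cl rep b.
  pose v0 := torsion_vec k W d (J0 (rep b)).
  exists v0, <<D>>%MS; split; first by rewrite mxrank_gen.
  have inD i : cl i = b -> (torsion_vec k W d i - v0 <= D)%MS.
    by move=> ib; rewrite /v0 /D -ib; apply: (in_class_span W0 bJ0 hd cl_eq).
  have A0 : torsion_part W d (J0 (rep b)) \in A b by apply/AP; exists (J0 (rep b)).
  apply/seteqP; split=> v /=.
    move=> [a [a1 ->]]; exists (\sum_(w <- A b) a w *: (map_mx intr w - v0)).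
      rewrite genmxE big_seq summx_sub // => w /AP[i ib ->].
      by rewrite scalemx_sub // inD.
    rewrite -[v0 in X in X + _]scale1r -a1 scaler_suml -big_split /=.
    by apply: eq_bigr => w _; rewrite scalerBr addrC subrK.
  move=> [w]; rewrite genmxE => /submxP[x ->] <-.
  pose w0 := torsion_part W d (J0 (rep b)).
  pose t a := torsion_part W d (J0 a).
  pose P a := cl (J0 a) == b.
  (* affine coefficients: mass 1 at w0, and x_a moved from w0 to t a *)
  exists (fun w => (w == w0)%:R + \sum_(a | P a) x 0 a * ((w == t a)%:R - (w == w0)%:R)).
  have sumA (g : 'rV[int]_r -> 'rV[k]_r) :
      \sum_(w <- A b) ((w == w0)%:R + \sum_(a | P a) x 0 a * ((w == t a)%:R - (w == w0)%:R)) *: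
        g w =
      g w0 + \sum_(a | P a) x 0 a *: (g (t a) - g w0).
    under eq_bigr do rewrite scalerDl scaler_suml.
    rewrite big_split /= sum_fset_delta //; congr (_ + _).
    rewrite exchange_big /=; apply: eq_bigr => a Pa.
    under eq_bigr do rewrite -scalerA scalerBl.
    rewrite -scaler_sumr sumrB !sum_fset_delta //; apply/AP; exists (J0 a) => //; exact/eqP.
  split; last first.
    rewrite sumA mulmx_sum_row; congr (_ + _).
    rewrite [LHS](bigID P) /= addrC big1 ?add0r => [|a nPa].
      by apply: eq_bigr => a Pa; rewrite rowK -/(P a) Pa.
    by rewrite rowK -/(P a) (negPf nPa) scaler0.
  rewrite big_split /= exchange_big /=.
  have one (w1 : 'rV[int]_r) : w1 \in A b -> \sum_(w <- A b) (w == w1)%:R = 1 :> k.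
    move=> w1A; rewrite -[RHS](sum_fset_delta (V := k^o) (fun=> 1) w1A).
    by apply: eq_bigr => w2 _; apply: esym (mulr1 _).
  rewrite one // big1 ?addr0 // => a Pa; rewrite -mulr_sumr sumrB !one ?subrr ?mulr0 //.
  by apply/AP; exists (J0 a) => //; apply/eqP.
pose tp (v : 'rV[int]_n) : 'rV[int]_r := \row_z v 0 (torsion_index z).
pose f v := (tp v, drop_first (homogenize 0 v *m invmx T)).
have fD : {morph f : x y / x - y}.
  move=> x y; rewrite /f; congr (_, _); first by apply/rowP => z; rewrite !mxE.
  have -> : homogenize 0 (x - y) = homogenize 0 x - homogenize 0 y.
    apply/eqP; rewrite eq_sym subr_eq -homogenizeD addr0 subrK //.
  by rewrite mulmxBl; apply/rowP => z; rewrite !mxE.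
pose fA : {additive 'rV[int]_n -> 'rV[int]_r * 'rV[int]_l} :=
  HB.pack f (GRing.isZmodMorphism.Build _ _ f fD).
have rowsum (y : 'rV[int]_l.+1) : (y *m T) 0 ord0 = \sum_b y 0 b.
  by rewrite mxE; apply: eq_bigr => b _; rewrite T0 mulr1.
exists (fun v => (tp v, drop_first (homogenize 1 v *m invmx T))); split.
  exists fA, (0, drop_first (homogenize 1 0 *m invmx T)); split; last first.
    move=> v; rewrite /fA /= /f; congr (_, _); first by rewrite addr0.
    rewrite -[in LHS](addr0 v) -[in LHS](add0r 1) homogenizeD mulmxDl.
    by apply/rowP => z; rewrite !mxE.
  (* if f v = 0 then all coordinates but one of the class of v vanish, and their sum is 0 *)
  have inj_f : injective f.
    suff f0 v : f v = 0 -> v = 0.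
      by move=> v w E; apply/eqP; rewrite -subr_eq0; apply/eqP/f0; rewrite fD E subrr.
    case=> tv0; set y := _ *m invmx T => y0.
    have yT : y *m T = homogenize 0 v by rewrite mulmxKV.
    have ylift z : y 0 (lift ord0 z) = 0.
      by have /rowP/(_ z) := y0; rewrite !mxE.
    have y00 : y 0 ord0 = 0.
      have := rowsum y; rewrite yT mxE unlift_none big_ord_recl big1 ?addr0 //.
    have Y0 : y = 0.
      apply/rowP => z; rewrite [RHS]mxE; have [z' ->|->] := unliftP ord0 z => //.
    apply/rowP => j; rewrite [RHS]mxE; have [jf|jf] := boolP (free_coord d j).
      have /rowP/(_ (lift ord0 (enum_rank_in jf j))) := yT; rewrite Y0 mul0mx !mxE liftK.
      by rewrite /free_index enum_rankK_in.
    have jr : j \in [predC free_coord d] by [].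
    by have /rowP/(_ (enum_rank_in jr j)) := tv0; rewrite !mxE /torsion_index enum_rankK_in.
  have surj_f p : exists v, f v = p.
    case: p => p q.
    (* the omitted coordinate is forced by the vanishing of the sum *)
    pose y : 'rV[int]_l.+1 := \row_z (if unlift ord0 z is Some z' then q 0 z' else - \sum_z q 0 z).
    have ysum : \sum_b y 0 b = 0.
      rewrite big_ord_recl mxE unlift_none addrC; apply/eqP; rewrite subr_eq0; apply/eqP.
      by apply: eq_bigr => z _; rewrite mxE liftK.
    pose yT := y *m T.
    pose v : 'rV[int]_n := \row_j (\sum_(z | free_index z == j) yT 0 (lift ord0 z) +
                                  \sum_(z | torsion_index z == j) p 0 z).
    have rho_iota (z : 'I_r) (z' : 'I_l) : (torsion_index z == free_index z') = false.
      apply/negP => /eqP E; have := enum_valP z; rewrite inE -/(torsion_index z) E => /negP; apply.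
      by have := enum_valP z'; rewrite /free_index.
    exists v; rewrite /f; congr (_, _).
      apply/rowP => z; rewrite !mxE big1 ?add0r => [|z' /eqP E]; last first.
        by have := rho_iota z z'; rewrite E eqxx.
      by rewrite (eq_bigl (pred1 z)) ?big_pred1_eq // => z' /=; rewrite (inj_eq enum_val_inj).
    have -> : homogenize 0 v = y *m T.
      apply/rowP => z; rewrite mxE; have [z' ->|->] := unliftP ord0 z; rewrite ?liftK ?unlift_none.
        rewrite mxE (eq_bigl (pred1 z')) ?big_pred1_eq => [|z'']; last first.
          by rewrite /= (inj_eq (@free_index_inj n d)).
        by rewrite [X in _ + X]big1 ?addr0 // => z'' ; rewrite rho_iota.
      by rewrite rowsum ysum.
    by rewrite mulmxK //; apply/rowP => z; rewrite !mxE liftK.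
  have /choice[g gK] := surj_f.
  by exists g => // v; apply: inj_f; rewrite gK.
have phiE i : (tp (exponent i), drop_first (homogenize 1 (exponent i) *m invmx T)) =
    (torsion_part W d i, cayley_vertex (cl i)).
  congr (_, _); first by apply/rowP => z; rewrite !mxE.
  rewrite homogenize_exponent -clT -row_mul mulmxV // row1 /cayley_vertex.
  apply/rowP => z; rewrite !mxE eqxx /=; have [b' ->|->] := unliftP ord0 (cl i).
    by rewrite !mxE (inj_eq lift_inj) eqxx.
  by rewrite !mxE eq_sym (negPf (neq_lift _ _)).
apply/seteqP; split=> [_ [_ [i _ <-] <-]|[p q] [b /= [/AP[i ib ->] ->]]].
  by rewrite phiE; exists (cl i); split=> //; apply/AP; exists i.
by exists (exponent i); [exists i | rewrite phiE ib].
Qed.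

End CayleyDecomposition.

(** * Coordinates adapted to the lattice of the Gauss map *)

Section Coordinates.
Variables (n N : nat) (M : zmodType) (u : 'I_N.+1 -> M).

(** Row i is (1, u_i), in the coordinates g of M. *)
Definition coord_mx (g : M -> 'rV[int]_n) : 'M[int]_(N.+1, n.+1) :=
  \matrix_(i, j) (if unlift ord0 j is Some j' then g (u i) 0 j' else 1).

Lemma coord_mx0 g i : coord_mx g i ord0 = 1.
Proof. by rewrite mxE unlift_none. Qed.

Lemma coord_mxS g i j : coord_mx g i (lift ord0 j) = g (u i) 0 j.
Proof. by rewrite mxE liftK. Qed.

(** A vector (1, v) is an integral combination of the rows because v is in
    Aff(A), and differences of two such vectors give the (0, v). *)
Lemma coord_mx_left_inverse (f : {additive 'rV[int]_n -> M}) (g : {additive M -> 'rV[int]_n}) :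
  cancel f g -> affZ u = setT -> exists S, S *m coord_mx g = 1%:M.
Proof.
move=> fK uT; have aff v : exists a : 'I_N.+1 -> int, \sum_i a i = 1 /\ v = \sum_i u i *~ a i.
  by have : affZ u v by rewrite uT.
have /choice[a aP] := aff.
pose S : 'M[int]_(n.+1, N.+1) := \matrix_(j, i)
  (if unlift ord0 j is Some j' then a (f (delta_mx 0 j')) i - a 0 i else a 0 i).
exists S; apply/matrixP => j j'; rewrite mxE [RHS]mxE.
have ga v z : \sum_i a v i * g (u i) 0 z = g v 0 z.
  rewrite {2}(proj2 (aP v)) raddf_sum summxE; apply: eq_bigr => i _.
  by rewrite raddfMz -scaler_int intz mxE.
have [z' ->|->] := unliftP ord0 j'; have [z ->|->] := unliftP ord0 j.
- under eq_bigr do rewrite mxE liftK coord_mxS mulrBl.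
  by rewrite sumrB !ga fK raddf0 !mxE subr0 eqxx /= eq_sym (inj_eq lift_inj).
- under eq_bigr do rewrite mxE unlift_none coord_mxS.
  by rewrite ga raddf0 mxE (negPf (neq_lift _ _)).
- under eq_bigr do rewrite mxE liftK coord_mx0 mulr1.
  by rewrite sumrB !(proj1 (aP _)) subrr eq_sym (negPf (neq_lift _ _)).
- under eq_bigr do rewrite mxE unlift_none coord_mx0 mulr1.
  by rewrite (proj1 (aP _)) eqxx.
Qed.

(** The change of coordinates R on M, extended to Z x M by the identity. *)
Definition affine_mx (R : 'M[int]_n) : 'M[int]_n.+1 := \matrix_(i, j)
  (if unlift ord0 i is Some i' then if unlift ord0 j is Some j' then R i' j' else 0
   else (j == ord0)%:R).

Lemma affine_mx_mul p (B : 'M[int]_(p, n.+1)) R i :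
  (B *m affine_mx R) i ord0 = B i ord0 /\
  forall j, (B *m affine_mx R) i (lift ord0 j) = \sum_a B i (lift ord0 a) * R a j.
Proof.
split=> [|j]; rewrite mxE big_ord_recl mxE unlift_none.
  rewrite eqxx mulr1 big1 ?addr0 // => a _.
  by rewrite mxE liftK unlift_none mulr0.
rewrite eq_sym (negPf (neq_lift _ _)) mulr0 add0r; apply: eq_bigr => a _.
by rewrite mxE !liftK.
Qed.

Lemma affine_mx_unit R : R \in unitmx -> affine_mx R \in unitmx.
Proof.
move=> Ru; have : affine_mx R *m affine_mx (invmx R) = 1%:M; last by case/mulmx1_unit.
apply/matrixP => i j; have [h0 hS] := affine_mx_mul (affine_mx R) (invmx R) i.
have [j' ->|->] := unliftP ord0 j; last first.
  by rewrite h0 !mxE unlift_none; have [i' ->|->] := unliftP ord0 i; rewrite ?liftK ?unlift_none.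
rewrite hS mxE; have [i' ->|->] := unliftP ord0 i.
  have /matrixP/(_ i' j') := mulmxV Ru; rewrite !mxE (inj_eq lift_inj) => <-.
  by apply: eq_bigr => a _; rewrite mxE !liftK.
rewrite (negPf (neq_lift _ _)) big1 // => a _.
by rewrite mxE unlift_none eq_sym (negPf (neq_lift _ _)) mul0r.
Qed.

Lemma coord_mx_affine g (R : 'M[int]_n) :
  coord_mx (fun v => g v *m R) = coord_mx g *m affine_mx R.
Proof.
apply/matrixP => i j; have [h0 hS] := affine_mx_mul (coord_mx g) R i.
have [j' ->|->] := unliftP ord0 j; last by rewrite h0 !coord_mx0.
by rewrite hS coord_mxS mxE; apply: eq_bigr => a _; rewrite coord_mxS.
Qed.

End Coordinates.

Section AdaptedBasis.
Variables (k : closedFieldType) (n N : nat) (W : 'M[int]_(N.+1, n.+1)).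
Hypothesis W0 : forall i, W i ord0 = 1.
Variable J0 : 'I_n.+1 -> 'I_N.+1.

Lemma basis_mul J (Q : 'M[int]_n.+1) : Q \in unitmx -> basis k (W *m Q) J = basis k W J.
Proof.
move=> Qu; rewrite /basis (_ : rowsub J _ = rowsub J (base_change k W) *m map_mx intr Q).
  rewrite det_mulmx mulf_eq0 negb_or det_map_mx.
  have -> : (\det Q)%:~R != 0 :> k by rewrite -unitfE rmorph_unit // -unitmxE.
  by rewrite andbT.
by rewrite mul_rowsub_mx -map_mxM.
Qed.

Lemma weight_sum_mul J (Q : 'M[int]_n.+1) : weight_sum (W *m Q) J = weight_sum W J *m Q.
Proof. by rewrite /weight_sum mulmx_suml; apply: eq_bigr => a _; rewrite row_mul. Qed.

(** Smith normal form G = L D R of the matrix G of the differences of sums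
    over bases, in the last n coordinates: after multiplication by the inverse
    of R the lattice is generated by the rows of L D, equivalently by those of
    D. *)
Lemma adapted_basis : exists2 R : 'M[int]_n, R \in unitmx &
  exists d, lattice_divisors k (W *m affine_mx R) J0 d.
Proof.
pose p := #|{ffun 'I_n.+1 -> 'I_N.+1}|.
pose Jx (x : 'I_p) : {ffun 'I_n.+1 -> 'I_N.+1} := enum_val x.
have JxK J : Jx (enum_rank J) = J by rewrite /Jx enum_rankK.
pose G : 'M[int]_(p, n) := \matrix_(x, j)
  (if basis k W (Jx x) then (weight_sum W (Jx x) - weight_sum W J0) ord0 (lift ord0 j) else 0).
have [L Lu [R Ru [e _ GE]]] := int_Smith_normal_form G.
set D := (\matrix_(i, j) _) in GE.
exists (invmx R); first by rewrite unitmx_inv.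
(* columns of D beyond its last row are zero *)
pose d (j : 'I_n) := if (j < p)%N then e`_j else 0.
have Qu := affine_mx_unit (_ : invmx R \in unitmx); rewrite unitmx_inv in Qu.
move/(_ Ru): Qu => Qu.
exists d; set W' := W *m _; have GR : G *m invmx R = L *m D by rewrite GE mulmxK.
have w'E J J' : weight_sum W' J - weight_sum W' J' =
  (weight_sum W J - weight_sum W J') *m affine_mx (invmx R).
  by rewrite !weight_sum_mul mulmxBl.
have w'0 J J' : (weight_sum W' J - weight_sum W' J') ord0 ord0 = 0.
  by rewrite w'E (proj1 (affine_mx_mul _ _ _)) mxE [X in _ + X]mxE !(weight_sum0 W0) subrr.
have w'S (J : {ffun _}) j : basis k W J ->
    (weight_sum W' J - weight_sum W' J0) ord0 (lift ord0 j) = (L *m D) (enum_rank J) j.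
  move=> bJ; rewrite w'E (proj2 (affine_mx_mul _ _ _)) -GR mxE.
  by apply: eq_bigr => a _; congr (_ * _); rewrite [RHS]mxE JxK bJ.
have bE J : basis k W' J = basis k W J by apply: basis_mul.
have dvdL i j : (d j %| (L *m D) i j)%Z.
  rewrite mxE; apply: rpred_sum => x _; apply: dvdz_mull; rewrite mxE /d.
  case: eqP => [xj|_]; last by rewrite mulr0n dvdz0.
  by rewrite -xj ltn_ord mulr1n dvdzz.
split=> [J J' bJ bJ' j|j].
  have dJ J1 : basis k W' J1 -> (d j %| (weight_sum W' J1 - weight_sum W' J0) ord0 (lift ord0 j))%Z.
    move=> bJ1; have fE : finfun J1 =1 J1 by move=> a; rewrite ffunE.
    have wE : weight_sum W' (finfun J1) = weight_sum W' J1 by apply: eq_bigr => a _; rewrite fE.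
    rewrite -wE w'S ?dvdL // -bE.
    rewrite /basis (_ : rowsub _ _ = rowsub J1 (base_change k W')) //.
    by apply/matrixP => a b; rewrite !mxE fE.
  have -> : weight_sum W' J - weight_sum W' J' =
    (weight_sum W' J - weight_sum W' J0) - (weight_sum W' J' - weight_sum W' J0).
    by rewrite opprB addrA subrK.
  by rewrite mxE [X in _ + X]mxE rpredB ?dJ.
have [jp|jp] := boolP (j < p)%N; last first.
  exists (fun=> 0); split=> [J|]; first by rewrite eqxx.
  by rewrite /d (negPf jp) scale0r big1 // => J _; rewrite scale0r.
exists (fun J : {ffun 'I_n.+1 -> 'I_N.+1} => if basis k W J then invmx L (Ordinal jp) (enum_rank
  J) else 0); split.
  by move=> J; rewrite bE; case: ifP => //; rewrite eqxx.
have DE : D = invmx L *m (L *m D) by rewrite mulKmx.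
apply/rowP => z; rewrite summxE; have [z' ->|->] := unliftP ord0 z; last first.
  rewrite !mxE (negPf (neq_lift _ _)) andbF mulr0 big1 // => J _.
  by rewrite mxE w'0 mulr0.
have -> : (d j *: delta_mx 0 (lift ord0 j) : 'rV[int]_n.+1) 0 (lift ord0 z') = D (Ordinal jp) z'.
  rewrite !mxE eqxx (inj_eq lift_inj) /d jp /= -val_eqE /= eq_sym.
  by case: eqP => _; rewrite ?mulr1 ?mulr0.
rewrite DE mxE (reindex (@enum_rank _)) /=; last exact/onW_bij/enum_rank_bij.
apply: eq_bigr => J _; rewrite [RHS]mxE; case: ifPn => bJ; first by rewrite w'S.
rewrite mul0r -GR [X in _ * X]mxE big1 ?mulr0 // => a _.
by rewrite [G _ _]mxE JxK (negPf bJ) mul0r.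
Qed.

End AdaptedBasis.

Section ToricPointsOfVariety.
Variables (k : closedFieldType) (n N : nat) (M : zmodType) (u : 'I_N.+1 -> M).
Variables (f : {additive 'rV[int]_n -> M}) (g : {additive M -> 'rV[int]_n}).
Hypothesis gK : cancel g f.

(** A point of T_M is determined by its values on a basis of M. *)
Lemma toric_image_torus_points :
  toric_image (k := k) u = torus_points (coord_mx u g).
Proof.
apply/seteqP; split=> x.
  move=> [c [t [c0 tt ->]]].
  exists (torus_coord c (fun j => t (f (delta_mx 0 j)))).
    by apply: torus_coord_nonzero => // j; apply: torus_neq0 tt.
  apply/rowP => i; rewrite monomial_pointE; last exact: coord_mx0.
  rewrite torus_coord0 !mxE -{1}[u i]gK (torus_basis _ _ tt); congr (_ * _).
  by apply: eq_bigr => j _; rewrite torus_coordS coord_mxS.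
move=> [s s0 ->]; exists (s ord0), (fun v => mon (g v) (fun j => s (lift ord0 j))).
split=> //.
  by split=> [|v w]; [rewrite raddf0 mon0 | rewrite raddfD monD // => j; apply: s0].
apply/rowP => i; rewrite monomial_pointE; last exact: coord_mx0.
by rewrite !mxE; congr (_ * _); apply: eq_bigr => j _; rewrite coord_mxS.
Qed.

End ToricPointsOfVariety.

(** * Structure of toric varieties with separable Gauss map *)

(** Pluecker coordinates are indexed by the dimension of X, which is now
    identified with n. *)
Lemma separable_divisors_unit (k : closedFieldType) (N : nat) (X : proj_variety k N) (n : nat)
    (W : 'M[int]_(N.+1, n.+1)) (W0 : forall i, W i ord0 = 1)
    (S : 'M[int]_(n.+1, N.+1)) (SW : S *m W = 1%:M)
    (XE : pv_set X = proj_closure (torus_points W)) (d : 'I_n -> int)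
    (J0 : 'I_n.+1 -> 'I_N.+1) (bJ0 : basis k W J0)
    (hd : lattice_divisors k W J0 d) :
  gauss_separable X -> forall j, d j != 0 -> (d j)%:~R != 0 :> k.
Proof.
have nE := esym (dimension_toric W0 SW XE); subst n.
exact: (separable_elementary_divisors W0 SW XE bJ0 hd).
Qed.

Theorem theorem4p8 (k : closedFieldType) (n N : nat) (M : zmodType)
    (hM : free_of_rank M n) (u : 'I_N.+1 -> M) (u_inj : injective u)
    (u_aff : affZ u = setT)
    (sep : gauss_separable (toric_variety k u hM))
    (l : nat) (hl : l = gauss_defect (toric_variety k u hM)) :
  exists (A : 'I_l.+1 -> {fset 'rV[int]_(n - l)}) (d : 'I_l.+1 -> nat),
    (forall j, affine_dim (affK k (A j)) (d j)) /\
    (\sum_j d j)%N = (n - l)%N /\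
    exists phi : M -> 'rV[int]_(n - l) * 'rV[int]_l,
      affine_iso phi /\ phi @` range u = cayley_sum A.
Proof.
have [f [g0 fK gK]] := hM.
have g0D : {morph g0 : x y / x - y}.
  by move=> x y; apply: (can_inj fK); rewrite raddfB !gK.
pose g : {additive M -> 'rV[int]_n} := HB.pack g0 (GRing.isZmodMorphism.Build _ _ g0 g0D).
have [S0 SW0] := coord_mx_left_inverse (g := g) fK u_aff.
have [J0 bJ0] := basis_exists k SW0.
have [R Ru [d hd]] := adapted_basis k (coord_mx0 u g) J0.
pose g1 v := g v *m R; pose f1 w := f (w *m invmx R).
have g1D : {morph g1 : x y / x - y} by move=> x y; rewrite /g1 raddfB mulmxBl.
have f1D : {morph f1 : x y / x - y} by move=> x y; rewrite /f1 mulmxBl raddfB.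
pose g' : {additive M -> 'rV[int]_n} := HB.pack g1 (GRing.isZmodMorphism.Build _ _ g1 g1D).
pose f' : {additive 'rV[int]_n -> M} := HB.pack f1 (GRing.isZmodMorphism.Build _ _ f1 f1D).
have fK' : cancel f' g'.
  by move=> w; transitivity (g0 (f (w *m invmx R)) *m R); rewrite // fK mulmxKV.
have gK' : cancel g' f'.
  by move=> v; transitivity (f (g0 v *m R *m invmx R)); rewrite // mulmxK // gK.
pose W := coord_mx u g'.
have WE : W = coord_mx u g *m affine_mx R by rewrite /W coord_mx_affine.
have W0 : forall i, W i ord0 = 1 := coord_mx0 u g'.
have [S SW] := coord_mx_left_inverse fK' u_aff.
rewrite -WE in hd.
have bW : basis k W J0 by rewrite WE basis_mul // affine_mx_unit.
have XE : pv_set (toric_variety k u hM) = proj_closure (torus_points W).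
  by rewrite /= /toric_set (toric_image_torus_points k u gK').
have d_unit := separable_divisors_unit W0 SW XE bW hd sep.
rewrite (gauss_defect_toric W0 SW bW hd XE) in hl; subst l.
have rE : (n - #|free_coord d|)%N = #|[predC free_coord d]|.
  by rewrite -{1}(card_free d) addKn.
rewrite rE.
have [A [dm [Adim dsum [phi [[h [c [hbij phiE]]] phiA]]]]] :=
  cayley_decomposition W0 SW bW hd d_unit.
exists A, dm; split=> //; split=> //; exists (fun v => phi (g' v)); split.
  exists (h \o g' : {additive M -> _}), c.
  split=> [|v]; last by rewrite phiE.
  by apply: bij_comp hbij _; exists f'.
rewrite -phiA; have expE i : exponent W i = g' (u i).
  by apply/rowP => j; rewrite mxE coord_mxS.
apply/seteqP; split=> _ [_ [i _ <-] <-].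
  by exists (g' (u i)) => //; exists i.
by exists (u i); [exists i | rewrite -expE].
Qed.
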